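(* Let $\Gamma\ltimes\mathbb H(\tilde{\mathcal R},k)$ be an extended graded Hecke algebra with complex parameters $k_\alpha\in\mathbb C$. For $n>\dim_{\mathbb C}(\mathfrak t^* )$ we have $$HP_n\big(\Gamma\ltimes\mathbb H(\tilde{\mathcal R},k)\big)\cong HC_n\big(\Gamma\ltimes\mathbb H(\tilde{\mathcal R},k)\big)\cong HC_n\big(\mathbb C[\Gamma\ltimes W]\big).$$ The inclusion $\mathbb C[\Gamma\ltimes W]\to\Gamma\ltimes\mathbb H(\tilde{\mathcal R},k)$ induces an isomorphism on periodic cyclic homology.
   Context: Let $\mathfrak a$ be a finite dimensional real inner product space with dual $\mathfrak a^*$, let $R\subset\mathfrak a^*$ be a reduced root system with dual root system $R^\vee\subset\mathfrak a$ and basis $\Pi$; $\tilde{\mathcal R}=(\mathfrak a^*,R,\mathfrak a,R^\vee,\Pi)$ is called a degenerate root datum. It is not assumed that $R$ is crystallographic, nor that $\Pi$ spans $\mathfrak a^*$ ($R$ may be empty). The Weyl group $W$ of $R$ is generated by $s_\alpha$, $\alpha\in\Pi$, with $s_\alpha(x)=x-\langle x,\alpha^\vee\rangle\alpha$; it acts orthogonally. $\mathfrak t,\mathfrak t^*$ are the complexifications of $\mathfrak a,\mathfrak a^*$. Choose $k_\alpha\in\mathbb C$ ($\alpha\in\Pi$) with $k_\alpha=k_\beta$ if $\alpha,\beta$ are $W$-conjugate. The graded Hecke algebra $\mathbb H(\tilde{\mathcal R},k)$ is the associative unital $\mathbb C$-algebra which as a vector space is $\mathbb C[W]\otimes S(\mathfrak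 t^* )$, in which $\mathbb C[W]$ and $S(\mathfrak t^* )$ are embedded as subalgebras, with cross relations $x\cdot s_\alpha-s_\alpha\cdot s_\alpha(x)=k_\alpha\langle x,\alpha^\vee\rangle$ for $x\in\mathfrak t^*$, $\alpha\in\Pi$. A diagram automorphism of $(R,\Pi)$ is a bijection $\gamma:\Pi\to\Pi$ with $\langle\gamma(\alpha),\gamma(\beta)^\vee\rangle=\langle\alpha,\beta^\vee\rangle$ for all $\alpha,\beta\in\Pi$; it induces automorphisms of $R,R^\vee,W$, and it is assumed to come with an extension of its action on the span of the coroots to an orthogonal linear map of $\mathfrak a$ (extended complex-linearly to $\mathfrak t$). Let $\Gamma$ be a finite group of such diagram automorphisms (acting by a group action on $\mathfrak a$) with $k_{\gamma(\alpha)}=k_\alpha$ for all $\gamma\in\Gamma,\alpha\in\Pi$. Then $\Gamma$ acts on $\mathbb H(\tilde{\mathcal R},k)$ by algebra automorphisms $\psi_\gamma$ with $\psi_\gamma(x s_\alpha)=\gamma(x)s_{\gamma(\alpha)}$ ($x\in\mathfrak t^*,\alpha\in\Pi$), and the crossed product $\Gamma\ltimes\mathbb H(\tilde{\mathcal R},k)$ is called an extended graded Hecke algebra. It contains $\mathbb C[\Gamma\ltimes W]$. All homologies are those of algebras over $\mathbb C$. *)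

(* Defs.v *)
From HB Require Import structures.
From mathcomp Require Import all_boot all_order all_algebra all_fingroup.
From mathcomp Require Import generic_quotient complex boolp reals freeg mpoly.

Set Implicit Arguments.
Unset Strict Implicit.
Unset Printing Implicit Defensive.

Import GRing.Theory.
Local Open Scope ring_scope.
Local Open Scope quotient_scope.

Section QuotientSpace.
Variables (K : fieldType) (V : lmodType K) (S : submodClosed V).

Lemma submodN (x : V) : (- x \in S) = (x \in S).
Proof.
have N y : y \in S -> - y \in S by move=> yS; rewrite -scaleN1r rpredZ.
by apply/idP/idP=> /N //; rewrite opprK.
Qed.

Definition quot_equiv (x y : V) : bool := x - y \in S.

Lemma quot_equiv_is_equiv : equiv_class_of quot_equiv.
Proof.
split=> [x|x y|y x z]; rewrite /quot_equiv.
- by rewrite subrr rpred0.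
- by rewrite -[y - x]opprB submodN.
- by move=> xy yz; have <- : (x - y) + (y - z) = x - z; [rewrite addrA subrK | apply: rpredD].
Qed.

Canonical quot_equiv_rel := EquivRelPack quot_equiv_is_equiv.
Canonical quot_encModRel := defaultEncModRel quot_equiv.

Definition quot := {eq_quot quot_equiv}.
#[export] HB.instance Definition _ : EqQuotient V quot_equiv quot :=
  EqQuotient.on quot.
#[export] HB.instance Definition _ := Choice.on quot.

Lemma quot_eqE (x y : V) : (\pi_quot x == \pi_quot y) = (x - y \in S).
Proof. by rewrite piE. Qed.

Lemma quot_eqP (x y : V) : reflect (\pi_quot x = \pi_quot y) (x - y \in S).
Proof. by rewrite -quot_eqE; apply: eqP. Qed.

Definition quot_add (x y : quot) : quot := \pi_quot (repr x + repr y).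
Definition quot_opp (x : quot) : quot := \pi_quot (- repr x).
Definition quot_scale (c : K) (x : quot) : quot := \pi_quot (c *: repr x).

Lemma repr_piB (x : V) : repr (\pi_quot x) - x \in S.
Proof. by apply/quot_eqP; rewrite reprK. Qed.

Lemma pi_quotD (x y : V) : \pi_quot (x + y) = quot_add (\pi_quot x) (\pi_quot y).
Proof.
apply/esym/quot_eqP; rewrite opprD addrACA; exact: rpredD (repr_piB x) (repr_piB y).
Qed.

Lemma pi_quotN (x : V) : \pi_quot (- x) = quot_opp (\pi_quot x).
Proof. by apply/esym/quot_eqP; rewrite -opprD submodN repr_piB. Qed.

Lemma pi_quotZ c (x : V) : \pi_quot (c *: x) = quot_scale c (\pi_quot x).
Proof. by apply/esym/quot_eqP; rewrite -scalerBr rpredZ // repr_piB. Qed.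

Lemma quot_addA : associative quot_add.
Proof. by elim/quotW=> x; elim/quotW=> y; elim/quotW=> z; rewrite -(pi_quotD y z) -(pi_quotD x y) -!pi_quotD addrA. Qed.
Lemma quot_addC : commutative quot_add.
Proof. by elim/quotW=> x; elim/quotW=> y; rewrite -(pi_quotD x y) -(pi_quotD y x) addrC. Qed.
Lemma quot_add0 : left_id (\pi_quot 0) quot_add.
Proof. by elim/quotW=> x; rewrite -!pi_quotD add0r. Qed.
Lemma quot_addN : left_inverse (\pi_quot 0) quot_opp quot_add.
Proof. by elim/quotW=> x; rewrite -pi_quotN -pi_quotD addNr. Qed.

#[export] HB.instance Definition _ :=
  GRing.isZmodule.Build quot quot_addA quot_addC quot_add0 quot_addN.

Lemma quot_scaleA a b (v : quot) :
  quot_scale a (quot_scale b v) = quot_scale (a * b) v.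
Proof. by elim/quotW: v => x; rewrite -(pi_quotZ b x) -!pi_quotZ scalerA. Qed.
Lemma quot_scale1 : left_id 1 quot_scale.
Proof. by elim/quotW=> x; rewrite -!pi_quotZ scale1r. Qed.
Lemma quot_scaleDr : right_distributive quot_scale +%R.
Proof.
move=> a; elim/quotW=> x; elim/quotW=> y.
rewrite -[_ + _]/(quot_add _ _) -[_ + _]/(quot_add _ _) -(pi_quotD x y).
by rewrite -(pi_quotZ a x) -(pi_quotZ a y) -pi_quotZ -pi_quotD scalerDr.
Qed.
Lemma quot_scaleDl (v : quot) : {morph quot_scale^~ v : a b / a + b}.
Proof.
move=> a b; elim/quotW: v => x.
rewrite -[RHS]/(quot_add _ _) -(pi_quotZ a x) -(pi_quotZ b x) -pi_quotZ.
by rewrite -pi_quotD scalerDl.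
Qed.

#[export] HB.instance Definition _ := GRing.Zmodule_isLmodule.Build K quot
  quot_scaleA quot_scale1 quot_scaleDr quot_scaleDl.

Definition quot_pi : V -> quot := \pi_quot.

Lemma quot_pi_is_linear : linear quot_pi.
Proof. by move=> c x y; rewrite /quot_pi pi_quotD pi_quotZ. Qed.

#[export] HB.instance Definition _ :=
  GRing.isLinear.Build K V quot *:%R quot_pi quot_pi_is_linear.

Section Lift.
Variables (U : lmodType K) (f : {linear V -> U}).
Hypothesis f0 : forall x, x \in S -> f x = 0.

Definition quot_lift_fun (f0 : forall x, x \in S -> f x = 0) (x : quot) : U :=
  f (repr x).

Lemma quot_liftE x : quot_lift_fun f0 (quot_pi x) = f x.
Proof. by apply/eqP; rewrite -subr_eq0 -linearB f0 // repr_piB. Qed.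

Lemma quot_lift_is_linear : linear (quot_lift_fun f0).
Proof.
move=> c; elim/quotW=> x; elim/quotW=> y; rewrite -!/(quot_pi _).
by rewrite -linearP !quot_liftE linearP.
Qed.

HB.instance Definition _ :=
  GRing.isLinear.Build K quot U *:%R (quot_lift_fun f0) quot_lift_is_linear.

Definition quot_lift : {linear quot -> U} := quot_lift_fun f0.
End Lift.
End QuotientSpace.

Section Subspace.
Variables (K : fieldType) (V : lmodType K) (S : submodClosed V).

Record subspace := Subspace { subspace_val :> V; _ : subspace_val \in S }.
#[export] HB.instance Definition _ := [isSub for subspace_val].
#[export] HB.instance Definition _ := [Choice of subspace by <:].
#[export] HB.instance Definition _ := [SubChoice_isSubLmodule of subspace by <:].
End Subspace.

Section Generated.
Variables (K : fieldType) (V : lmodType K) (P : V -> Prop).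

Definition generated_submod : {pred V} :=
  fun x => `[< forall S : submodClosed V, (forall y, P y -> y \in S) -> x \in S >].

Lemma generated_submod_closed : submod_closed generated_submod.
Proof.
split=> [|c x y /asboolP gx /asboolP gy]; apply/asboolP=> S PS.
  exact: rpred0.
by rewrite rpredD ?rpredZ //; [apply: gx | apply: gy].
Qed.

#[export] HB.instance Definition _ :=
  GRing.isSubmodClosed.Build K V generated_submod generated_submod_closed.
End Generated.

Section Kernel.
Variables (K : fieldType) (V U : lmodType K) (f : {linear V -> U}).
Definition kernel_of : {pred V} := fun x => f x == 0.
Lemma kernel_submod_closed : submod_closed kernel_of.
Proof.
split=> [|c x y]; rewrite !unfold_in /= ?linear0 // => /eqP fx /eqP fy.
by rewrite linearP fx fy scaler0 addr0.
Qed.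
HB.instance Definition _ :=
  GRing.isSubmodClosed.Build K V kernel_of kernel_submod_closed.
End Kernel.

Section FreeLift.
Variables (K : fieldType) (T : choiceType) (U : lmodType K) (f : T -> U).

Definition free_lift_fun : {freeg T / K} -> U := fglift f.

HB.instance Definition _ :=
  GRing.isZmodMorphism.Build {freeg T / K} U (fglift f) (lift_is_additive f).

Lemma free_lift_is_linear : linear free_lift_fun.
Proof.
move=> c x y; rewrite /free_lift_fun raddfD; congr (_ + _).
have fE : fglift f x = \sum_(t <- dom x) coeff t x *: f t.
  by rewrite -[in LHS](freeg_sumE x) raddf_sum; apply: eq_bigr => t _; rewrite /= liftU.
have -> : c *: x = \sum_(t <- dom x) << c * coeff t x *g t >> by [].
rewrite fE scaler_sumr raddf_sum; apply: eq_bigr => t _ /=.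
by rewrite liftU scalerA.
Qed.

HB.instance Definition _ :=
  GRing.isLinear.Build K {freeg T / K} U *:%R free_lift_fun free_lift_is_linear.

Definition free_lift : {linear {freeg T / K} -> U} := free_lift_fun.

Lemma free_liftE t : free_lift << t >> = f t.
Proof. by rewrite /= /free_lift_fun liftU scale1r. Qed.
End FreeLift.

Section Tensor.
Variables (K : fieldType) (A : lmodType K).
Implicit Types n : nat.

Definition update n (a : {ffun 'I_n -> A}) (i : 'I_n) (x : A) : {ffun 'I_n -> A} :=
  [ffun j => if j == i then x else a j].

Definition multilinear n (U : lmodType K) (f : {ffun 'I_n -> A} -> U) : Prop :=
  forall a i c x y, f (update a i (c *: x + y)) = c *: f (update a i x) + f (update a i y).

Definition tensor_relator n (z : {freeg {ffun 'I_n -> A} / K}) : Prop :=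
  exists a i c x y,
    z = << update a i (c *: x + y) >> - c *: << update a i x >> - << update a i y >>.

Definition tensor n := quot (generated_submod (@tensor_relator n)).

#[export] HB.instance Definition _ n := GRing.Lmodule.on (tensor n).

Definition pure_tensor n (a : {ffun 'I_n -> A}) : tensor n := quot_pi _ << a >>.

Lemma pure_multilinear n : multilinear (@pure_tensor n).
Proof.
move=> a i c x y; apply/eqP; rewrite /pure_tensor -linearP -subr_eq0 -linearB /=.
rewrite -(linear0 (quot_pi (generated_submod (@tensor_relator n)))) /quot_pi quot_eqE subr0.
apply/asboolP=> S; apply; exists a, i, c, x, y.
by rewrite opprD addrA.
Qed.

Section TensorLift.
Variables (n : nat) (U : lmodType K) (f : {ffun 'I_n -> A} -> U).
Hypothesis fL : multilinear f.

Lemma tensor_lift_subproof (z : {freeg {ffun 'I_n -> A} / K}) :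
  z \in generated_submod (@tensor_relator n) -> free_lift f z = 0.
Proof.
move=> /asboolP /(_ (kernel_of (free_lift f))) kz; apply/eqP; apply: kz => y.
move=> [a [i [c [u [v ->]]]]]; rewrite unfold_in.
by rewrite !linearB linearZ !free_liftE fL -addrA -opprD subrr.
Qed.

Definition tensor_lift : {linear tensor n -> U} := quot_lift tensor_lift_subproof.

Lemma tensor_liftE a : tensor_lift (pure_tensor a) = f a.
Proof. exact: etrans (quot_liftE tensor_lift_subproof _) (free_liftE f a). Qed.
End TensorLift.

Lemma tensor_eq n (U : lmodType K) (f g : {linear tensor n -> U}) :
  (forall a, f (pure_tensor a) = g (pure_tensor a)) -> f =1 g.
Proof.
move=> fg; elim/quotW=> z; rewrite -/(quot_pi _ z) -[z]freeg_sumE !raddf_sum.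
apply: eq_bigr => a _; move: (coeff a z) => d.
have -> : << d *g a >> = d *: << a >> :> {freeg {ffun 'I_n -> A} / K}.
  by apply/eqP/freeg_eqP=> s; rewrite coeffZ !coeffU mul1r.
by rewrite /= !linearZ -/(pure_tensor a) /= fg.
Qed.
End Tensor.

Lemma pure_comp_multilinear (K : fieldType) (A B : lmodType K) m n
    (g : {ffun 'I_m -> A} -> {ffun 'I_n -> B}) :
  (forall a i, exists b j (phi : A -> B), linear phi /\
     forall x, g (update a i x) = update b j (phi x)) ->
  multilinear (fun a => pure_tensor (g a)).
Proof.
move=> gP a i c x y; have [b [j [phi [phiL gE]]]] := gP a i.
by rewrite !gE phiL pure_multilinear.
Qed.

Section Hochschild.
Variables (K : fieldType) (A : algType K).
Implicit Types n q : nat.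

(* The (n+1)-st tensor power of A: unnormalized Hochschild chains of degree n. *)
Definition hoch n := tensor A n.+1.
#[export] HB.instance Definition _ n := GRing.Lmodule.on (hoch n).

Definition merge_at n (i : 'I_n.+1) (a : {ffun 'I_n.+2 -> A}) : {ffun 'I_n.+1 -> A} :=
  [ffun j : 'I_n.+1 =>
    if (j < i)%N then a (widen_ord (leqnSn n.+1) j)
    else if j == i then a (widen_ord (leqnSn n.+1) j) * a (fintype.lift ord0 j)
    else a (fintype.lift ord0 j)].

Definition rotate_ffun n (a : {ffun 'I_n.+1 -> A}) : {ffun 'I_n.+1 -> A} :=
  [ffun j => a (ord_pred j)].

Definition prepend1 n (a : {ffun 'I_n.+1 -> A}) : {ffun 'I_n.+2 -> A} :=
  [ffun j => if unlift ord0 j is Some k then a k else 1].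

Lemma merge_multilinear n (i : 'I_n.+1) : multilinear (fun a => pure_tensor (merge_at i a)).
Proof.
apply: pure_comp_multilinear => a l.
have lE (j : 'I_n.+1) : (fintype.lift ord0 j == l) = (j.+1 == l :> nat) by [].
have wE (j : 'I_n.+1) : (widen_ord (leqnSn n.+1) j == l) = (j == l :> nat) by [].
have [li|il] := leqP l i.
  have ln : (l < n.+1)%N by apply: leq_ltn_trans li (ltn_ord i).
  exists (merge_at i a), (Ordinal ln),
    (fun x => if l == i :> nat then x * a (fintype.lift ord0 i) else x).
  split=> [c x y|x]; first by case: ifP; rewrite // mulrDl scalerAl.
  apply/ffunP=> j; rewrite !ffunE lE wE -2!(inj_eq val_inj j) /=.
  have [jl|jl] := eqVneq (val j) l.
    rewrite -jl in li *; have -> : (j.+1 == j :> nat) = false by rewrite gtn_eqF.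
    case: (ltngtP j i) li => // ji _.
        by congr (_ * a _); apply: val_inj; rewrite /= ji.
  by case: (ltngtP j i) => // ji; rewrite gtn_eqF // ltnS (leq_trans li) // ?ji // ltnW.
have l0 : (0 < l)%N by apply: leq_ltn_trans il.
have ln : (l.-1 < n.+1)%N by rewrite -ltnS prednK.
exists (merge_at i a), (Ordinal ln),
  (fun x => if l == i.+1 :> nat then a (widen_ord (leqnSn n.+1) i) * x else x).
split=> [c x y|x]; first by case: ifP; rewrite // mulrDr scalerAr.
apply/ffunP=> j; rewrite !ffunE lE wE -2!(inj_eq val_inj j) /= -[val j == l.-1]eqSS prednK //.
have [jl|jl] := eqVneq j.+1 l.
  rewrite -jl in il *; rewrite eqSS ltnS in il *.
  have -> : (j == j.+1 :> nat) = false by rewrite ltn_eqF.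
  rewrite ltnNge il /=; case: eqP => // ji.
  by congr (a _ * _); apply: val_inj.
case: (ltngtP j i) => // ji; rewrite ltn_eqF // ?ji // (ltn_trans ji) //.
Qed.

Lemma rotate_multilinear n : multilinear (fun a => pure_tensor (@rotate_ffun n a)).
Proof.
apply: pure_comp_multilinear => a l; exists (rotate_ffun a), (ordS l), id; split=> // x.
apply/ffunP=> j; rewrite !ffunE; congr (if _ then _ else _).
by apply/eqP/eqP => [<-|->]; rewrite (ord_predK, ordSK).
Qed.

Lemma prepend1_multilinear n : multilinear (fun a => pure_tensor (@prepend1 n a)).
Proof.
apply: pure_comp_multilinear => a l.
exists (prepend1 a), (fintype.lift ord0 l), id; split=> // x.
apply/ffunP=> j; rewrite !ffunE; case: unliftP => [k ->|->].
  by rewrite ffunE (inj_eq lift_inj).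
by rewrite (negPf (neq_lift _ _)) ?ffunE ?unlift_none.
Qed.

Definition hoch_merge n (i : 'I_n.+1) : {linear hoch n.+1 -> hoch n} :=
  tensor_lift (merge_multilinear i).
Definition hoch_rotate n : {linear hoch n -> hoch n} :=
  tensor_lift (@rotate_multilinear n).
Definition hoch_prepend1 n : {linear hoch n -> hoch n.+1} :=
  tensor_lift (@prepend1_multilinear n).

Lemma hoch_mergeE n (i : 'I_n.+1) a : hoch_merge i (pure_tensor a) = pure_tensor (merge_at i a).
Proof. exact: tensor_liftE. Qed.
Lemma hoch_rotateE n a : hoch_rotate n (pure_tensor a) = pure_tensor (rotate_ffun a).
Proof. exact: tensor_liftE. Qed.
Lemma hoch_prepend1E n a : hoch_prepend1 n (pure_tensor a) = pure_tensor (prepend1 a).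
Proof. exact: tensor_liftE. Qed.

(* The last face a_0 (x) .. (x) a_(n+1) |-> a_(n+1) a_0 (x) .. (x) a_n is the
   face merging positions 0 and 1 after a rotation. *)
Definition hoch_b n (x : hoch n.+1) : hoch n :=
  \sum_(i < n.+1) (-1) ^+ i *: hoch_merge i x
  + (-1) ^+ n.+1 *: hoch_merge ord0 (hoch_rotate n.+1 x).

(* The operators t, N and B = (1 - t) s N of Connes, on unnormalized chains. *)
Definition hoch_t n (x : hoch n) : hoch n := (-1) ^+ n *: hoch_rotate n x.

Definition hoch_N n (x : hoch n) : hoch n := \sum_(i < n.+1) iter i (@hoch_t n) x.

Definition connes_B n (x : hoch n) : hoch n.+1 :=
  let y := hoch_prepend1 n (hoch_N x) in y - hoch_t y.

Lemma hoch_b_is_linear n : linear (@hoch_b n).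
Proof.
move=> c x y; rewrite /hoch_b !linearP [in RHS]scalerDr [RHS]addrACA.
congr (_ + _).
rewrite scaler_sumr -big_split; apply: eq_bigr => i _.
by rewrite linearP scalerDr !scalerA mulrC.
Qed.
HB.instance Definition _ n :=
  GRing.isLinear.Build K (hoch n.+1) (hoch n) *:%R (@hoch_b n) (@hoch_b_is_linear n).

Lemma hoch_t_is_linear n : linear (@hoch_t n).
Proof. by move=> c x y; rewrite /hoch_t linearP scalerDr !scalerA mulrC. Qed.
HB.instance Definition _ n :=
  GRing.isLinear.Build K (hoch n) (hoch n) *:%R (@hoch_t n) (@hoch_t_is_linear n).

Lemma hoch_N_is_linear n : linear (@hoch_N n).
Proof.
move=> c x y; rewrite /hoch_N scaler_sumr -big_split; apply: eq_bigr => -[i _] _ /=.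
by elim: i => //= i ->; rewrite linearP.
Qed.
HB.instance Definition _ n :=
  GRing.isLinear.Build K (hoch n) (hoch n) *:%R (@hoch_N n) (@hoch_N_is_linear n).

Lemma connes_B_is_linear n : linear (@connes_B n).
Proof. by move=> c x y; rewrite /connes_B !linearP addrACA -scalerDr. Qed.
HB.instance Definition _ n :=
  GRing.isLinear.Build K (hoch n) (hoch n.+1) *:%R (@connes_B n)
    (@connes_B_is_linear n).

End Hochschild.

Section CyclicHomology.
Variables (K : fieldType) (A : algType K).

Definition hoch_prod := forall q : nat, hoch A q.
HB.instance Definition _ := Choice.on hoch_prod.

Lemma hoch_prod_addA : associative (fun x y : hoch_prod => fun q => x q + y q).
Proof. by move=> x y z; apply: functional_extensionality_dep => q; rewrite addrA. Qed.
Lemma hoch_prod_addC : commutative (fun x y : hoch_prod => fun q => x q + y q).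
Proof. by move=> x y; apply: functional_extensionality_dep => q; rewrite addrC. Qed.
Lemma hoch_prod_add0 :
  left_id (fun _ => 0) (fun x y : hoch_prod => fun q => x q + y q).
Proof. by move=> x; apply: functional_extensionality_dep => q; rewrite add0r. Qed.
Lemma hoch_prod_addN : left_inverse (fun _ => 0) (fun (x : hoch_prod) q => - x q)
  (fun x y : hoch_prod => fun q => x q + y q).
Proof. by move=> x; apply: functional_extensionality_dep => q; rewrite addNr. Qed.
HB.instance Definition _ := GRing.isZmodule.Build hoch_prod
  hoch_prod_addA hoch_prod_addC hoch_prod_add0 hoch_prod_addN.

Definition hoch_prod_scale (c : K) (x : hoch_prod) : hoch_prod := fun q => c *: x q.
Lemma hoch_prod_scaleA a b (v : hoch_prod) :
  hoch_prod_scale a (hoch_prod_scale b v) = hoch_prod_scale (a * b) v.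
Proof. by apply: functional_extensionality_dep => q; apply: scalerA. Qed.
Lemma hoch_prod_scale1 : left_id 1 hoch_prod_scale.
Proof. by move=> x; apply: functional_extensionality_dep => q; apply: scale1r. Qed.
Lemma hoch_prod_scaleDr : right_distributive hoch_prod_scale +%R.
Proof. by move=> a x y; apply: functional_extensionality_dep => q; apply: scalerDr. Qed.
Lemma hoch_prod_scaleDl (v : hoch_prod) : {morph hoch_prod_scale^~ v : a b / a + b}.
Proof. by move=> a b; apply: functional_extensionality_dep => q; apply: scalerDl. Qed.
HB.instance Definition _ := GRing.Zmodule_isLmodule.Build K hoch_prod
  hoch_prod_scaleA hoch_prod_scale1 hoch_prod_scaleDr hoch_prod_scaleDl.

Lemma hoch_prodP (x y : hoch_prod) : (forall q, x q = y q) -> x = y.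
Proof. by move=> xy; apply: functional_extensionality_dep. Qed.

(* The differential b + B of the (b, B)-bicomplex. *)
Definition total_d (x : hoch_prod) : hoch_prod := fun q =>
  hoch_b (x q.+1) +
  match q return hoch A q with 0 => 0 | q'.+1 => connes_B (x q') end.

Lemma total_d_is_linear : linear total_d.
Proof.
move=> c x y; apply: hoch_prodP => q.
have pE (u v : hoch_prod) r : (c *: u + v) r = c *: u r + v r by [].
rewrite pE /total_d pE linearP [in RHS]scalerDr [RHS]addrACA; congr (_ + _).
by case: q => [|q]; rewrite ?scaler0 ?addr0 // pE linearP.
Qed.
HB.instance Definition _ :=
  GRing.isLinear.Build K hoch_prod hoch_prod *:%R total_d total_d_is_linear.

(* Degree n of the periodic complex: the product of the hoch A q, q = n mod 2.
   Degree n of the cyclic complex: the part of it with q <= n. *)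
Definition per_chain n (x : hoch_prod) : Prop :=
  forall q, odd q != odd n -> x q = 0.
Definition cyc_chain n (x : hoch_prod) : Prop :=
  per_chain n x /\ forall q, (n < q)%N -> x q = 0.

(* The projection onto the part with q < m; the differential of the cyclic
   complex is total_d followed by it. *)
Definition below m (x : hoch_prod) : hoch_prod := fun q => if (q < m)%N then x q else 0.

Definition HP_cycle n : {pred hoch_prod} :=
  fun x => `[< per_chain n x /\ total_d x = 0 >].
Definition HP_boundary n : {pred hoch_prod} :=
  fun x => `[< exists2 y, per_chain n.+1 y & x = total_d y >].
Definition HC_cycle n : {pred hoch_prod} :=
  fun x => `[< cyc_chain n x /\ below n (total_d x) = 0 >].
Definition HC_boundary n : {pred hoch_prod} :=
  fun x => `[< exists2 y, cyc_chain n.+1 y & x = below n.+1 (total_d y) >].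

Lemma below_is_linear m : linear (below m).
Proof.
move=> c x y; apply: hoch_prodP => q.
have pE (u v : hoch_prod) r : (c *: u + v) r = c *: u r + v r by [].
by rewrite pE /below; case: ifP; rewrite // scaler0 addr0.
Qed.
HB.instance Definition _ m :=
  GRing.isLinear.Build K hoch_prod hoch_prod *:%R (below m) (below_is_linear m).

Lemma per_chain0 n : per_chain n 0. Proof. by []. Qed.
Lemma per_chainP n c x y : per_chain n x -> per_chain n y -> per_chain n (c *: x + y).
Proof.
move=> px py q nq; rewrite -[LHS]/(c *: x q + y q) px // py //.
by rewrite scaler0 addr0.
Qed.
Lemma cyc_chain0 n : cyc_chain n 0. Proof. by []. Qed.
Lemma cyc_chainP n c x y : cyc_chain n x -> cyc_chain n y -> cyc_chain n (c *: x + y).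
Proof.
move=> [px cx] [py cy]; split=> [|q nq]; first exact: per_chainP.
by rewrite -[LHS]/(c *: x q + y q) cx // cy // scaler0 addr0.
Qed.

Lemma HP_cycle_closed n : submod_closed (HP_cycle n).
Proof.
split=> [|c x y /asboolP[px dx] /asboolP[py dy]]; apply/asboolP; split.
- exact: per_chain0.
- exact: linear0.
- exact: per_chainP.
- by rewrite linearP /= dx dy scaler0 addr0.
Qed.
HB.instance Definition _ n :=
  GRing.isSubmodClosed.Build K hoch_prod (HP_cycle n) (HP_cycle_closed n).

Lemma HP_boundary_closed n : submod_closed (HP_boundary n).
Proof.
split=> [|c _ _ /asboolP[x px ->] /asboolP[y py ->]]; apply/asboolP.
  by exists 0; [exact: per_chain0 | rewrite linear0].
by exists (c *: x + y); [exact: per_chainP | rewrite linearP].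
Qed.
HB.instance Definition _ n :=
  GRing.isSubmodClosed.Build K hoch_prod (HP_boundary n) (HP_boundary_closed n).

Lemma HC_cycle_closed n : submod_closed (HC_cycle n).
Proof.
split=> [|c x y /asboolP[px dx] /asboolP[py dy]]; apply/asboolP; split.
- exact: cyc_chain0.
- by rewrite !linear0.
- exact: cyc_chainP.
- by rewrite !linearP /= dx dy scaler0 addr0.
Qed.
HB.instance Definition _ n :=
  GRing.isSubmodClosed.Build K hoch_prod (HC_cycle n) (HC_cycle_closed n).

Lemma HC_boundary_closed n : submod_closed (HC_boundary n).
Proof.
split=> [|c _ _ /asboolP[x px ->] /asboolP[y py ->]]; apply/asboolP.
  by exists 0; [exact: cyc_chain0 | rewrite !linear0].
by exists (c *: x + y); [exact: cyc_chainP | rewrite !linearP].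
Qed.
HB.instance Definition _ n :=
  GRing.isSubmodClosed.Build K hoch_prod (HC_boundary n) (HC_boundary_closed n).

End CyclicHomology.

Section Subquotient.
Variables (K : fieldType) (V : lmodType K) (Z B : submodClosed V).

Definition restrict_to : {pred subspace Z} := fun z => \val z \in B.
Lemma restrict_closed : submod_closed restrict_to.
Proof.
split=> [|c x y xB yB]; first exact: rpred0.
by apply: (@rpredD _ B (c *: val x) (val y)); [apply: rpredZ | exact: yB].
Qed.
HB.instance Definition _ :=
  GRing.isSubmodClosed.Build K (subspace Z) restrict_to restrict_closed.

(* Z / (Z :&: B); B is contained in Z in the cases of interest. *)
Definition subquot := quot restrict_to.
#[export] HB.instance Definition _ := GRing.Lmodule.on subquot.
End Subquotient.

Section SubquotientMap.
Variables (K : fieldType) (V V' : lmodType K).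
Variables (Z B : submodClosed V) (Z' B' : submodClosed V') (f : {linear V -> V'}).
Hypothesis fZ : forall x, x \in Z -> f x \in Z'.
Hypothesis fB : forall x, x \in B -> f x \in B'.

Definition subspace_map (fZ : forall x, x \in Z -> f x \in Z') (z : subspace Z) :
  subspace Z' := Subspace (fZ _ (valP z)).
Lemma subspace_map_is_linear : linear (subspace_map fZ).
Proof. by move=> c x y; apply: val_inj; rewrite /= linearP. Qed.
HB.instance Definition _ := GRing.isLinear.Build K (subspace Z) (subspace Z') *:%R
  (subspace_map fZ) subspace_map_is_linear.

Lemma subquot_map_subproof (z : subspace Z) : z \in restrict_to B ->
  (@quot_pi _ _ (restrict_to B') \o subspace_map fZ) z = 0.
Proof.
move=> zB; rewrite -(linear0 (@quot_pi _ _ (restrict_to B'))).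
by apply/quot_eqP; rewrite subr0 unfold_in; apply: fB.
Qed.

Definition subquot_map : {linear subquot Z B -> subquot Z' B'} :=
  quot_lift subquot_map_subproof.
End SubquotientMap.

Definition HP (K : fieldType) n (A : algType K) : lmodType K :=
  subquot (@HP_cycle K A n) (@HP_boundary K A n).
Definition HC (K : fieldType) n (A : algType K) : lmodType K :=
  subquot (@HC_cycle K A n) (@HC_boundary K A n).

Section Functoriality.
Variables (K : fieldType) (A A' : algType K) (f : {lrmorphism A -> A'}).

Lemma hoch_map_multilinear n :
  multilinear (fun a : {ffun 'I_n.+1 -> A} => pure_tensor [ffun i => f (a i)]).
Proof.
apply: pure_comp_multilinear => a i; exists [ffun i => f (a i)], i, f.
split=> [|x]; first exact: linearP.
by apply/ffunP=> j; rewrite !ffunE; case: ifP.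
Qed.

Definition hoch_map n : {linear hoch A n -> hoch A' n} :=
  tensor_lift (@hoch_map_multilinear n).

Lemma hoch_mapE n a : hoch_map n (pure_tensor a) = pure_tensor [ffun i => f (a i)].
Proof. exact: tensor_liftE. Qed.

Lemma hoch_map_merge n (i : 'I_n.+1) x :
  hoch_map n (hoch_merge A i x) = hoch_merge A' i (hoch_map n.+1 x).
Proof.
apply: (@tensor_eq _ _ _ _ (hoch_map n \o hoch_merge A i) (hoch_merge A' i \o hoch_map n.+1)).
move=> a; rewrite -[LHS]/(hoch_map n (hoch_merge A i (pure_tensor a))) -[RHS]/(hoch_merge A' i (hoch_map n.+1 (pure_tensor a))).
rewrite !(hoch_mapE, hoch_mergeE); congr pure_tensor; apply/ffunP=> j.
by rewrite !ffunE; do 2?case: ifP => _; rewrite // rmorphM.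
Qed.

Lemma hoch_map_rotate n x :
  hoch_map n (hoch_rotate A n x) = hoch_rotate A' n (hoch_map n x).
Proof.
apply: (@tensor_eq _ _ _ _ (hoch_map n \o hoch_rotate A n)
  (hoch_rotate A' n \o hoch_map n)).
move=> a; rewrite -[LHS]/(hoch_map n (hoch_rotate A n (pure_tensor a))) -[RHS]/(hoch_rotate A' n (hoch_map n (pure_tensor a))).
rewrite !(hoch_mapE, hoch_rotateE); congr pure_tensor; apply/ffunP=> j.
by rewrite !ffunE.
Qed.

Lemma hoch_map_prepend1 n x :
  hoch_map n.+1 (hoch_prepend1 A n x) = hoch_prepend1 A' n (hoch_map n x).
Proof.
apply: (@tensor_eq _ _ _ _ (hoch_map n.+1 \o hoch_prepend1 A n)
  (hoch_prepend1 A' n \o hoch_map n)).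
move=> a; rewrite -[LHS]/(hoch_map n.+1 (hoch_prepend1 A n (pure_tensor a))) -[RHS]/(hoch_prepend1 A' n (hoch_map n (pure_tensor a))).
rewrite !(hoch_mapE, hoch_prepend1E); congr pure_tensor; apply/ffunP=> j.
by rewrite !ffunE; case: unlift => [k|]; rewrite ?ffunE ?rmorph1.
Qed.

Lemma hoch_map_b n x : hoch_map n (hoch_b x) = hoch_b (hoch_map n.+1 x).
Proof.
rewrite /hoch_b linearD linearZ hoch_map_merge hoch_map_rotate; congr (_ + _).
by rewrite linear_sum; apply: eq_bigr => i _; rewrite linearZ hoch_map_merge.
Qed.

Lemma hoch_map_t n x : hoch_map n (hoch_t x) = hoch_t (hoch_map n x).
Proof. by rewrite /hoch_t linearZ hoch_map_rotate. Qed.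

Lemma hoch_map_N n x : hoch_map n (hoch_N x) = hoch_N (hoch_map n x).
Proof.
rewrite /hoch_N linear_sum; apply: eq_bigr => -[i _] _ /=.
by elim: i => //= i <-; rewrite -hoch_map_t.
Qed.

Lemma hoch_map_B n x : hoch_map n.+1 (connes_B x) = connes_B (hoch_map n x).
Proof. by rewrite /connes_B linearB hoch_map_t hoch_map_prepend1 hoch_map_N. Qed.

Definition prod_map (x : hoch_prod A) : hoch_prod A' := fun q => hoch_map q (x q).
Lemma prod_map_is_linear : linear prod_map.
Proof. by move=> c x y; apply: hoch_prodP => q; apply: linearP. Qed.
HB.instance Definition _ := GRing.isLinear.Build K (hoch_prod A) (hoch_prod A') *:%R
  prod_map prod_map_is_linear.

Lemma prod_map_d x : prod_map (total_d x) = total_d (prod_map x).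
Proof.
apply: hoch_prodP => q; rewrite /prod_map /total_d linearD hoch_map_b; congr (_ + _).
by case: q => [|q]; rewrite ?linear0 ?hoch_map_B.
Qed.

Lemma prod_map_per n x : per_chain n x -> per_chain n (prod_map x).
Proof. by move=> px q /px xq; rewrite /prod_map xq linear0. Qed.

Lemma HP_map_cycle n x : x \in @HP_cycle _ A n -> prod_map x \in @HP_cycle _ A' n.
Proof.
move=> /asboolP[px dx]; apply/asboolP; split; first exact: prod_map_per.
by rewrite -prod_map_d dx linear0.
Qed.

Lemma HP_map_boundary n x : x \in @HP_boundary _ A n -> prod_map x \in @HP_boundary _ A' n.
Proof.
move=> /asboolP[y py ->]; apply/asboolP; exists (prod_map y).
  exact: prod_map_per.
exact: prod_map_d.
Qed.

Definition HP_map n : {linear HP n A -> HP n A'} :=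
  subquot_map (@HP_map_cycle n) (@HP_map_boundary n).
End Functoriality.

Definition lmod_iso (K : fieldType) (U V : lmodType K) : Prop :=
  exists f : {linear U -> V}, bijective f.

Section CrossedProduct.
Variables (K : fieldType) (G : finGroupType) (H : algType K).

Structure algebra_action := AlgebraAction {
  algebra_act :> G -> {lrmorphism H -> H};
  algebra_act1 : forall h, algebra_act 1%g h = h;
  algebra_actM : forall g g' h,
    algebra_act (g * g')%g h = algebra_act g (algebra_act g' h)
}.

Variable psi : algebra_action.

(* f stands for the sum of the f g * g, with the relations g * h = psi g h * g. *)
Definition crossed of algebra_action := {ffun G -> H}.
HB.instance Definition _ := GRing.Lmodule.on (crossed psi).

Definition crossed_one : crossed psi := [ffun g => (g == 1%g)%:R].
Definition crossed_mul (f f' : crossed psi) : crossed psi :=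
  [ffun r => \sum_g f g * psi g (f' (g^-1 * r)%g)].

Lemma crossed_mulA : associative crossed_mul.
Proof.
move=> x y z; apply/ffunP=> r; rewrite !ffunE.
transitivity (\sum_g \sum_t x g * psi g (y (g^-1 * t)%g) * psi t (z (t^-1 * r)%g)).
  apply: eq_bigr => g _; rewrite ffunE raddf_sum mulr_sumr.
  rewrite (reindex_inj (mulgI g^-1%g)) /=; apply: eq_bigr => t _.
  by rewrite rmorphM mulrA /= -algebra_actM mulKVg invMg invgK -mulgA mulKVg.
rewrite exchange_big; apply: eq_bigr => t _; rewrite ffunE mulr_suml.
by apply: eq_bigr.
Qed.

Lemma crossed_mul1 : left_id crossed_one crossed_mul.
Proof.
move=> x; apply/ffunP=> r; rewrite !ffunE (bigD1 1%g) //= big1 => [|g /negPf g1].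
  by rewrite ffunE eqxx mul1r algebra_act1 invg1 mul1g addr0.
by rewrite ffunE g1 mul0r.
Qed.

Lemma crossed_1mul : right_id crossed_one crossed_mul.
Proof.
move=> x; apply/ffunP=> r; rewrite !ffunE (bigD1 r) //= big1 => [|g gr].
  by rewrite ffunE mulVg eqxx rmorph1 mulr1 addr0.
by rewrite ffunE -eq_mulVg1 (negPf gr) raddf0 mulr0.
Qed.

Lemma crossed_mulDl : left_distributive crossed_mul +%R.
Proof.
move=> x y z; apply/ffunP=> r; rewrite !ffunE -big_split; apply: eq_bigr => g _.
by rewrite ffunE mulrDl.
Qed.

Lemma crossed_mulDr : right_distributive crossed_mul +%R.
Proof.
move=> x y z; apply/ffunP=> r; rewrite !ffunE -big_split; apply: eq_bigr => g _.
by rewrite ffunE raddfD mulrDr.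
Qed.

Lemma crossed_one_neq0 : crossed_one != 0.
Proof. by apply/eqP=> /ffunP/(_ 1%g); rewrite !ffunE eqxx; apply/eqP/oner_neq0. Qed.

HB.instance Definition _ := GRing.Zmodule_isNzRing.Build (crossed psi)
  crossed_mulA crossed_mul1 crossed_1mul crossed_mulDl crossed_mulDr crossed_one_neq0.

Lemma crossed_scaleAl (c : K) (x y : crossed psi) : c *: (x * y) = (c *: x) * y.
Proof.
apply/ffunP=> r; rewrite !ffunE scaler_sumr; apply: eq_bigr => g _.
by rewrite ffunE scalerAl.
Qed.
HB.instance Definition _ := GRing.Lmodule_isLalgebra.Build K (crossed psi) crossed_scaleAl.

Lemma crossed_scaleAr (c : K) (x y : crossed psi) : c *: (x * y) = x * (c *: y).
Proof.
apply/ffunP=> r; rewrite !ffunE scaler_sumr; apply: eq_bigr => g _.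
by rewrite ffunE linearZ scalerAr.
Qed.
HB.instance Definition _ := GRing.Lalgebra_isAlgebra.Build K (crossed psi) crossed_scaleAr.

Definition crossed_elt (h : H) (g : G) : crossed psi := [ffun r => if r == g then h else 0].

Lemma crossed_eltM h g h' g' :
  crossed_elt h g * crossed_elt h' g' = crossed_elt (h * psi g h') (g * g')%g.
Proof.
apply/ffunP=> r; rewrite !ffunE (bigD1 g) //= big1 => [|t /negPf tg].
  rewrite !ffunE eqxx addr0 -(inj_eq (mulgI g)) mulKVg.
  by case: eqP; rewrite // raddf0 mulr0.
by rewrite !ffunE tg mul0r.
Qed.
End CrossedProduct.

Section GroupAlgebra.
Variables (K : fieldType) (G : finGroupType).

Definition trivial_action : algebra_action G K^o :=
  @AlgebraAction K G K^o (fun=> idfun) (fun=> erefl) (fun _ _ _ => erefl).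

Definition group_algebra := crossed trivial_action.
HB.instance Definition _ := GRing.Algebra.on group_algebra.

Definition group_elt (g : G) : group_algebra := crossed_elt trivial_action 1 g.

Section Lift.
Variables (A : algType K) (u : G -> A).
Hypotheses (u1 : u 1%g = 1) (uM : forall g g', u (g * g')%g = u g * u g').

Definition group_algebra_lift_fun (u1 : u 1%g = 1)
  (uM : forall g g', u (g * g')%g = u g * u g') (f : group_algebra) : A :=
  \sum_g f g *: u g.
Local Notation lift := (group_algebra_lift_fun u1 uM).

Lemma group_algebra_lift_linear : linear lift.
Proof.
move=> c x y; rewrite /lift scaler_sumr -big_split; apply: eq_bigr => g _.
by rewrite !ffunE scalerDl scalerA.
Qed.

Lemma group_algebra_lift_monoid : monoid_morphism lift.
Proof.
split=> [|x y]; rewrite /lift.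
  rewrite (bigD1 1%g) //= big1 => [|g /negPf g1]; rewrite !ffunE ?g1 ?scale0r //.
  by rewrite eqxx scale1r addr0.
rewrite mulr_suml; under [RHS]eq_bigr do rewrite mulr_sumr.
rewrite exchange_big /=.
transitivity (\sum_r \sum_g (x g * y (g^-1 * r)%g) *: u r).
  by apply: eq_bigr => r _; rewrite ffunE scaler_suml.
rewrite exchange_big [RHS]exchange_big /=; apply: eq_bigr => g _.
rewrite (reindex_inj (mulgI g)) /=; apply: eq_bigr => r _.
by rewrite mulKg uM -scalerAl -scalerAr scalerA.
Qed.

HB.instance Definition _ := GRing.isLinear.Build K group_algebra A *:%R lift
  group_algebra_lift_linear.
HB.instance Definition _ := GRing.isMonoidMorphism.Build group_algebra A lift
  group_algebra_lift_monoid.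

Definition group_algebra_lift : {lrmorphism group_algebra -> A} := lift.

Lemma group_algebra_liftE g : group_algebra_lift (group_elt g) = u g.
Proof.
rewrite /= /lift (bigD1 g) //= big1 => [|t /negPf tg]; rewrite !ffunE ?tg ?scale0r //.
by rewrite eqxx scale1r addr0.
Qed.
End Lift.
End GroupAlgebra.

Section RootDatum.
Variable R : realType.

Definition dual_space (V : vectType R) : vectType R := 'Hom(V, R^o).

Structure root_datum := RootDatum {
  rd_space :> vectType R;
  rd_ip : rd_space -> rd_space -> R;
  rd_ipC : forall u v, rd_ip u v = rd_ip v u;
  rd_ipDl : forall c u v w, rd_ip (c *: u + v) w = c * rd_ip u w + rd_ip v w;
  rd_ip_gt0 : forall v, v != 0 -> 0 < rd_ip v v;

  (* Only the values of rd_coroot on rd_roots matter. *)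
  rd_roots : seq (dual_space rd_space);
  rd_coroot : dual_space rd_space -> rd_space;
  rd_pairing : forall a, a \in rd_roots -> a (rd_coroot a) = 2;
  rd_reflect : forall a b, a \in rd_roots -> b \in rd_roots ->
    b - b (rd_coroot a) *: a \in rd_roots;
  rd_coreflect : forall a b, a \in rd_roots -> b \in rd_roots ->
    rd_coroot b - a (rd_coroot b) *: rd_coroot a \in map rd_coroot rd_roots;
  rd_reduced : forall a (c : R), a \in rd_roots -> c *: a \in rd_roots ->
    c = 1 \/ c = -1;
  rd_orthogonal : forall a u v, a \in rd_roots ->
    rd_ip (u - a u *: rd_coroot a) (v - a v *: rd_coroot a) = rd_ip u v;

  rd_rank : nat;
  rd_simple : rd_rank.-tuple (dual_space rd_space);
  rd_simple_root : {subset rd_simple <= rd_roots};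
  rd_simple_free : free rd_simple;
  rd_simple_basis : forall b, b \in rd_roots -> exists c : 'I_rd_rank -> R,
    b = \sum_i c i *: tnth rd_simple i /\
    ((forall i, 0 <= c i) \/ (forall i, c i <= 0))
}.

Variable D : root_datum.
Local Notation I := 'I_(rd_rank D).

Definition simple_root (i : I) : dual_space D := tnth (rd_simple D) i.
Definition simple_coroot (i : I) : D := rd_coroot (simple_root i).

Definition reflection (i : I) (x : dual_space D) : dual_space D :=
  x - x (simple_coroot i) *: simple_root i.

(* A finite group identified with the subgroup of GL(a^* ) generated by the
   simple reflections. *)
Structure weyl_group := WeylGroup {
  weyl_sort :> finGroupType;
  weyl_act : weyl_sort -> 'End(dual_space D);
  weyl_s : I -> weyl_sort;
  weyl_act1 : weyl_act 1%g = \1%VF;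
  weyl_actM : forall w w', weyl_act (w * w')%g = (weyl_act w \o weyl_act w')%VF;
  weyl_act_inj : injective weyl_act;
  weyl_act_s : forall i x, weyl_act (weyl_s i) x = reflection i x;
  weyl_generated : <<[set weyl_s i | i : I]>>%g = [set: weyl_sort]
}.

Variable W : weyl_group.

Structure parameters := MakeParameters {
  param :> I -> R[i];
  param_conj : forall i j,
    (exists w : W, weyl_act w (simple_root i) = simple_root j) -> param i = param j
}.

(* diag_w is the right action of the group by the induced automorphisms of W:
   diag_w w g is g^-1 w g in the semidirect product. *)
Structure diagram_group := DiagramGroup {
  diag_sort :> finGroupType;
  diag_perm : diag_sort -> {perm I};
  diag_cartan : forall g i j,
    simple_root (diag_perm g i) (simple_coroot (diag_perm g j)) =
    simple_root i (simple_coroot j);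
  diag_lin : diag_sort -> 'End(D);
  diag_lin1 : diag_lin 1%g = \1%VF;
  diag_linM : forall g h, diag_lin (g * h)%g = (diag_lin g \o diag_lin h)%VF;
  diag_orthogonal : forall g u v, rd_ip (diag_lin g u) (diag_lin g v) = rd_ip u v;
  diag_coroot : forall g i,
    diag_lin g (simple_coroot i) = simple_coroot (diag_perm g i);
  diag_w : groupAction [set: diag_sort] [set: W];
  diag_w_s : forall g i, diag_w (weyl_s W (diag_perm g i)) g = weyl_s W i
}.

Variables (k : parameters) (Gam : diagram_group).

(* Complexification: the pair (x, y) stands for x + i y. *)
Definition cdual := (dual_space D * dual_space D)%type.

Definition cpairing (x : cdual) (v : D) : R[i] := Complex (x.1 v) (x.2 v).

Definition creflection (i : I) (x : cdual) : cdual :=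
  (reflection i x.1, reflection i x.2).

Definition cdiag (g : Gam) (x : cdual) : cdual :=
  ((x.1 \o diag_lin g^-1%g)%VF, (x.2 \o diag_lin g^-1%g)%VF).

(* S(t^* ) as the polynomial functions on t, in the coordinates of a basis of a. *)
Definition symt := {mpoly R[i][\dim {:D}]}.
HB.instance Definition _ := GRing.ComAlgebra.on symt.

Definition sym_of (x : cdual) : symt :=
  \sum_(j < \dim {:D}) cpairing x (vbasis {:D})`_j *: 'X_j.

Structure hecke_algebra := HeckeAlgebra {
  hecke_sort :> algType R[i];
  hecke_W : {lrmorphism group_algebra R[i] W -> hecke_sort};
  hecke_S : {lrmorphism symt -> hecke_sort};
  hecke_tensor : bijective (fun p : {ffun W -> symt} =>
    \sum_w hecke_W (group_elt R[i] w) * hecke_S (p w));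
  hecke_cross : forall i x,
    hecke_S (sym_of x) * hecke_W (group_elt R[i] (weyl_s W i))
    - hecke_W (group_elt R[i] (weyl_s W i)) * hecke_S (sym_of (creflection i x)) =
    (k i * cpairing x (simple_coroot i))%:A
}.

Variable H : hecke_algebra.

Structure hecke_diagram_action := HeckeDiagramAction {
  hecke_act :> algebra_action Gam H;
  hecke_act_S : forall g x,
    hecke_act g (hecke_S H (sym_of x)) = hecke_S H (sym_of (cdiag g x));
  hecke_act_s : forall g i,
    hecke_act g (hecke_W H (group_elt R[i] (weyl_s W i))) =
    hecke_W H (group_elt R[i] (weyl_s W (diag_perm g i)))
}.

Variable psi : hecke_diagram_action.

Definition extended_hecke := crossed psi.
HB.instance Definition _ := GRing.Algebra.on extended_hecke.

Definition extended_weyl := sdprod_by (diag_w Gam).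
HB.instance Definition _ := FinGroup.on extended_weyl.

(* The element u of the semidirect product is u.1 u.2, with u.1 a diagram
   automorphism and u.2 in W. *)
Definition extended_elt (u : extended_weyl) : extended_hecke :=
  crossed_elt psi 1 (\val u).1 *
  crossed_elt psi (hecke_W H (group_elt R[i] (\val u).2)) 1%g.

Lemma group_eltM (F : fieldType) (G : finGroupType) (g h : G) :
  group_elt F (g * h)%g = group_elt F g * group_elt F h.
Proof. by rewrite /group_elt [RHS]crossed_eltM mulr1. Qed.

Lemma group_elt1 (F : fieldType) (G : finGroupType) : group_elt F (1%g : G) = 1.
Proof. by apply/ffunP=> g; rewrite !ffunE; case: eqP. Qed.

Lemma hecke_act_W (g : Gam) (w : W) :
  psi g (hecke_W H (group_elt R[i] (diag_w Gam w g))) = hecke_W H (group_elt R[i] w).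
Proof.
pose P := [set w : W | psi g (hecke_W H (group_elt R[i] (diag_w Gam w g)))
  == hecke_W H (group_elt R[i] w)].
suff: [set: W] \subset P by move/subsetP/(_ w (in_setT w)); rewrite inE => /eqP.
have gP : group_set P.
  apply/group_setP; split=> [|v v'].
    by rewrite inE gact1 ?inE // group_elt1 !rmorph1.
  rewrite !inE => /eqP vP /eqP vP'.
  by rewrite gactM ?inE // !group_eltM !rmorphM /= vP vP'.
rewrite -weyl_generated (gen_subG _ (Group gP)); apply/subsetP=> _ /imsetP[i _ ->].
by rewrite inE -(permKV (diag_perm g) i) diag_w_s hecke_act_s.
Qed.

Lemma extended_elt1 : extended_elt 1%g = 1.
Proof.
rewrite /extended_elt /= group_elt1 rmorph1.
have -> : crossed_elt psi 1 1%g = 1 by apply/ffunP=> g; rewrite !ffunE; case: eqP.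
by rewrite mulr1.
Qed.

Lemma extended_eltM u v : extended_elt (u * v)%g = extended_elt u * extended_elt v.
Proof.
rewrite /extended_elt !crossed_eltM !mul1r !mulg1 /= group_eltM rmorphM /=.
by rewrite [in LHS]rmorphM /= !algebra_actM hecke_act_W.
Qed.

Definition extended_inclusion :
    {lrmorphism group_algebra R[i] extended_weyl -> extended_hecke} :=
  group_algebra_lift extended_elt1 extended_eltM.

End RootDatum.

(* Main.v *)
(* Through its PBW basis, the extended graded Hecke algebra A is a filtered
   deformation of the crossed product A1 of the extended Weyl group by the polynomial
   algebra, graded by polynomial degree. Let d be the number of variables.

   On the bar complex of A1 the operators x_j (x) 1 - 1 (x) x_j form a regular
   sequence, so killing them costs d degrees, and averaging over the finite group
   shows that HH_q(A1) = 0 for q > d. Rinehart's formula for the action of the Euler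
   derivation then shows that HC_n(A1) is concentrated in weight 0 for n >= d.
   Induction on the filtration gives HH_q(A) = 0 for q > d, and shows that every
   cyclic cycle of A of degree at least d is homologous to one coming from the weight 0
   part, which is the group algebra.

   Since the periodic complex consists of products, a cycle vanishing in low degrees
   can be killed degree by degree upwards wherever HH vanishes; this gives HP_n = HC_n
   for n > d, both for A and for the group algebra. Applied relative to the subcomplex
   of chains of the group algebra, it gives the isomorphism on HP in all degrees. *)

Require Import Defs.
From HB Require Import structures.
From mathcomp Require Import all_boot all_order all_algebra all_fingroup.
From mathcomp Require Import generic_quotient complex boolp reals freeg mpoly zify ring.

Set Implicit Arguments.
Unset Strict Implicit.
Unset Printing Implicit Defensive.

Import GRing.Theory.
Local Open Scope ring_scope.

(** * Cyclic operators on pure tensors *)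

(** Why the detour through A1: in the Hecke algebra, conjugating x_j by a group element gives a
    linear form only up to an element of the group algebra, so averaging does not respect the ideal
    of the commutators; in A1 it does. The PBW map from A1 to A is linear and fixes 1, hence
    commutes exactly with t, N and B, which multiply no entries; only b is deformed, by terms of
    lower weight.

    In weight p > 0 the Lie derivative is multiplication by p. Rinehart's formula then writes a
    Hochschild cycle which B maps to a boundary as B of a cycle plus a boundary, and this kills a
    cyclic cycle from its lowest degree upwards. As the chains are unnormalized, the usual
    identities hold only up to boundaries, which have to be exhibited.

    In the cyclic argument the bound d enters only at the top: truncation drops the condition on B
    z_n, and the vanishing of HH in degree n+1 replaces it.

    The comparison of HC for A and the group algebra is not made directly: it is the composite of HC
    = HP for A, the isomorphism on HP, and HP = HC for the group algebra. *)

Section PureTensors.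
Variables (K : fieldType) (A : algType K).
Implicit Types (n : nat) (f g : nat -> A).

(** The factors come from a function on all of [nat], of which only the values at indices up to [n]
    matter; index arithmetic then stays outside the ordinals. *)
Definition pt n f : hoch A n := pure_tensor [ffun i : 'I_n.+1 => f i].

Lemma eq_pt n f g : (forall i, (i <= n)%N -> f i = g i) -> pt n f = pt n g.
Proof.
by move=> fg; congr pure_tensor; apply/ffunP=> i; rewrite !ffunE fg // -ltnS.
Qed.

Lemma pure_pt n (a : {ffun 'I_n.+1 -> A}) :
  pure_tensor a = pt n (fun i => a (inord i)).
Proof. by congr pure_tensor; apply/ffunP=> i; rewrite ffunE inord_val. Qed.

Lemma hoch_ind n (P : hoch A n -> Prop) :
    P 0 -> (forall c x y, P x -> P y -> P (c *: x + y)) ->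
  (forall f, P (pt n f)) -> forall x, P x.
Proof.
move=> P0 PD Pf; elim/quotW=> z; rewrite -/(quot_pi _ z) -[z]freeg_sumE raddf_sum.
elim: (dom z) => [|a s IHs]; first by rewrite big_nil.
rewrite big_cons.
have -> : << coeff a z *g a >> = coeff a z *: << a >> :> {freeg {ffun 'I_n.+1 -> A} / K}.
  by apply/eqP/freeg_eqP=> b; rewrite coeffZ !coeffU mul1r.
by rewrite /= linearZ; apply: PD => //; rewrite -[X in P X]/(pure_tensor a) pure_pt.
Qed.

(** Linearity is a plain hypothesis, so that composites and sums of operators can be compared
    without packing them as linear maps. *)
Lemma hoch_ext n (U : lmodType K) (F G : hoch A n -> U) :
  linear F -> linear G -> (forall f, F (pt n f) = G (pt n f)) -> F =1 G.
Proof.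
move=> Fl Gl FG; elim/hoch_ind => [|c x y IHx IHy|f] //.
  by have := Fl (-1) 0 0; have := Gl (-1) 0 0; rewrite !scaleN1r !addNr => -> ->.
by rewrite Fl Gl IHx IHy.
Qed.

Definition upd f i (x : A) : nat -> A := fun j => if j == i then x else f j.

Lemma pt_linear n f i c x y : (i <= n)%N ->
  pt n (upd f i (c *: x + y)) = c *: pt n (upd f i x) + pt n (upd f i y).
Proof.
move=> ni; have E z : pt n (upd f i z) =
    pure_tensor (update [ffun j : 'I_n.+1 => f j] (inord i) z).
  congr pure_tensor; apply/ffunP=> j; rewrite !ffunE /upd.
  by rewrite -(inj_eq val_inj) /= inordK.
by rewrite !E pure_multilinear.
Qed.

Lemma pt_updD n f i x y : (i <= n)%N ->
  pt n (upd f i (x + y)) = pt n (upd f i x) + pt n (upd f i y).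
Proof. by move=> ni; have := pt_linear f 1 x y ni; rewrite !scale1r. Qed.

Lemma pt_upd0 n f i : (i <= n)%N -> pt n (upd f i 0) = 0.
Proof.
move=> ni; have := pt_linear f (-1) 0 0 ni.
by rewrite scaleN1r oppr0 addr0 scaleN1r addNr.
Qed.

Lemma pt_updZ n f i c x : (i <= n)%N -> pt n (upd f i (c *: x)) = c *: pt n (upd f i x).
Proof. by move=> ni; rewrite -[c *: x]addr0 pt_linear // pt_upd0 // addr0. Qed.

Lemma pt_upd_sum n f i (I : Type) (r : seq I) (P : pred I) (F : I -> A) :
  (i <= n)%N ->
  pt n (upd f i (\sum_(k <- r | P k) F k)) = \sum_(k <- r | P k) pt n (upd f i (F k)).
Proof.
move=> ni; elim/big_rec2: _ => [|k y x _ <-]; first by rewrite pt_upd0.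
by rewrite pt_updD.
Qed.

Lemma upd_id f i : upd f i (f i) =1 f.
Proof. by move=> j; rewrite /upd; case: eqP => // ->. Qed.

Lemma pt_upd_id n f i : pt n (upd f i (f i)) = pt n f.
Proof. by apply: eq_pt => j _; rewrite upd_id. Qed.

Definition mrg i f : nat -> A :=
  fun j => if (j < i)%N then f j else if j == i then f j * f j.+1 else f j.+1.
Definition rotf n f : nat -> A := fun j => if j is j'.+1 then f j' else f n.
Definition cns (x : A) f : nat -> A := fun j => if j is j'.+1 then f j' else x.

(* [simpl] unfolds the applications of the linear maps [hoch_merge],
   [hoch_rotate] and [hoch_prepend1]; it leaves the following aliases alone. *)
Definition face n (i : 'I_n.+1) (x : hoch A n.+1) : hoch A n := hoch_merge A i x.
Definition hrot n (x : hoch A n) : hoch A n := hoch_rotate A n x.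
Definition cons1 n (x : hoch A n) : hoch A n.+1 := hoch_prepend1 A n x.

Lemma face_is_linear n i : linear (@face n i). Proof. exact: linearP. Qed.
Lemma hrot_is_linear n : linear (@hrot n). Proof. exact: linearP. Qed.
Lemma cons1_is_linear n : linear (@cons1 n). Proof. exact: linearP. Qed.
HB.instance Definition _ n i := GRing.isLinear.Build K (hoch A n.+1) (hoch A n) *:%R
  (@face n i) (@face_is_linear n i).
HB.instance Definition _ n := GRing.isLinear.Build K (hoch A n) (hoch A n) *:%R
  (@hrot n) (@hrot_is_linear n).
HB.instance Definition _ n := GRing.isLinear.Build K (hoch A n) (hoch A n.+1) *:%R
  (@cons1 n) (@cons1_is_linear n).

Lemma face_pt n (i : 'I_n.+1) f : face i (pt n.+1 f) = pt n (mrg i f).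
Proof.
rewrite /face hoch_mergeE; congr pure_tensor; apply/ffunP=> j; rewrite !ffunE /mrg /=.
by rewrite -(inj_eq val_inj).
Qed.

Lemma hrot_pt n f : hrot (pt n f) = pt n (rotf n f).
Proof.
rewrite /hrot hoch_rotateE; congr pure_tensor; apply/ffunP=> j; rewrite !ffunE /rotf /=.
case: j => [[|j] jn] /=.
  by rewrite modn_small.
by rewrite modnDr modn_small // ltnW.
Qed.

Lemma cons1_pt n f : cons1 (pt n f) = pt n.+1 (cns 1 f).
Proof.
rewrite /cons1 hoch_prepend1E; congr pure_tensor; apply/ffunP=> j; rewrite !ffunE /cns.
by case: unliftP => [k|] -> //=; rewrite ffunE.
Qed.

End PureTensors.

#[global] Arguments face : simpl never.
#[global] Arguments hrot : simpl never.
#[global] Arguments cons1 : simpl never.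

Ltac hext := apply: hoch_ext;
  [by move=> ? ? ?; rewrite ?linearP | by move=> ? ? ?; rewrite ?linearP | ].

(** * Linear maps acting slot by slot *)

Section TensorMap.
Variables (K : fieldType).

Section Two.
Variables (A B : algType K) (phi : nat -> {linear A -> B}).
Lemma tmap_multilinear n :
  multilinear (fun a : {ffun 'I_n.+1 -> A} => pure_tensor [ffun i : 'I_n.+1 => phi i (a i)]).
Proof.
apply: pure_comp_multilinear => a i; exists [ffun i : 'I_n.+1 => phi i (a i)], i, (phi i).
split=> [|x]; first exact: linearP.
by apply/ffunP=> j; rewrite !ffunE; case: eqP => // ->.
Qed.
Definition tmap n (x : hoch A n) : hoch B n := tensor_lift (@tmap_multilinear n) x.

Lemma tmap_is_linear n : linear (@tmap n). Proof. exact: linearP. Qed.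
HB.instance Definition _ n := GRing.isLinear.Build K (hoch A n) (hoch B n) *:%R
  (@tmap n) (@tmap_is_linear n).

Lemma tmap_pt n f : tmap (pt n f) = pt n (fun i => phi i (f i)).
Proof.
by rewrite [LHS]tensor_liftE; congr pure_tensor; apply/ffunP=> i; rewrite !ffunE.
Qed.
End Two.

Lemma tmap_comp (A B C : algType K) (phi : nat -> {linear A -> B})
    (chi : nat -> {linear B -> C}) (xi : nat -> {linear A -> C}) n :
  (forall i a, (i <= n)%N -> chi i (phi i a) = xi i a) ->
  forall x, tmap chi (tmap phi x) = tmap xi (x : hoch A n).
Proof.
move=> H; hext => f; rewrite !tmap_pt; apply: eq_pt => i ni; exact: H.
Qed.

Lemma tmap_id (A : algType K) (phi : nat -> {linear A -> A}) n :
  (forall i a, (i <= n)%N -> phi i a = a) -> forall x : hoch A n, tmap phi x = x.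
Proof.
move=> H; hext => f; rewrite !tmap_pt; apply: eq_pt => i ni; exact: H.
Qed.

Lemma hoch_map_pt (A B : algType K) (h : {lrmorphism A -> B}) n f :
  hoch_map h n (pt n f) = pt n (fun i => h (f i)).
Proof. by rewrite hoch_mapE; congr pure_tensor; apply/ffunP=> i; rewrite !ffunE. Qed.

Definition slot (A : algType K) i (phi : {linear A -> A}) (j : nat) : {linear A -> A} :=
  if j == i then phi else idfun.

Definition atslot (A : algType K) i (phi : {linear A -> A}) n (x : hoch A n) : hoch A n :=
  tmap (slot i phi) x.

Lemma atslot_is_linear (A : algType K) i (phi : {linear A -> A}) n :
  linear (@atslot A i phi n).
Proof. exact: linearP. Qed.
HB.instance Definition _ (A : algType K) i (phi : {linear A -> A}) n :=
  GRing.isLinear.Build K (hoch A n) (hoch A n) *:%R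
  (@atslot A i phi n) (@atslot_is_linear A i phi n).

Lemma atslot_pt (A : algType K) i (phi : {linear A -> A}) n f :
  atslot i phi (pt n f) = pt n (upd f i (phi (f i))).
Proof.
rewrite [LHS]tmap_pt; apply: eq_pt => j _; rewrite /slot /upd.
by case: eqP => [->|].
Qed.
End TensorMap.

#[global] Arguments tmap : simpl never.
#[global] Arguments atslot : simpl never.

Section SlotMultiplication.
Variables (K : fieldType) (A : algType K) (a : A).
Definition lmul (x : A) : A := a * x.
Definition rmul (x : A) : A := x * a.
Lemma lmul_is_linear : linear lmul.
Proof. by move=> c x y; rewrite /lmul mulrDr scalerAr. Qed.
Lemma rmul_is_linear : linear rmul.
Proof. by move=> c x y; rewrite /rmul mulrDl scalerAl. Qed.
HB.instance Definition _ := GRing.isLinear.Build K A A *:%R lmul lmul_is_linear.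
HB.instance Definition _ := GRing.isLinear.Build K A A *:%R rmul rmul_is_linear.
End SlotMultiplication.

Section OperatorLinearity.
Variables (K : fieldType) (A : algType K) (n : nat).

Lemma hoch_b0 : hoch_b (0 : hoch A n.+1) = 0. Proof. exact: linear0. Qed.
Lemma hoch_bD (x y : hoch A n.+1) : hoch_b (x + y) = hoch_b x + hoch_b y.
Proof. exact: (linearD (@hoch_b K A n)). Qed.
Lemma hoch_bN (x : hoch A n.+1) : hoch_b (- x) = - hoch_b x.
Proof. by apply/eqP; rewrite -subr_eq0 opprK -hoch_bD addNr hoch_b0. Qed.
Lemma hoch_bBr (x y : hoch A n.+1) : hoch_b (x - y) = hoch_b x - hoch_b y.
Proof. by rewrite hoch_bD hoch_bN. Qed.
Lemma hoch_bZ c (x : hoch A n.+1) : hoch_b (c *: x) = c *: hoch_b x.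
Proof. exact: (linearZZ (@hoch_b K A n)). Qed.
Lemma connes_B0 : connes_B (0 : hoch A n) = 0. Proof. exact: linear0. Qed.
Lemma connes_BD (x y : hoch A n) : connes_B (x + y) = connes_B x + connes_B y.
Proof. exact: (linearD (@connes_B K A n)). Qed.
Lemma connes_BN (x : hoch A n) : connes_B (- x) = - connes_B x.
Proof. by apply/eqP; rewrite -subr_eq0 opprK -connes_BD addNr connes_B0. Qed.
Lemma connes_BBr (x y : hoch A n) : connes_B (x - y) = connes_B x - connes_B y.
Proof. by rewrite connes_BD connes_BN. Qed.
Lemma connes_BZ c (x : hoch A n) : connes_B (c *: x) = c *: connes_B x.
Proof. exact: (linearZZ (@connes_B K A n)). Qed.
Lemma hoch_tB (x y : hoch A n) : hoch_t (x - y) = hoch_t x - hoch_t y.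
Proof. exact: (linearB (@hoch_t K A n)). Qed.
Lemma hoch_NB (x y : hoch A n) : hoch_N (x - y) = hoch_N x - hoch_N y.
Proof. exact: (linearB (@hoch_N K A n)). Qed.
End OperatorLinearity.

(** * Identities between b, b', t, N, s and B *)

Section CyclicOperators.
Variables (K : fieldType) (A : algType K).
Implicit Types n k : nat.

Local Notation T k x := (iter k (@hoch_t _ A _) x).
Local Notation s := (@cons1 _ A _).
Local Notation d0 := (face ord0).

Lemma iter_t_is_linear n k : linear (iter k (@hoch_t _ A n)).
Proof. by move=> c x y; elim: k => //= k ->; rewrite linearP. Qed.
HB.instance Definition _ n k := GRing.isLinear.Build K (hoch A n) (hoch A n) *:%R
  (iter k (@hoch_t _ A n)) (@iter_t_is_linear n k).

Definition rotk n k (f : nat -> A) : nat -> A :=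
  fun j => if (j < k)%N then f (j + n.+1 - k)%N else f (j - k)%N.

Lemma iter_rot_pt n k f : (k <= n.+1)%N ->
  iter k (@hrot _ A n) (pt n f) = pt n (rotk n k f).
Proof.
elim: k => [|k IHk] kn; first by apply: eq_pt => j jn; rewrite /rotk !subn0.
rewrite iterS IHk ?(ltnW kn) // hrot_pt; apply: eq_pt => -[|j] jn; rewrite /rotf /rotk /=.
  by do 2?case: ltnP => ?; congr f; lia.
by do 2?case: ltnP => ?; congr f; lia.
Qed.

Lemma iter_t_pt n k f : (k <= n.+1)%N ->
  T k (pt n f) = (-1) ^+ (n * k) *: pt n (rotk n k f).
Proof.
move=> kn; rewrite -iter_rot_pt //; elim: k {kn} => [|k IHk].
  by rewrite muln0 scale1r.
by rewrite !iterS IHk /hoch_t linearZZ /= scalerA -exprD mulnS.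
Qed.

Lemma t_order n (x : hoch A n) : T n.+1 x = x.
Proof.
move: x; hext => f.
rewrite iter_t_pt // -signr_odd oddM /= andbN scale1r.
by apply: eq_pt => j jn; rewrite /rotk ltnS jn addnK.
Qed.

Lemma N_t n (x : hoch A n) : hoch_N (hoch_t x) = hoch_N x.
Proof.
rewrite /hoch_N; under eq_bigr do rewrite -iterSr.
rewrite big_ord_recr [RHS]big_ord_recl addrC; congr (_ + _); exact: t_order.
Qed.

Lemma t_N n (x : hoch A n) : hoch_t (hoch_N x) = hoch_N x.
Proof.
rewrite -[RHS]N_t /hoch_N linear_sum; apply: eq_bigr => i _.
by rewrite -iterS -iterSr.
Qed.

Lemma iter_t_N n k (x : hoch A n) : T k (hoch_N x) = hoch_N x.
Proof. by elim: k => //= k ->; rewrite t_N. Qed.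
Lemma N_iter_t n k (x : hoch A n) : hoch_N (T k x) = hoch_N x.
Proof. by elim: k => //= k; rewrite N_t. Qed.

(** In degree n+1 the operator t has order n+2, so [T (n.+2 - i)] is the inverse of [T i]: every
    signed face is a conjugate of the first one, and identities between faces reduce to counting
    powers of t. *)
Lemma merge_conj n (i : 'I_n.+1) (x : hoch A n.+1) :
  (-1) ^+ i *: face i x = T i (d0 (T (n.+2 - i) x)).
Proof.
move: x; apply: hoch_ext => [c x y|c x y|f].
- by rewrite linearP scalerDr !scalerA mulrC.
- by rewrite !linearP.
have iN : (i < n.+1)%N := ltn_ord i.
rewrite iter_t_pt ?leq_subr // linearZZ /= !face_pt linearZZ /= iter_t_pt 1?ltnW //.
rewrite scalerA -exprD; congr (_ *: _).
  rewrite -signr_odd -[RHS]signr_odd oddD !oddM oddB ?(ltnW iN) /=; last by lia.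
  by case: (odd n); case: (odd i).
apply: eq_pt => j jn; rewrite /rotk /mrg /=.
case: (ltngtP j i) => ji.
- have -> : (j + n.+1 - i == 0)%N = false by lia.
  by case: ltnP => h; [lia | congr f; lia].
- have -> : (j - i == 0)%N = false by lia.
  by case: ltnP => h; [congr f; lia | lia].
- rewrite ji subnn eqxx.
  by case: ltnP => ?; [case: ltnP => ?; [congr (f _ * f _)|] |]; lia.
Qed.

(** The operator b': the Hochschild differential without its wrap-around face. It is the
    differential of the bar resolution, with [hoch A m.+1] as the bimodule in degree m. *)
Definition bar_b n (x : hoch A n.+1) : hoch A n :=
  \sum_(i < n.+1) (-1) ^+ i *: face i x.

Lemma bar_b_is_linear n : linear (@bar_b n).
Proof.
move=> c x y; rewrite /bar_b scaler_sumr -big_split; apply: eq_bigr => i _.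
by rewrite linearP scalerDr !scalerA mulrC.
Qed.
HB.instance Definition _ n := GRing.isLinear.Build K (hoch A n.+1) (hoch A n) *:%R
  (@bar_b n) (@bar_b_is_linear n).

Lemma bar_bE n (x : hoch A n.+1) :
  bar_b x = \sum_(i < n.+1) T i (d0 (T (n.+2 - i) x)).
Proof. by apply: eq_bigr => i _; rewrite merge_conj. Qed.

Lemma b_bar n (x : hoch A n.+1) : hoch_b x = bar_b x + d0 (hoch_t x).
Proof. by rewrite /hoch_t linearZZ. Qed.

(** b'N = Nb. Since N absorbs powers of t on either side, conjugated faces all become d_0, and both
    sides equal N d_0 N. *)
Lemma bar_b_N n (x : hoch A n.+1) : bar_b (hoch_N x) = hoch_N (hoch_b x).
Proof.
transitivity (hoch_N (d0 (hoch_N x))).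
  by rewrite bar_bE [RHS]/hoch_N; apply: eq_bigr => i _; rewrite iter_t_N.
rewrite b_bar bar_bE [in RHS]linearD /= (linear_sum (@hoch_N _ A n)) /=.
under [X in _ = X + _]eq_bigr do rewrite N_iter_t.
have -> : hoch_N x = \sum_(i < n.+1) T (n.+2 - i) x + hoch_t x.
  rewrite -N_t /hoch_N big_ord_recl addrC; congr (_ + _).
  rewrite (reindex_inj rev_ord_inj); apply: eq_bigr => i _.
  have -> : (n.+2 - i = (fintype.lift ord0 (rev_ord i)).+1)%N.
    by rewrite /= /bump; have := ltn_ord i; lia.
  by rewrite iterSr.
by rewrite !linearD /= (linear_sum (@face _ A n ord0)) (linear_sum (@hoch_N _ A n)).
Qed.

(** b(1 - t) = (1 - t)b'. With [u i] the conjugated faces of t x, the terms left to compare are two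
    groupings of the sum of [u i] over i < n+2: as u_0 plus t b' x, and as b'(t x) plus u_(n+1). *)
Lemma b_1t n (x : hoch A n.+1) :
  hoch_b (x - hoch_t x) = bar_b x - hoch_t (bar_b x).
Proof.
rewrite linearB /=; apply/eqP; rewrite subr_eq addrAC -subr_eq opprK; apply/eqP.
rewrite !b_bar -addrA; congr (_ + _).
rewrite !bar_bE (linear_sum (@hoch_t _ A n)) /=.
pose u i := T i (d0 (T (n.+2 - i) (hoch_t x))).
have u0 : d0 (hoch_t x) = u 0%N by rewrite /u subn0 t_order.
have uS : d0 (hoch_t (hoch_t x)) = u n.+1.
  by rewrite /u t_order subSn // subnn.
have uE (i : 'I_n.+1) : hoch_t (T i (d0 (T (n.+2 - i) x))) = u i.+1.
  by rewrite /u iterS -[in RHS]iterSr -subSn //= ltnS ltnW.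
under [X in _ + X = _]eq_bigr do rewrite uE.
by rewrite u0 uS; transitivity (\sum_(i < n.+2) u i);
  [rewrite [RHS]big_ord_recl | rewrite big_ord_recr].
Qed.

Lemma bar_b0 n : bar_b (0 : hoch A n.+1) = 0. Proof. exact: linear0. Qed.
Lemma bar_bD n (x y : hoch A n.+1) : bar_b (x + y) = bar_b x + bar_b y.
Proof. exact: (linearD (@bar_b n)). Qed.
Lemma bar_bBr n (x y : hoch A n.+1) : bar_b (x - y) = bar_b x - bar_b y.
Proof.
rewrite bar_bD; congr (_ + _).
by apply/eqP; rewrite -subr_eq0 opprK -bar_bD addNr bar_b0.
Qed.

Lemma merge0_s n (x : hoch A n) : d0 (s x) = x.
Proof.
move: x; hext => f.
by rewrite cons1_pt face_pt; apply: eq_pt => -[|j] _; rewrite /mrg /= ?mul1r.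
Qed.

Lemma mergeS_s n (i : 'I_n.+1) (x : hoch A n.+1) :
  face (fintype.lift ord0 i) (s x) = s (face i x).
Proof.
move: x; hext => f.
by rewrite !(cons1_pt, face_pt); apply: eq_pt => -[|j] _.
Qed.

Lemma bar_b_s0 (x : hoch A 0) : bar_b (s x) = x.
Proof. by rewrite /bar_b big_ord1 scale1r merge0_s. Qed.

(** Prepending 1 is a contracting homotopy for b'; this is the exactness of the bar complex. *)
Lemma bar_b_s n (x : hoch A n.+1) : bar_b (s x) = x - s (bar_b x).
Proof.
rewrite /bar_b big_ord_recl scale1r merge0_s linear_sum -sumrN; congr (_ + _).
by apply: eq_bigr => i _; rewrite mergeS_s linearZZ /= exprS mulN1r scaleNr.
Qed.

Lemma bar_b_lmul n a (x : hoch A n.+1) :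
  bar_b (atslot 0 (lmul a) x) = atslot 0 (lmul a) (bar_b x).
Proof.
rewrite /bar_b linear_sum; apply: eq_bigr => i _; rewrite linearZZ /=; congr (_ *: _).
move: x; hext => f.
rewrite !(atslot_pt, face_pt); apply: eq_pt => -[|j] _; rewrite /mrg /upd /=.
  by case: ifP => // ?; case: ifP => [_|]; [rewrite /lmul mulrA | lia].
by [].
Qed.

Lemma bar_b_rmul n a (x : hoch A n.+1) :
  bar_b (atslot n.+1 (rmul a) x) = atslot n (rmul a) (bar_b x).
Proof.
rewrite /bar_b linear_sum; apply: eq_bigr => i _; rewrite linearZZ /=; congr (_ *: _).
move: x; hext => f.
rewrite !(atslot_pt, face_pt); apply: eq_pt => j jn; rewrite /mrg /upd !eqSS.
have := ltn_ord i; rewrite ltnS => iN.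
have [->|jN] := eqVneq j n; last first.
  by have -> : (j == n.+1) = false by lia.
have -> : (n == n.+1) = false by lia.
by case: ifP => [|_]; [lia | case: ifP => _ //=; rewrite /rmul mulrA].
Qed.

Lemma pt_lmul_s n f : pt n.+1 f = atslot 0 (lmul (f 0%N)) (s (pt n (fun j => f j.+1))).
Proof.
by rewrite cons1_pt atslot_pt; apply: eq_pt => -[|j] _; rewrite /upd //= /lmul mulr1.
Qed.

(** No simplicial identities are needed: a pure tensor is a left multiple of some s y, b' is left
    linear, and b's = 1 - sb' reduces the claim to lower degree. *)
Lemma bar_bb n (x : hoch A n.+2) : bar_b (bar_b x) = 0.
Proof.
have zL m r : linear (fun _ : hoch A m => 0 : hoch A r).
  by move=> c u v; rewrite /= scaler0 addr0.
elim: n x => [|n IHn]; (apply: hoch_ext => [c u v||f]; [by rewrite !linearP | exact: zL |]).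
  by rewrite pt_lmul_s !bar_b_lmul bar_b_s bar_bBr bar_b_s0 subrr linear0.
rewrite pt_lmul_s !bar_b_lmul bar_b_s bar_bBr bar_b_s IHn.
by rewrite linear0 subr0 subrr linear0.
Qed.

(** Seen as a map from the bar resolution, this is the passage to the commutator quotient, which
    turns the bar complex into the Hochschild complex. *)
Definition close n (x : hoch A n.+1) : hoch A n := d0 (hrot x).

Lemma close_is_linear n : linear (@close n).
Proof. by move=> c x y; rewrite /close !linearP. Qed.
HB.instance Definition _ n := GRing.isLinear.Build K (hoch A n.+1) (hoch A n) *:%R
  (@close n) (@close_is_linear n).
#[global] Arguments close : simpl never.

Lemma closeD n (u v : hoch A n.+1) : close (u + v) = close u + close v.
Proof. exact: (linearD (@close n)). Qed.
Lemma closeZ n c (u : hoch A n.+1) : close (c *: u) = c *: close u.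
Proof. exact: (linearZZ (@close n)). Qed.
Lemma close0 n : close (0 : hoch A n.+1) = 0. Proof. exact: linear0. Qed.
Lemma closeB n (u v : hoch A n.+1) : close (u - v) = close u - close v.
Proof. by rewrite closeD -scaleN1r closeZ scaleN1r. Qed.

Lemma close_pt n f : close (pt n.+1 f) =
  pt n (fun j => if j == 0%N then f n.+1 * f 0%N else f j).
Proof. by rewrite /close /= hrot_pt face_pt; apply: eq_pt => -[|j]. Qed.

Lemma hoch_bE n (x : hoch A n.+1) :
  hoch_b x = \sum_(i < n.+1) (-1) ^+ i *: face i x + (-1) ^+ n.+1 *: close x.
Proof. by []. Qed.

Lemma close_bar_b n (x : hoch A n.+2) : close (bar_b x) = hoch_b (close x).
Proof.
move: x; hext => f.
rewrite /bar_b (linear_sum (@close n)) big_ord_recr hoch_bE /=; congr (_ + _).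
  apply: eq_bigr => i _; rewrite linearZZ /=; congr (_ *: _).
  rewrite face_pt !close_pt face_pt; apply: eq_pt => -[|j] jn; rewrite /mrg /=.
    have -> : (n.+1 < i)%N = false by have := ltn_ord i; lia.
    have -> : (n.+1 == i)%N = false by have := ltn_ord i; lia.
    by case: ifP => // ?; case: ifP => [_|]; [rewrite mulrA | lia].
  by [].
rewrite linearZZ /=; congr (_ *: _).
rewrite face_pt !close_pt; apply: eq_pt => -[|j] jn; rewrite /mrg /=.
  by rewrite ltnn eqxx mulrA.
by rewrite ltnS jn.
Qed.

Lemma close_surj n (x : hoch A n) : close ((-1) ^+ n.+1 *: T n.+1 (s x)) = x.
Proof.
have -> y : close ((-1) ^+ n.+1 *: y) = d0 (hoch_t y) :> hoch A n.
  by rewrite /close /hoch_t !linearZZ.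
by rewrite -iterS t_order merge0_s.
Qed.

(** Inherited from b'b' = 0, because [close] is surjective and intertwines b' with b. *)
Lemma hoch_bb n (x : hoch A n.+2) : hoch_b (hoch_b x) = 0.
Proof.
by rewrite -[x]close_surj -!close_bar_b bar_bb linear0.
Qed.

Lemma connes_BE n (x : hoch A n) :
  connes_B x = s (hoch_N x) - hoch_t (s (hoch_N x)).
Proof. by []. Qed.

Lemma hoch_bB0 (x : hoch A 0) : hoch_b (connes_B x) = 0.
Proof. by rewrite connes_BE b_1t bar_b_s0 t_N subrr. Qed.

(** b(1 - t)sN = (1 - t)b'sN = (1 - t)(1 - sb')N; the first term vanishes as (1 - t)N = 0, and b'N =
    Nb turns the second into -Bb. *)
Lemma hoch_bB n (x : hoch A n.+1) : hoch_b (connes_B x) = - connes_B (hoch_b x).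
Proof.
rewrite !connes_BE b_1t bar_b_s bar_b_N hoch_tB t_N.
by rewrite !opprB addrC addrA subrK.
Qed.

Lemma connes_BB n (x : hoch A n) : connes_B (connes_B x) = 0.
Proof. by rewrite connes_BE [connes_B x]connes_BE hoch_NB N_t subrr !linear0 ?subr0 ?addr0. Qed.

Lemma total_dd (x : hoch_prod A) : total_d (total_d x) = 0.
Proof.
apply: hoch_prodP => q; rewrite -[RHS]/(0 : hoch A q) /total_d.
case: q => [|q]; first by rewrite hoch_bD hoch_bb hoch_bB0 !addr0.
rewrite hoch_bD connes_BD hoch_bb hoch_bB.
rewrite add0r addrA addNr add0r.
by case: q => [|q]; rewrite ?connes_BB ?connes_B0.
Qed.
End CyclicOperators.

(** * Vanishing of Hochschild homology *)

Section SlotAlgebra.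
Variables (K : fieldType) (A : algType K).
Implicit Types (phi chi : {linear A -> A}) (i j m : nat).

Lemma atslotC i j phi chi m (v : hoch A m) : i != j ->
  atslot i phi (atslot j chi v) = atslot j chi (atslot i phi v).
Proof.
move=> ij; move: v; hext => f; rewrite !atslot_pt; apply: eq_pt => k _.
by rewrite /upd; do !case: eqP => //; move=> *; subst; rewrite eqxx in ij.
Qed.

Lemma atslot_comp i phi chi (xi : {linear A -> A}) m (v : hoch A m) :
  (forall a, phi (chi a) = xi a) -> atslot i phi (atslot i chi v) = atslot i xi v.
Proof.
move=> H; move: v; hext => f; rewrite !atslot_pt; apply: eq_pt => k _.
by rewrite /upd eqxx; case: eqP.
Qed.

Lemma atslot_comp2 i (p1 p2 p3 p4 : {linear A -> A}) m (v : hoch A m) :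
  (forall a, p1 (p2 a) = p3 (p4 a)) ->
  atslot i p1 (atslot i p2 v) = atslot i p3 (atslot i p4 v).
Proof.
move=> H; move: v; hext => f; rewrite !atslot_pt; apply: eq_pt => k _.
by rewrite /upd eqxx; case: eqP.
Qed.

Lemma atslot_id i phi m (v : hoch A m) : (forall a, phi a = a) -> atslot i phi v = v.
Proof.
move=> H; move: v; hext => f; rewrite !atslot_pt; apply: eq_pt => k _.
by rewrite /upd; case: eqP => [->|].
Qed.

Lemma atslot0 i phi m : atslot i phi (0 : hoch A m) = 0. Proof. exact: linear0. Qed.
Lemma atslotD i phi m (u v : hoch A m) :
  atslot i phi (u + v) = atslot i phi u + atslot i phi v.
Proof. exact: (linearD (@atslot _ A i phi m)). Qed.
Lemma atslotN i phi m (u : hoch A m) : atslot i phi (- u) = - atslot i phi u.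
Proof. exact: (linearN (@atslot _ A i phi m)). Qed.
Lemma atslotB i phi m (u v : hoch A m) :
  atslot i phi (u - v) = atslot i phi u - atslot i phi v.
Proof. by rewrite atslotD atslotN. Qed.
Lemma atslotZ i phi m c (u : hoch A m) : atslot i phi (c *: u) = c *: atslot i phi u.
Proof. exact: (linearZZ (@atslot _ A i phi m)). Qed.
Lemma atslot_sum i phi m (I : Type) (r : seq I) (P : pred I) (F : I -> hoch A m) :
  atslot i phi (\sum_(k <- r | P k) F k) = \sum_(k <- r | P k) atslot i phi (F k).
Proof. exact: (linear_sum (@atslot _ A i phi m)). Qed.
Lemma atslot_lmulP i m c a b (v : hoch A m) : (i <= m)%N ->
  atslot i (lmul (c *: a + b)) v = c *: atslot i (lmul a) v + atslot i (lmul b) v.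
Proof.
move=> im; move: v; apply: hoch_ext => [e x y|e x y|f].
- by rewrite atslotD atslotZ.
- by rewrite !atslotD !atslotZ !scalerDr !scalerA ![c * e]mulrC addrACA.
- by rewrite !atslot_pt -pt_linear //= /lmul mulrDl scalerAl.
Qed.

Lemma atslot_rmulP i m c a b (v : hoch A m) : (i <= m)%N ->
  atslot i (rmul (c *: a + b)) v = c *: atslot i (rmul a) v + atslot i (rmul b) v.
Proof.
move=> im; move: v; apply: hoch_ext => [e x y|e x y|f].
- by rewrite atslotD atslotZ.
- by rewrite !atslotD !atslotZ !scalerDr !scalerA ![c * e]mulrC addrACA.
- by rewrite !atslot_pt -pt_linear //= /rmul mulrDr scalerAr.
Qed.

End SlotAlgebra.

(** * The commutators with the variables form a regular sequence on the bar complex *)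

Section RegularSequence.
Variables (K : fieldType) (A : algType K) (d : nat) (x : nat -> A).
(** An abstract division by the variables: [delta i] is a left inverse of multiplication by [x i],
    commutes with the other variables, and is locally nilpotent. *)
Variable delta : nat -> {linear A -> A}.
Hypothesis xC : forall i j, (i < d)%N -> (j < d)%N -> x i * x j = x j * x i.
Hypothesis deltaK : forall i a, (i < d)%N -> delta i (x i * a) = a.
Hypothesis deltaC : forall i j a, (i < d)%N -> (j < d)%N -> i != j ->
  delta i (x j * a) = x j * delta i a.
Hypothesis delta_nil : forall i a, (i < d)%N -> exists N, iter N (delta i) a = 0.

Section FixedDegree.
Variable m : nat.
Local Notation V := (hoch A m.+1).
Implicit Types (u v w : V) (i j k N : nat).

Definition mulX i (v : V) : V := atslot 0 (lmul (x i)) v.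
Definition mulY i (v : V) : V := atslot m.+1 (rmul (x i)) v.
Definition dell i (v : V) : V := atslot 0 (delta i) v.
Definition commx i (v : V) : V := mulX i v - mulY i v.

Lemma dell_mulX i v : (i < d)%N -> dell i (mulX i v) = v.
Proof.
move=> id; rewrite /dell /mulX (@atslot_comp _ _ _ _ _ idfun) ?atslot_id //.
by move=> a; exact: deltaK.
Qed.
Lemma dell_mulXC i j v : (i < d)%N -> (j < d)%N -> i != j ->
  dell i (mulX j v) = mulX j (dell i v).
Proof. by move=> id jd ij; apply: atslot_comp2 => a; exact: deltaC. Qed.
Lemma dell_mulY i j v : dell i (mulY j v) = mulY j (dell i v).
Proof. exact: atslotC. Qed.
Lemma mulX_mulY i j v : mulX i (mulY j v) = mulY j (mulX i v).
Proof. exact: atslotC. Qed.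
Lemma mulXX i j v : (i < d)%N -> (j < d)%N -> mulX i (mulX j v) = mulX j (mulX i v).
Proof. by move=> id jd; apply: atslot_comp2 => a; rewrite /= /lmul !mulrA xC. Qed.
Lemma mulYY i j v : (i < d)%N -> (j < d)%N -> mulY i (mulY j v) = mulY j (mulY i v).
Proof. by move=> id jd; apply: atslot_comp2 => a; rewrite /= /rmul -!mulrA xC. Qed.

Lemma commx_dell i j v : (i < d)%N -> (j < d)%N -> i != j ->
  dell i (commx j v) = commx j (dell i v).
Proof. by move=> id jd ij; rewrite /commx /dell atslotB -!/(dell _ _) dell_mulXC // dell_mulY. Qed.
Lemma commx_mulY i j v : (i < d)%N -> (j < d)%N -> mulY i (commx j v) = commx j (mulY i v).
Proof. by move=> id jd; rewrite /commx {1}/mulY atslotB -!/(mulY _ _) -mulX_mulY mulYY. Qed.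
Lemma commx_mulX i j v : (i < d)%N -> (j < d)%N -> mulX i (commx j v) = commx j (mulX i v).
Proof. by move=> id jd; rewrite /commx {1}/mulX atslotB -!/(mulX _ _) mulX_mulY mulXX. Qed.
Lemma commxC i j v : (i < d)%N -> (j < d)%N -> commx i (commx j v) = commx j (commx i v).
Proof.
move=> id jd; rewrite {1}/commx commx_mulX // commx_mulY // /commx /mulX /mulY !atslotB.
by rewrite !opprB addrACA [RHS]addrACA; congr (_ + _); rewrite addrC.
Qed.

Lemma commxD i u v : commx i (u + v) = commx i u + commx i v.
Proof. by rewrite /commx /mulX /mulY !atslotD opprD addrACA. Qed.
Lemma commx0 i : commx i 0 = 0. Proof. by rewrite /commx /mulX /mulY !atslot0 subrr. Qed.
Lemma commxN i u : commx i (- u) = - commx i u.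
Proof. by apply/eqP; rewrite -subr_eq0 opprK -commxD addNr commx0. Qed.
Lemma commxB i u v : commx i (u - v) = commx i u - commx i v.
Proof. by rewrite commxD commxN. Qed.
Lemma commx_sum i N (F : nat -> V) :
  commx i (\sum_(k < N) F k) = \sum_(k < N) commx i (F k).
Proof.
elim: N => [|N IHN]; first by rewrite !big_ord0 commx0.
by rewrite !big_ord_recr /= commxD IHN.
Qed.

Lemma mulXB i u v : mulX i (u - v) = mulX i u - mulX i v. Proof. exact: atslotB. Qed.
Lemma mulYB i u v : mulY i (u - v) = mulY i u - mulY i v. Proof. exact: atslotB. Qed.

Lemma telescope_ord (g : nat -> V) N : \sum_(k < N) (g k - g k.+1) = g 0%N - g N.
Proof.
elim: N => [|M IHM]; first by rewrite big_ord0 subrr.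
by rewrite big_ord_recr /= IHM addrA subrK.
Qed.

Lemma iter_dell0 i N : iter N (dell i) 0 = 0.
Proof. by elim: N => //= N ->; exact: atslot0. Qed.

Lemma dell_nil i v : (i < d)%N -> exists N, iter N (dell i) v = 0.
Proof.
move=> id; elim/hoch_ind: v => [|c u v [N1 Nu] [N2 Nv]|f]; first by exists 0%N.
  exists (N2 + N1)%N.
  have iterP N y z : iter N (dell i) (c *: y + z) = c *: iter N (dell i) y + iter N (dell i) z.
    by elim: N => //= N ->; rewrite /dell atslotD atslotZ.
  by rewrite iterP iterD Nu iter_dell0 scaler0 add0r addnC iterD Nv iter_dell0.
have [N Nf] := delta_nil (f 0%N) id; exists N.
suff -> : iter N (dell i) (pt m.+1 f) = pt m.+1 (upd f 0 (iter N (delta i) (f 0%N))).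
  by rewrite Nf pt_upd0.
elim: N {Nf} => [|N IHN] /=; first by rewrite pt_upd_id.
rewrite IHN /dell atslot_pt; apply: eq_pt => k _.
by rewrite /upd eqxx; case: eqP.
Qed.

Definition nil_index i v (id : (i < d)%N) : nat := projT1 (cid (dell_nil v id)).

(** Write X for [mulX i] and D for [dell i]. As DX = 1, the operator 1 - XD projects onto the kernel
    of D, so (1 - XD)D^N v is the coefficient of X^N in v; here X^N is replaced by the N-th power of
    right multiplication. *)
Definition subst_term i N v : V :=
  iter N (mulY i) (iter N (dell i) v - mulX i (iter N.+1 (dell i) v)).

(* Moves all factors x_i standing at the left end of the word to its right end. *)
Definition subst i (v : V) : V :=
  if pselect (i < d)%N is left id then \sum_(k < nil_index v id) subst_term i k v else v.

Lemma iter_mulY0 i N : iter N (mulY i) 0 = 0.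
Proof. by elim: N => //= N ->; exact: atslot0. Qed.

Lemma subst_term0 i N k v : iter N (dell i) v = 0 -> (N <= k)%N -> subst_term i k v = 0.
Proof.
move=> vN /subnK <-; rewrite /subst_term -addnS !iterD vN.
by rewrite !iterS vN /dell atslot0 -/(dell i) iter_dell0 /mulX atslot0 subr0 -iterD iter_mulY0.
Qed.

Lemma sum_stable (F : nat -> V) N M : (N <= M)%N ->
  (forall k, (N <= k)%N -> F k = 0) -> \sum_(k < M) F k = \sum_(k < N) F k.
Proof.
move=> NM F0; rewrite (big_ord_widen M F NM) [RHS]big_mkcond; apply: eq_bigr => k _.
by case: ltnP => // /F0.
Qed.

Lemma substE i N v : (i < d)%N -> iter N (dell i) v = 0 ->
  subst i v = \sum_(k < N) subst_term i k v.
Proof.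
move=> id vN; rewrite /subst; case: pselect => // id'; rewrite /nil_index.
case: cid => M /= vM; have [MN|/ltnW NM] := leqP M N.
  by rewrite (@sum_stable (fun k => subst_term i k v) _ _ MN) // => k; exact: subst_term0.
by rewrite (@sum_stable (fun k => subst_term i k v) _ _ NM) // => k; exact: subst_term0.
Qed.

Lemma iter_mulYD i N u v : iter N (mulY i) (u + v) = iter N (mulY i) u + iter N (mulY i) v.
Proof. by elim: N => //= N ->; rewrite /mulY atslotD. Qed.
Lemma iter_mulYN i N u : iter N (mulY i) (- u) = - iter N (mulY i) u.
Proof. by elim: N => //= N ->; rewrite /mulY atslotN. Qed.
Lemma iter_dellD i N u v : iter N (dell i) (u + v) = iter N (dell i) u + iter N (dell i) v.
Proof. by elim: N => //= N ->; rewrite /dell atslotD. Qed.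
Lemma iter_dellN i N u : iter N (dell i) (- u) = - iter N (dell i) u.
Proof. by elim: N => //= N ->; rewrite /dell atslotN. Qed.

Lemma subst_termD i N u v : subst_term i N (u + v) = subst_term i N u + subst_term i N v.
Proof.
by rewrite /subst_term !iter_dellD /mulX atslotD opprD addrACA -iter_mulYD.
Qed.

(** The number of terms in [subst] depends on the chain; additivity follows by evaluating all three
    sums with one bound that works for both [u] and [v]. *)
Lemma substD i u v : (i < d)%N -> subst i (u + v) = subst i u + subst i v.
Proof.
move=> id; have [N1 uN] := dell_nil u id; have [N2 vN] := dell_nil v id.
have uN' : iter (N2 + N1) (dell i) u = 0 by rewrite iterD uN iter_dell0.
have vN' : iter (N2 + N1) (dell i) v = 0 by rewrite addnC iterD vN iter_dell0.
rewrite !(@substE i (N2 + N1)) ?iter_dellD ?uN' ?vN' ?addr0 //.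
by rewrite -big_split; apply: eq_bigr => k _; rewrite subst_termD.
Qed.

Lemma subst0 i : (i < d)%N -> subst i 0 = 0.
Proof. by move=> id; rewrite (@substE i 0) // big_ord0. Qed.

Lemma iter_dell_commx i j N v : (i < d)%N -> (j < d)%N -> i != j ->
  iter N (dell i) (commx j v) = commx j (iter N (dell i) v).
Proof. by move=> id jd ij; elim: N => //= N ->; rewrite commx_dell. Qed.
Lemma iter_mulY_commx i j N v : (i < d)%N -> (j < d)%N ->
  iter N (mulY i) (commx j v) = commx j (iter N (mulY i) v).
Proof. by move=> id jd; elim: N => //= N ->; rewrite commx_mulY. Qed.

Lemma subst_commxC i j v : (i < d)%N -> (j < d)%N -> i != j ->
  subst i (commx j v) = commx j (subst i v).
Proof.
move=> id jd ij; have [N vN] := dell_nil v id.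
rewrite !(@substE i N) ?iter_dell_commx ?vN ?commx0 //.
rewrite (commx_sum j N (fun k => subst_term i k v)).
apply: eq_bigr => k _; rewrite /subst_term !iter_dell_commx // commx_mulX //.
by rewrite -commxB iter_mulY_commx.
Qed.

Lemma iter_dell_mulY i N v : iter N (dell i) (mulY i v) = mulY i (iter N (dell i) v).
Proof. by elim: N => //= N ->; rewrite dell_mulY. Qed.

(** Each coefficient of [v] occurs twice, shifted up by one power through [mulX] and multiplied on
    the right through [mulY]; after substitution the two contributions cancel in a telescoping
    sum. *)
Lemma subst_commx i v : (i < d)%N -> subst i (commx i v) = 0.
Proof.
move=> id; have [N vN] := dell_nil v id.
have dS k : iter k.+1 (dell i) (commx i v) = iter k (dell i) v - mulY i (iter k.+1 (dell i) v).
  by rewrite /commx iter_dellD iter_dellN iter_dell_mulY iterSr dell_mulX.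
have vN1 : iter N.+1 (dell i) v = 0 by rewrite iterS vN /dell atslot0.
pose g k := iter k.+1 (mulY i) (iter k (dell i) v - mulX i (iter k.+1 (dell i) v)).
rewrite (@substE i N.+1) //; last by rewrite dS vN vN1 /mulY atslot0 subr0.
rewrite big_ord_recl.
have -> : subst_term i 0 (commx i v) = - g 0%N.
  rewrite /subst_term dS /g /= /commx mulXB mulYB mulX_mulY !opprB.
  by rewrite addrC addrA subrK.
have E k : subst_term i k.+1 (commx i v) = g k - g k.+1.
  rewrite /subst_term !dS /g [iter k.+2 (mulY i) _]iterSr -iter_mulYN -iter_mulYD.
  congr iter; rewrite mulXB mulYB mulX_mulY !opprB [LHS]addrACA [RHS]addrACA.
  by congr (_ + _); rewrite addrC.
under eq_bigr do rewrite E.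
rewrite telescope_ord.
by rewrite addKr /g vN vN1 /mulX atslot0 subr0 iter_mulY0 oppr0.
Qed.

(** The witness is the divided difference (f(x) - f(y)) / (x - y), expanded as the sum of y^k
    D^(k+1) f. *)
Lemma sub_subst i v : (i < d)%N -> exists w, v - subst i v = commx i w.
Proof.
move=> id; have [N vN] := dell_nil v id.
exists (\sum_(k < N) iter k (mulY i) (iter k.+1 (dell i) v)).
rewrite (substE id vN) (commx_sum i N (fun k => iter k (mulY i) (iter k.+1 (dell i) v))).
apply/eqP; rewrite subr_eq -big_split; apply/eqP.
pose h k := iter k (mulY i) (iter k (dell i) v).
transitivity (h 0%N - h N); first by rewrite /h vN iter_mulY0 subr0.
rewrite -telescope_ord; apply: eq_bigr => k _; rewrite /subst_term -iter_mulY_commx //=.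
by rewrite -iter_mulYD [X in _ = iter _ _ X]addrC /commx addrA subrK iter_mulYD iter_mulYN -iterSr.
Qed.

(** If left and right multiplication agree on [v], then v = D X v = D Y v = Y D v, hence v = Y^N D^N
    v, which vanishes for large N. *)
Lemma commx_inj i v : (i < d)%N -> commx i v = 0 -> v = 0.
Proof.
move=> id /eqP; rewrite subr_eq0 => /eqP XY; have [N vN] := dell_nil v id.
have E : v = mulY i (dell i v) by rewrite -dell_mulY -XY dell_mulX.
suff -> : v = iter N (mulY i) (iter N (dell i) v) by rewrite vN iter_mulY0.
elim: N {vN} => // N {1}->; rewrite [RHS]iterSr; congr iter.
by rewrite {1}E iter_dell_mulY -iterSr.
Qed.

Definition Idl j v := exists w : nat -> V, v = \sum_(i < j) commx i (w i).

Lemma Idl0 j : Idl j 0.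
Proof. by exists (fun=> 0); rewrite big1 // => i _; rewrite commx0. Qed.

Lemma IdlD j u v : Idl j u -> Idl j v -> Idl j (u + v).
Proof.
move=> [f ->] [g ->]; exists (fun i => f i + g i).
by rewrite -big_split; apply: eq_bigr => i _; rewrite commxD.
Qed.

Lemma IdlN j u : Idl j u -> Idl j (- u).
Proof.
by move=> [f ->]; exists (fun i => - f i); rewrite -sumrN; apply: eq_bigr => i _; rewrite commxN.
Qed.

Lemma commxZ i c u : commx i (c *: u) = c *: commx i u.
Proof. by rewrite /commx /mulX /mulY !atslotZ scalerBr. Qed.

Lemma IdlZ j c u : Idl j u -> Idl j (c *: u).
Proof.
move=> [f ->]; exists (fun i => c *: f i).
by rewrite scaler_sumr; apply: eq_bigr => i _; rewrite commxZ.
Qed.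

Lemma Idl_sum j (I : Type) (r : seq I) (F : I -> V) :
  (forall k : I, Idl j (F k)) -> Idl j (\sum_(k <- r) F k).
Proof. by move=> IF; elim/big_ind: _ => //; [exact: Idl0 | exact: IdlD]. Qed.

Lemma Idl_commx i j w : (i < j)%N -> Idl j (commx i w).
Proof.
move=> ij; exists (fun k => if k == i then w else 0).
rewrite (bigD1 (Ordinal ij)) //= eqxx big1 ?addr0 // => k /negPf ki.
by rewrite -(inj_eq val_inj) in ki; rewrite ki commx0.
Qed.

Lemma IdlSP j v : Idl j.+1 v -> exists w u, v = commx j w + u /\ Idl j u.
Proof.
move=> [f ->]; exists (f j), (\sum_(i < j) commx i (f i)).
by rewrite big_ord_recr /= addrC; split=> //; exists f.
Qed.

Lemma IdlS j v : Idl j v -> Idl j.+1 v.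
Proof.
move=> [f ->]; rewrite (eq_bigr (fun i : 'I_j => commx i (f i))) //.
by apply: Idl_sum => i; apply: Idl_commx; apply: ltnW; rewrite ltnS.
Qed.

Lemma Idl_stable i j v : (i < d)%N -> (j <= d)%N -> Idl j v -> Idl j (commx i v).
Proof.
move=> id jd [f ->]; rewrite (commx_sum i j (fun k => commx k (f k))).
apply: Idl_sum => k; rewrite commxC //; first exact: Idl_commx.
exact: leq_trans jd.
Qed.

Fixpoint substs j v : V := if j is j'.+1 then subst j' (substs j' v) else v.

Lemma substsD j u v : (j <= d)%N -> substs j (u + v) = substs j u + substs j v.
Proof. by elim: j => //= j IHj jd; rewrite IHj ?substD // ltnW. Qed.

Lemma substs0 j : (j <= d)%N -> substs j 0 = 0.
Proof. by elim: j => //= j IHj jd; rewrite IHj ?subst0 // ltnW. Qed.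

Lemma substs_commxC k j v : (j <= k)%N -> (k < d)%N ->
  substs j (commx k v) = commx k (substs j v).
Proof.
elim: j => //= j IHj jk kd; rewrite (IHj (ltnW jk) kd) subst_commxC ?neq_ltn ?jk //.
exact: ltn_trans kd.
Qed.

Lemma substs_commx i j v : (i < j)%N -> (j <= d)%N -> substs j (commx i v) = 0.
Proof.
elim: j => //= j IHj; rewrite ltnS leq_eqVlt => /orP[/eqP->|ij] jd.
  by rewrite substs_commxC // subst_commx.
by rewrite IHj ?subst0 // ltnW.
Qed.

Lemma substs_Idl j v : (j <= d)%N -> Idl j v -> substs j v = 0.
Proof.
move=> jd [f ->]; rewrite big_seq.
elim/big_rec: _ => [|i u _ IHu]; first exact: substs0.
by rewrite substsD // IHu addr0 substs_commx.
Qed.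

Lemma sub_substs j v : (j <= d)%N -> Idl j (v - substs j v).
Proof.
elim: j => [|j IHj] jd /=; first by rewrite subrr; exact: Idl0.
have [w E] := sub_subst (substs j v) jd.
rewrite -[v - _](subrKA (substs j v)) E.
by apply: IdlD; [apply/IdlS/IHj/ltnW | exact: Idl_commx].
Qed.

(** [substs j] kills [Idl j], is the identity modulo it and commutes with [commx j]. It thus reduces
    injectivity modulo [Idl j] to plain injectivity of [commx j]. *)
Lemma Idl_regular j v : (j < d)%N -> Idl j (commx j v) -> Idl j v.
Proof.
move=> jd /(substs_Idl (ltnW jd)); rewrite substs_commxC // => /(commx_inj jd) v0.
by rewrite -[v]subr0 -v0; apply: sub_substs; apply: ltnW.
Qed.

End FixedDegree.

Lemma bar_b_commx m i (v : hoch A m.+2) : bar_b (commx i v) = commx i (bar_b v).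
Proof.
by rewrite /commx bar_bBr bar_b_lmul bar_b_rmul.
Qed.

Lemma bar_b_Idl m j (v : hoch A m.+2) : Idl j v -> Idl j (bar_b v).
Proof.
move=> [f ->]; exists (fun i => bar_b (f i)).
by rewrite (linear_sum (@bar_b _ A _)); apply: eq_bigr => i _; exact: bar_b_commx.
Qed.

(* The Koszul argument: [x_j (x) 1 - 1 (x) x_j], [j < d], is a regular sequence
   of endomorphisms of the (exact) bar complex, and each quotient costs one degree. *)
Lemma bar_b_exact_mod j m (z : hoch A m.+2) : (j <= d)%N -> (j <= m)%N ->
  Idl j (bar_b z) -> exists y : hoch A m.+3, Idl j (z - bar_b y).
Proof.
elim: j m z => [|j IHj] m z jd jm.
  move=> [w]; rewrite big_ord0 => z0; exists (cons1 z).
  by rewrite bar_b_s z0 linear0 subr0 subrr; exact: Idl0.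
case: m jm z => // m jm z /IdlSP[w [u [zE uI]]].
have jd' := ltnW jd.
(* Applying b' to b'z = commx_j w + u puts commx_j (b'w) in [Idl j], and by regularity [w] is a
   cycle modulo [Idl j], one degree below [z]: this is the degree lost. Writing w = b'y1 modulo
   [Idl j], the chain z - commx_j y1 is a cycle modulo [Idl j], in the degree of [z]. *)
have : Idl j (commx j (bar_b w)).
  rewrite -bar_b_commx -[commx j w](addrK u) -zE bar_bBr bar_bb sub0r.
  exact/IdlN/bar_b_Idl.
case/(Idl_regular jd)/(IHj m w jd' jm) => y1 wI.
have [|y yI] := IHj _ (z - commx j y1) jd' (leqW jm).
  rewrite bar_bBr bar_b_commx zE addrAC -commxB.
  by apply: IdlD => //; apply: Idl_stable.
exists y; rewrite -[z](subrK (commx j y1)) addrAC.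
by apply: IdlD; [exact: IdlS | exact: Idl_commx].
Qed.
End RegularSequence.

(** * Lifting Hochschild chains to bar chains *)

Section AppendOne.
Variables (K : fieldType) (A : algType K).
Implicit Types n : nat.

(** The section y |-> y (x) 1 of [close], obtained by rotating 1 (x) y; the sign in front cancels
    the one produced by the powers of t. *)
Definition app1 n (y : hoch A n) : hoch A n.+1 :=
  (-1) ^+ n.+1 *: iter n.+1 (@hoch_t _ A n.+1) (cons1 y).

Lemma app1_is_linear n : linear (@app1 n).
Proof.
move=> c u v; rewrite /app1 (linearP (@cons1 _ A n)).
by rewrite (linearP (iter n.+1 (@hoch_t _ A n.+1))) scalerDr !scalerA [c * _]mulrC.
Qed.
HB.instance Definition _ n := GRing.isLinear.Build K (hoch A n) (hoch A n.+1) *:%R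
  (@app1 n) (@app1_is_linear n).

Lemma app1D n (u v : hoch A n) : app1 (u + v) = app1 u + app1 v.
Proof. exact: (linearD (@app1 n)). Qed.
Lemma app1Z n c (u : hoch A n) : app1 (c *: u) = c *: app1 u.
Proof. exact: (linearZZ (@app1 n)). Qed.
Lemma app10 n : app1 (0 : hoch A n) = 0. Proof. exact: linear0. Qed.

Lemma app1_pt n f : app1 (pt n f) = pt n.+1 (fun j => if j == n.+1 then 1 else f j).
Proof.
rewrite /app1 cons1_pt iter_t_pt // scalerA -exprD -signr_odd oddD oddM andbb addbb scale1r.
apply: eq_pt => j jn; rewrite /rotk; case: ltnP => h.
  have -> : (j + n.+2 - n.+1 = j.+1)%N by lia.
  by have -> : (j == n.+1) = false by lia.
have -> : j = n.+1 by lia.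
by rewrite subnn eqxx.
Qed.

Lemma close_app1 n (y : hoch A n) : close (app1 y) = y.
Proof. exact: close_surj. Qed.

Lemma face_app1 n (i : 'I_n.+1) (y : hoch A n.+1) :
  face (widen_ord (leqnSn n.+1) i) (app1 y) = app1 (face i y).
Proof.
move: y; hext => f; rewrite app1_pt !face_pt app1_pt; apply: eq_pt => j jn.
have iN : (i <= n)%N by rewrite -ltnS.
rewrite /mrg /= !eqSS; have [->|jN] := eqVneq j n.+1.
  have -> : (n.+1 < i)%N = false by lia.
  by have -> : (n.+1 == i) = false by lia.
by have -> : (j == n.+2) = false by lia.
Qed.

Lemma face_last_app1 n (y : hoch A n) : face ord_max (app1 y) = y.
Proof.
move: y; hext => f; rewrite app1_pt face_pt; apply: eq_pt => j jn; rewrite /mrg /= !eqSS.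
case: ltngtP jn => // [jn|->] _; first by have -> : (j == n.+1) = false by lia.
have -> : (n == n.+1) = false by lia.
by rewrite mulr1.
Qed.

Lemma bar_b_app1 n (y : hoch A n.+1) : bar_b (app1 y) = app1 (bar_b y) + (-1) ^+ n.+1 *: y.
Proof.
rewrite {1}/bar_b big_ord_recr /= face_last_app1; congr (_ + _).
rewrite (linear_sum (@app1 n)); apply: eq_bigr => i _.
by rewrite face_app1 [RHS](linearZZ (@app1 n)).
Qed.
End AppendOne.

(** * Averaging over the group and vanishing of HH *)

Section HochschildVanishing.
Variables (K : fieldType) (A : algType K) (d : nat) (x : nat -> A).
Variable delta : nat -> {linear A -> A}.
Hypothesis xC : forall i j, (i < d)%N -> (j < d)%N -> x i * x j = x j * x i.
Hypothesis deltaK : forall i a, (i < d)%N -> delta i (x i * a) = a.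
Hypothesis deltaC : forall i j a, (i < d)%N -> (j < d)%N -> i != j ->
  delta i (x j * a) = x j * delta i a.
Hypothesis delta_nil : forall i a, (i < d)%N -> exists N, iter N (delta i) a = 0.

Variables (G : finGroupType) (U : G -> A).
Hypothesis U1 : U 1%g = 1.
Hypothesis UM : forall g h, U (g * h)%g = U g * U h.
Hypothesis Ux : forall g j, (j < d)%N -> exists M : nat -> K,
  U g * x j * U g^-1%g = \sum_(i < d) M i *: x i.
Hypothesis genA : forall P : A -> Prop,
  (forall c a b, P a -> P b -> P (c *: a + b)) -> (forall a b, P a -> P b -> P (a * b)) ->
  (forall g, P (U g)) -> (forall j, (j < d)%N -> P (x j)) -> forall a, P a.
Hypothesis cardG : #|G|%:R != 0 :> K.

Section Average.
Variable m : nat.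
Local Notation V := (hoch A m.+1).
Local Notation L a := (@atslot K A 0 (lmul a) m.+1).
Local Notation Rt a := (@atslot K A m.+1 (rmul a) m.+1).
Local Notation I := (@Idl K A x m d).

(** Outer conjugation of a bar chain. It commutes with b' and is invisible after [close], where
    [U g^-1] and [U g] meet and cancel. *)
Definition conjg_word g (v : V) : V := L (U g) (Rt (U g^-1%g) v).
Definition avg (v : V) : V := \sum_(g : G) conjg_word g v.

Lemma lmulM a b v : L (a * b) v = L a (L b v).
Proof. by apply/esym/atslot_comp => c; rewrite /= /lmul mulrA. Qed.
Lemma rmulM a b v : Rt (a * b) v = Rt b (Rt a v).
Proof. by apply/esym/atslot_comp => c; rewrite /= /rmul mulrA. Qed.
Lemma lmul_rmul a b v : L a (Rt b v) = Rt b (L a v).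
Proof. exact: atslotC. Qed.
Lemma L_linear c a b v : L (c *: a + b) v = c *: L a v + L b v.
Proof. exact: atslot_lmulP. Qed.
Lemma R_linear c a b v : Rt (c *: a + b) v = c *: Rt a v + Rt b v.
Proof. exact: atslot_rmulP. Qed.
Lemma L_0 v : L 0 v = 0.
Proof. by have := L_linear (-1) 0 0 v; rewrite scaler0 addr0 => ->; rewrite scaleN1r addNr. Qed.
Lemma R_0 v : Rt 0 v = 0.
Proof. by have := R_linear (-1) 0 0 v; rewrite scaler0 addr0 => ->; rewrite scaleN1r addNr. Qed.
Lemma L_sum M v : L (\sum_(i < d) M i *: x i) v = \sum_(i < d) M i *: mulX x i v.
Proof. by elim/big_rec2: _ => [|i y a _ <-]; rewrite ?L_0 // L_linear. Qed.
Lemma R_sum M v : Rt (\sum_(i < d) M i *: x i) v = \sum_(i < d) M i *: mulY x i v.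
Proof. by elim/big_rec2: _ => [|i y a _ <-]; rewrite ?R_0 // R_linear. Qed.

Lemma avgD u v : avg (u + v) = avg u + avg v.
Proof. by rewrite /avg -big_split; apply: eq_bigr => g _; rewrite /conjg_word !atslotD. Qed.
Lemma avgZ c v : avg (c *: v) = c *: avg v.
Proof. by rewrite /avg scaler_sumr; apply: eq_bigr => g _; rewrite /conjg_word !atslotZ. Qed.

Lemma U_VK g : U g^-1%g * U g = 1. Proof. by rewrite -UM mulVg. Qed.

(** The property passes to products and linear combinations, so generators suffice. For [U h],
    reindex the sum over the group; for [x j], the conjugate by [U g] is a combination of the
    variables, whose left and right actions agree modulo the ideal. *)
Lemma avg_cyclic a v : I (avg (Rt a v) - avg (L a v)).
Proof.
move: a v; apply: genA => [c a b Ia Ib v|a b Ia Ib v|h v|j jd v].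
- rewrite R_linear L_linear !avgD !avgZ opprD addrACA -scalerBr.
  by apply: IdlD; [apply: IdlZ | exact: Ib].
- rewrite rmulM lmulM -[_ - _](subrKA (avg (Rt a (L b v)))).
  by apply: IdlD; [rewrite -lmul_rmul; exact: Ib | exact: Ia].
- have -> : avg (Rt (U h) v) = avg (L (U h) v).
    rewrite /avg (reindex_inj (mulIg h)); apply: eq_bigr => g _.
    by rewrite /conjg_word -rmulM -UM invMg mulKVg UM lmulM !lmul_rmul.
  by rewrite subrr; exact: Idl0.
- rewrite /avg -sumrB; apply: Idl_sum => g.
  have [M E] := Ux g jd.
  have -> : conjg_word g (Rt (x j) v) = \sum_(i < d) M i *: mulY x i (conjg_word g v).
    rewrite -R_sum -E /conjg_word -lmul_rmul -!rmulM; congr (L _ _); congr (Rt _ _).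
    by rewrite !mulrA U_VK mul1r.
  have -> : conjg_word g (L (x j) v) = \sum_(i < d) M i *: mulX x i (conjg_word g v).
    rewrite -L_sum -E /conjg_word -lmul_rmul -!lmulM; congr (L _ _).
    by rewrite -mulrA U_VK mulr1.
  rewrite -sumrB; apply: Idl_sum => i; rewrite -scalerBr -opprB; apply/IdlZ/IdlN.
  exact: Idl_commx.
Qed.

Lemma avg0 : avg 0 = 0.
Proof. by have := avgZ 0 0; rewrite !scale0r. Qed.

Lemma avg_close v : I (avg (v - app1 (close v))).
Proof.
have avgB u w : avg (u - w) = avg u - avg w by rewrite avgD -scaleN1r avgZ scaleN1r.
elim/hoch_ind: v => [|c u v Iu Iv|f].
- by rewrite close0 app10 subr0 avg0; exact: Idl0.
- have -> : c *: u + v - app1 (close (c *: u + v)) =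
      c *: (u - app1 (close u)) + (v - app1 (close v)).
    by rewrite closeD closeZ app1D app1Z scalerBr opprD addrACA.
  by rewrite avgD avgZ; apply: IdlD => //; apply: IdlZ.
pose z := pt m.+1 (upd f m.+1 1).
have -> : pt m.+1 f = Rt (f m.+1) z.
  by rewrite atslot_pt; apply: eq_pt => j _; rewrite /upd /= /rmul eqxx mul1r; case: eqP => // ->.
have -> : app1 (close (Rt (f m.+1) z)) = L (f m.+1) z.
  rewrite !atslot_pt close_pt app1_pt; apply: eq_pt => -[|j] jm; rewrite /upd /= /rmul /lmul.
    by rewrite eqxx mul1r.
  by rewrite eqSS; case: eqP.
by rewrite avgB; exact: avg_cyclic.
Qed.
End Average.

Lemma bar_b_avg m (v : hoch A m.+2) : bar_b (avg v) = avg (bar_b v).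
Proof.
rewrite /avg (linear_sum (@bar_b _ A _)); apply: eq_bigr => g _.
by rewrite /conjg_word /= bar_b_lmul bar_b_rmul.
Qed.

Lemma close_conjg_word m g (v : hoch A m.+1) : close (conjg_word g v) = close v.
Proof.
rewrite /conjg_word; move: v; hext => f.
rewrite !atslot_pt !close_pt; apply: eq_pt => -[|j] jm; rewrite /upd /= ?eqSS.
  by rewrite /rmul /lmul eqxx -mulrA [U _ * _]mulrA U_VK mul1r.
by have -> : (j == m) = false by lia.
Qed.

Lemma close_commx m i (v : hoch A m.+1) : close (commx x i v) = 0.
Proof.
rewrite /commx /mulX /mulY closeB; apply/eqP; rewrite subr_eq0; apply/eqP.
move: v; hext => f.
rewrite !atslot_pt !close_pt; apply: eq_pt => -[|j] jm; rewrite /upd /= ?eqxx ?eqSS.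
  by rewrite /lmul /rmul mulrA.
by have -> : (j == m) = false by lia.
Qed.

(** For a Hochschild cycle [z], the bar boundary of z (x) 1 is, up to sign, z - [app1 (close z)],
    whose average lies in the ideal. So the average w of z (x) 1 is a bar cycle modulo the ideal,
    hence a bar boundary b'y modulo the ideal. Closing kills the ideal and turns w into |G| z, which
    is therefore b of [close y]. *)
Lemma hoch_vanish q (z : hoch A q.+1) : (d <= q)%N -> hoch_b z = 0 -> exists y, z = hoch_b y.
Proof.
move=> dq bz; pose w := avg (app1 z).
have wI : Idl x d (bar_b w).
  have E : bar_b (app1 z) = (-1) ^+ q.+1 *: (z - app1 (close z)).
    rewrite bar_b_app1 -[RHS]add0r -app10 -bz hoch_bE -/(bar_b z) app1D app1Z scalerBr.
    by rewrite -addrA [X in _ = _ + X]addrC subrK.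
  by rewrite /w bar_b_avg E avgZ; apply: IdlZ; exact: avg_close.
have [y [f E]] := bar_b_exact_mod xC deltaK deltaC delta_nil (leqnn d) dq wI.
have cw : close w = #|G|%:R *: z.
  rewrite /w /avg (linear_sum (@close _ A _)) /=.
  under eq_bigr do rewrite close_conjg_word close_app1.
  by rewrite sumr_const scaler_nat cardT.
exists (#|G|%:R^-1 *: close y).
rewrite hoch_bZ -close_bar_b -[z](scalerK cardG) -cw; congr (_ *: _).
apply/eqP; rewrite -subr_eq0 -closeB E (linear_sum (@close _ A _)).
by rewrite big1 // => i _; exact: close_commx.
Qed.
End HochschildVanishing.

(** * Derivations and weights *)

Section CartanHomotopy.
Variables (K : fieldType) (A : algType K) (D : {linear A -> A}).
Hypothesis DM : forall a b, D (a * b) = D a * b + a * D b.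
Implicit Types n i j k : nat.

Local Notation T k x := (iter k (@hoch_t _ A _) x).
Local Notation s := (@cons1 _ A _).
Local Notation d0 := (face ord0).
Local Notation Dj j v := (atslot j D v).

Definition Dsum n k (v : hoch A n) : hoch A n := \sum_(j < k) Dj j v.
Definition Lie n (v : hoch A n) : hoch A n := Dsum n.+1 v.
(** The contraction e_D: it sends a_0 (x) .. (x) a_(n+1) to D(a_(n+1)) a_0 (x) a_1 (x) .. (x) a_n
    with sign (-1)^n. *)
Definition cap n (v : hoch A n.+1) : hoch A n := (-1) ^+ n *: close (Dj n.+1 v).
Definition Yterm n k (v : hoch A n) : hoch A n := Dsum k (T k v).
(** Prepending 1 to this gives Rinehart's operator E_D: in the k-th rotation a_0 stands in slot k,
    and D runs over the factors in front of it. *)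
Definition Ysum n (v : hoch A n) : hoch A n := \sum_(k < n.+1) Yterm k v.
(** Signed faces, uniformly including the wrap-around one as i = n+1, in the conjugated form that
    moves past rotations. *)
Definition beta n i (v : hoch A n.+1) : hoch A n := T i (d0 (T (n.+2 - i) v)).

Lemma iter_tD n k (u v : hoch A n) : T k (u + v) = T k u + T k v.
Proof. exact: (linearD (iter k (@hoch_t _ A n))). Qed.
Lemma iter_tZ n k c (u : hoch A n) : T k (c *: u) = c *: T k u.
Proof. exact: (linearZZ (iter k (@hoch_t _ A n))). Qed.
Lemma iter_t_sum n k (I : Type) (r : seq I) (F : I -> hoch A n) :
  T k (\sum_(i <- r) F i) = \sum_(i <- r) T k (F i).
Proof. exact: (linear_sum (iter k (@hoch_t _ A n))). Qed.

Lemma DsumD n k (u v : hoch A n) : Dsum k (u + v) = Dsum k u + Dsum k v.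
Proof. by rewrite /Dsum -big_split; apply: eq_bigr => j _; rewrite atslotD. Qed.
Lemma DsumZ n k c (u : hoch A n) : Dsum k (c *: u) = c *: Dsum k u.
Proof. by rewrite /Dsum scaler_sumr; apply: eq_bigr => j _; rewrite atslotZ. Qed.
Lemma Dsum0 n k : Dsum k (0 : hoch A n) = 0.
Proof. by rewrite /Dsum big1 // => j _; rewrite atslot0. Qed.
Lemma Dsum_sum n k (I : Type) (r : seq I) (F : I -> hoch A n) :
  Dsum k (\sum_(i <- r) F i) = \sum_(i <- r) Dsum k (F i).
Proof. by elim/big_rec2: _ => [|i y a _ <-]; rewrite ?Dsum0 // DsumD. Qed.

Lemma t_pt n f : hoch_t (pt n f) = (-1) ^+ n *: pt n (rotf n f) :> hoch A n.
Proof. by rewrite /hoch_t -/(hrot _) hrot_pt. Qed.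

Lemma t_Dj n j (v : hoch A n) : (j < n)%N -> hoch_t (Dj j v) = Dj j.+1 (hoch_t v).
Proof.
move=> jn; move: v; hext => f; rewrite !(atslot_pt, t_pt) atslotZ atslot_pt; congr (_ *: _).
apply: eq_pt => -[|k] _; rewrite /upd /rotf //=.
by have -> : (n == j) = false by lia.
Qed.

Lemma t_Dlast n (v : hoch A n) : hoch_t (Dj n v) = Dj 0 (hoch_t v).
Proof.
move: v; hext => f; rewrite !(atslot_pt, t_pt) atslotZ atslot_pt; congr (_ *: _).
apply: eq_pt => -[|k] kn; rewrite /upd /rotf /= ?eqxx //.
by have -> : (k == n) = false by lia.
Qed.

Lemma iter_t_Dlast n k (v : hoch A n) : (k <= n)%N -> T k.+1 (Dj n v) = Dj k (T k.+1 v).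
Proof.
elim: k => [|k IHk] kn; first exact: t_Dlast.
by rewrite iterS IHk ?(ltnW kn) // t_Dj.
Qed.

Lemma t_Yterm n k (v : hoch A n) : (k <= n)%N ->
  hoch_t (Yterm k v) = Yterm k.+1 v - Dj 0 (T k.+1 v).
Proof.
move=> kn; rewrite /Yterm /Dsum big_ord_recl addrAC subrr add0r -[hoch_t _]/(T 1 _) iter_t_sum.
by apply: eq_bigr => j _; rewrite [LHS]t_Dj //; apply: leq_trans kn.
Qed.

(** Rotating [Yterm k] gives [Yterm k.+1] without its term in slot 0. The sum telescopes to the last
    [Yterm], which is the Lie derivative as t^(n+1) = 1, and the missing terms add up to D_0 N. *)
Lemma Ysum_1t n (v : hoch A n) : Ysum v - hoch_t (Ysum v) = Dj 0 (hoch_N v) - Lie v.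
Proof.
rewrite /Ysum -[hoch_t _]/(T 1 _) iter_t_sum.
have -> : \sum_(i < n.+1) T 1 (Yterm i v) =
    \sum_(i < n.+1) (Yterm i.+1 v - Dj 0 (T i.+1 v)).
  by apply: eq_bigr => k _; apply: t_Yterm; rewrite -ltnS.
have -> : hoch_N v = \sum_(k < n.+1) T k.+1 v.
  by rewrite -N_t /hoch_N; apply: eq_bigr => k _; rewrite -iterSr.
rewrite sumrB opprB addrCA atslot_sum; congr (_ + _).
rewrite [X in X - _]big_ord_recl [X in _ - X]big_ord_recr /= {1}/Yterm /Dsum big_ord0 add0r.
by rewrite opprD addrA subrr add0r /Lie /Yterm t_order.
Qed.

Lemma betaE n i (v : hoch A n.+1) (io : (i < n.+1)%N) :
  beta i v = (-1) ^+ i *: face (Ordinal io) v.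
Proof. by rewrite -[LHS](merge_conj (Ordinal io)). Qed.

Lemma beta_last n (v : hoch A n.+1) : beta n.+1 v = (-1) ^+ n.+1 *: close v.
Proof.
rewrite /beta subSnn t_order -[T 1 v]/((-1) ^+ n.+1 *: hrot v).
exact: (linearZZ (@face _ A n ord0)).
Qed.

Lemma b_beta n (v : hoch A n.+1) : hoch_b v = \sum_(i < n.+2) beta i v.
Proof.
rewrite big_ord_recr /= beta_last hoch_bE; congr (_ + _).
by apply: eq_bigr => i _; rewrite (betaE _ (ltn_ord i)); congr (_ *: face _ _); apply: val_inj.
Qed.

Lemma bar_b_beta n (v : hoch A n.+1) : bar_b v = \sum_(i < n.+1) beta i v.
Proof. by rewrite bar_bE. Qed.

Lemma iter_t_period n k (v : hoch A n) : T (n.+1 + k) v = T k v.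
Proof. by rewrite iterD t_order. Qed.

Lemma beta_shift_ge n i k (v : hoch A n.+1) : (k <= i <= n.+1)%N ->
  beta i (T k v) = T k (beta (i - k) v).
Proof.
move=> /andP[ki iN]; rewrite /beta -!iterD subnKC //; congr (iter _ _ (d0 (iter _ _ _))); lia.
Qed.

Lemma beta_shift_lt n i k (v : hoch A n.+1) : (i < k <= n.+1)%N ->
  beta i (T k v) = T k.-1 (beta (n.+2 - k + i) v).
Proof.
move=> /andP[ik kN]; rewrite /beta -!iterD.
have -> : (n.+2 - i + k = n.+2 + (k - i))%N by lia.
have -> : (k.-1 + (n.+2 - k + i) = n.+1 + i)%N by lia.
rewrite !iter_t_period; congr (iter _ _ (d0 (iter _ _ _))); lia.
Qed.

Lemma face_Dj_lt n (i : 'I_n.+1) j (v : hoch A n.+1) : (j < i)%N ->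
  face i (Dj j v) = Dj j (face i v).
Proof.
move=> ji; move: v; hext => f; rewrite !(atslot_pt, face_pt); apply: eq_pt => k _.
rewrite /upd /mrg; have [->|kj] := eqVneq k j; first by rewrite ji.
have [ki|] := leqP i k; last by [].
by have -> : (k.+1 == j) = false by lia.
Qed.

Lemma face_Dj_gt n (i : 'I_n.+1) j (v : hoch A n.+1) : (i.+1 < j)%N ->
  face i (Dj j v) = Dj j.-1 (face i v).
Proof.
case: j => // j ji; move: v; hext => f; rewrite !(atslot_pt, face_pt); apply: eq_pt => k _.
rewrite /upd /mrg /= eqSS; have [->|kj] := eqVneq k j.
  have -> : (j < i)%N = false by lia.
  by have -> : (j == i) = false by lia.
case: ltnP => ki; first by have -> : (k == j.+1) = false by lia.
by case: eqP => // ->; have -> : (i == j.+1 :> nat) = false by lia.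
Qed.

Lemma face_Dj_eq n (i : 'I_n.+1) (v : hoch A n.+1) :
  face i (Dj i v) + face i (Dj i.+1 v) = Dj i (face i v).
Proof.
move: v; apply: hoch_ext => [c u v|c u v|f].
- have fD := linearP (@face _ A n i).
  by rewrite !(atslotD, atslotZ) !fD scalerDr addrACA.
- by rewrite (linearP (@face _ A n i)) atslotD atslotZ.
rewrite !(atslot_pt, face_pt) /=.
have E a : pt n (mrg i (upd f i a)) = pt n (upd (mrg i f) i (a * f i.+1)).
  apply: eq_pt => k _; rewrite /upd /mrg.
  have [ki|ki|ki] := ltngtP k i => //; have -> : (k.+1 == i) = false by lia.
    by [].
  by rewrite ki.
have E' a : pt n (mrg i (upd f i.+1 a)) = pt n (upd (mrg i f) i (f i * a)).
  apply: eq_pt => k _; rewrite /upd /mrg eqSS.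
  have [ki|ki|ki] := ltngtP k i => //; have -> : (k == i.+1) = false by lia.
    by [].
  by rewrite ki.
rewrite E E' -pt_updD; last by rewrite -ltnS.
apply: eq_pt => k _; rewrite /upd.
by case: eqP => // _; rewrite /mrg ltnn eqxx DM.
Qed.

Lemma beta_Dj_lt n i j (v : hoch A n.+1) : (j < i < n.+1)%N ->
  beta i (Dj j v) = Dj j (beta i v).
Proof. by move=> /andP[ji io]; rewrite !(betaE _ io) face_Dj_lt // atslotZ. Qed.

Lemma beta_Dj_gt n i j (v : hoch A n.+1) : (i < n.+1)%N -> (i.+1 < j)%N ->
  beta i (Dj j v) = Dj j.-1 (beta i v).
Proof. by move=> io ij; rewrite !(betaE _ io) face_Dj_gt // atslotZ. Qed.

Lemma beta_Dj_eq n i (v : hoch A n.+1) : (i < n.+1)%N ->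
  beta i (Dj i v) + beta i (Dj i.+1 v) = Dj i (beta i v).
Proof.
by move=> io; rewrite !(betaE _ io) -scalerDr (face_Dj_eq (Ordinal io)) atslotZ.
Qed.

Lemma betaD n i (u v : hoch A n.+1) : beta i (u + v) = beta i u + beta i v.
Proof. by rewrite /beta iter_tD (linearD (@face _ A n ord0)) iter_tD. Qed.
Lemma beta0 n i : beta i (0 : hoch A n.+1) = 0.
Proof. by apply: (addrI (beta i (0 : hoch A n.+1))); rewrite -betaD !addr0. Qed.
Lemma beta_sum n i (I : Type) (r : seq I) (F : I -> hoch A n.+1) :
  beta i (\sum_(k <- r) F k) = \sum_(k <- r) beta i (F k).
Proof. by elim/big_rec2: _ => [|k y a _ <-]; rewrite ?beta0 // betaD. Qed.

Lemma beta_Dsum_ge n i k (v : hoch A n.+1) : (k <= i < n.+1)%N ->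
  beta i (Dsum k v) = Dsum k (beta i v).
Proof.
move=> /andP[ki io]; rewrite /Dsum beta_sum; apply: eq_bigr => j _.
by rewrite beta_Dj_lt // io andbT; apply: leq_trans ki.
Qed.

Lemma beta_Dsum_eq n i (v : hoch A n.+1) : (i < n.+1)%N ->
  beta i (Dsum i.+1 v) = Dsum i (beta i v) + beta i (Dj i v).
Proof.
by move=> io; rewrite /Dsum big_ord_recr betaD -/(Dsum i v) beta_Dsum_ge // leqnn.
Qed.

Lemma beta_Dsum_lt n i k (v : hoch A n.+1) : (i < n.+1)%N -> (i.+1 < k)%N ->
  beta i (Dsum k v) = Dsum k.-1 (beta i v).
Proof.
move=> io; elim: k => // k IHk; rewrite ltnS leq_eqVlt => /orP[/eqP<-|ik].
  rewrite /Dsum big_ord_recr betaD /= -/(Dsum i.+1 v) beta_Dsum_eq // -addrA beta_Dj_eq //.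
  by rewrite [RHS]big_ord_recr.
rewrite /Dsum big_ord_recr betaD /= -/(Dsum k v) IHk // beta_Dj_gt //.
by case: k ik {IHk} => // k _; rewrite [RHS]big_ord_recr.
Qed.

Lemma capE n (v : hoch A n.+1) : cap v = - beta n.+1 (Dj n.+1 v).
Proof. by rewrite /cap beta_last exprS mulN1r scaleNr opprK. Qed.

Lemma Yterm_beta_ge n i k (v : hoch A n.+1) : (k <= i < n.+1)%N ->
  beta i (Yterm k v) = Yterm k (beta (i - k) v).
Proof.
move=> /andP[ki io]; rewrite /Yterm beta_Dsum_ge ?ki // beta_shift_ge //.
by rewrite ki ltnW.
Qed.

Lemma Yterm_beta_lt n i k (v : hoch A n.+1) : (i < k < n.+1)%N ->
  beta i (Yterm k.+1 v) = Yterm k (beta (n.+2 - k.+1 + i) v).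
Proof.
move=> /andP[ik kN]; rewrite /Yterm beta_Dsum_lt ?(ltn_trans ik) //=.
by rewrite -[hoch_t _]/(T k.+1 v) beta_shift_lt // ltnW //= ltnS ltnW.
Qed.

Lemma Yterm_beta_eq n k (v : hoch A n.+1) : (k < n.+1)%N ->
  beta k (Yterm k.+1 v) = Yterm k (beta (n.+2 - k.+1 + k) v) - T k (cap v).
Proof.
move=> kN; rewrite /Yterm beta_Dsum_eq // -iter_t_Dlast 1?ltnW //.
rewrite !beta_shift_lt ?leqnn //=; congr (_ + _).
have -> : (n.+2 - k.+1 + k = n.+1)%N by lia.
have -> : beta n.+1 (Dj n.+1 v) = -1 *: cap v by rewrite capE scaleN1r opprK.
by rewrite iter_tZ scaleN1r.
Qed.

(** b'Y = Yb - N e_D. Each face of a [Yterm] is a [Yterm] of a face, except the one merging the last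
    differentiated factor a_(n+1) with a_0: it retains half of a Leibniz rule, and these halves add
    up to -N e_D. *)
Lemma bar_b_Ysum n (v : hoch A n.+1) :
  bar_b (Ysum v) = Ysum (hoch_b v) - hoch_N (cap v).
Proof.
pose y k j := Yterm k (beta j v).
(* Both sides contain the sum of the [a k]. They differ by having [r k.+1] against [r k], and these
   sums agree since [r 0] and [r n.+1] vanish. *)
pose a k := \sum_(0 <= i < k.+1) y k (n.+1 - k + i)%N.
pose r k := \sum_(0 <= j < n.+1 - k) y k j.
have Y0 m (u : hoch A m) : Yterm 0 u = 0 by rewrite /Yterm /Dsum big_ord0.
have inner (k : 'I_n.+1) : \sum_(i < n.+1) beta i (Yterm k.+1 v) = a k - T k (cap v) + r k.+1.
  have /= kN := ltn_ord k.
  rewrite -(big_mkord xpredT (fun i => beta i (Yterm k.+1 v))) (@big_cat_nat _ _ _ k.+1) //=.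
  congr (_ + _).
    rewrite /a !big_nat_recr //= Yterm_beta_eq // addrA; congr (_ + _ - _).
    rewrite big_nat [RHS]big_nat; apply: eq_bigr => i /andP[_ ik].
    by rewrite Yterm_beta_lt ?ik.
  rewrite /r -(add0n k.+1) big_addn !add0n big_nat [RHS]big_nat; apply: eq_bigr => i /andP[_ ik].
  by rewrite Yterm_beta_ge ?addnK // leq_addl /=; lia.
have outer (k : 'I_n.+1) : Yterm k (hoch_b v) = a k + r k.
  have /= kN := ltn_ord k.
  rewrite b_beta /Yterm iter_t_sum Dsum_sum -(big_mkord xpredT (y k)).
  rewrite (@big_cat_nat _ _ _ (n.+1 - k)) //=; last by lia.
  rewrite [RHS]addrC; congr (_ + _); rewrite -(add0n (n.+1 - k)%N) big_addn.
  have -> : (n.+2 - (n.+1 - k) = k.+1)%N by lia.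
  by apply: eq_bigr => i _; rewrite ?add0n addnC.
rewrite bar_b_beta /Ysum; under eq_bigr do rewrite beta_sum big_ord_recl Y0 beta0 add0r.
rewrite exchange_big /= (eq_bigr (fun k : 'I_n.+1 => a k - T k (cap v) + r k.+1)); last first.
  by move=> k _; exact: inner.
rewrite [in RHS](eq_bigr (fun k : 'I_n.+1 => a k + r k)); last by move=> k _; exact: outer.
rewrite !big_split /= sumrN addrAC /hoch_N; congr (_ + _ - _).
have r0 : r 0%N = 0 by rewrite /r big1 // => j _; exact: Y0.
have rN : r n.+1 = 0 by rewrite /r subnn big_geq.
transitivity (\sum_(k < n.+2) r k); first by rewrite [RHS]big_ord_recl r0 add0r.
by rewrite big_ord_recr /= rN addr0.
Qed.

Lemma cap_cons1 n (v : hoch A n) : cap (cons1 v) = Dj 0 (hoch_t v).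
Proof.
have E (u : hoch A n) : close (Dj n.+1 (cons1 u)) = Dj 0 (hrot u).
  move: u; hext => f.
  rewrite cons1_pt !atslot_pt close_pt hrot_pt atslot_pt; apply: eq_pt => -[|j] jn.
    by rewrite /upd /= eqxx mulr1.
  by rewrite /upd /= eqSS; have -> : (j == n) = false by lia.
by rewrite /cap E -atslotZ.
Qed.

Lemma b_cap n (v : hoch A n.+2) : hoch_b (cap v) = - cap (hoch_b v).
Proof.
rewrite /cap hoch_bZ -close_bar_b exprS mulN1r scaleNr; congr (- (_ *: _)).
have barD : bar_b (Dj n.+2 v) =
    Dj n.+1 (bar_b v) + (-1) ^+ n.+2 *: face ord_max (Dj n.+1 v).
  rewrite /bar_b [in LHS]big_ord_recr [in RHS]big_ord_recr /= atslotD atslotZ atslot_sum -addrA.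
  congr (_ + _).
    apply: eq_bigr => i _; rewrite atslotZ face_Dj_gt //=.
    by have := ltn_ord i; lia.
  have /= <- := face_Dj_eq ord_max v; rewrite scalerDr addrAC [(-1) ^+ n.+2]exprS mulN1r scaleNr.
  by rewrite subrr add0r.
rewrite barD hoch_bE -/(bar_b v) atslotD atslotZ !closeD !closeZ; congr (_ + _ *: _).
move: v {barD}; hext => f; rewrite atslot_pt face_pt !close_pt atslot_pt close_pt.
apply: eq_pt => -[|j] jn; rewrite /upd /mrg /= ?ltnn ?eqxx ?eqSS.
  have -> : (n.+1 == n) = false by lia.
  by rewrite mulrA.
by have -> : (j.+1 < n.+1)%N by lia.
Qed.

Lemma d0_t_cons1 n (y : hoch A n) : d0 (hoch_t (s y)) = - hoch_t y.
Proof.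
have -> : d0 (hoch_t (s y)) = (-1) ^+ n.+1 *: close (s y).
  exact: (linearZZ (@face _ A n ord0)).
have -> : close (s y) = hrot y.
  move: y; hext => f; rewrite cons1_pt close_pt hrot_pt; apply: eq_pt => -[|j] jn //=.
  by rewrite mulr1.
by rewrite exprS mulN1r scaleNr.
Qed.

(** On normalized chains sN is B. Here the difference is tsN x, and since b(s s y) = -t s y whenever
    b's y = y, it is the boundary of -s s N x. *)
Lemma cons1_N_connes0 (x : hoch A 0) :
  exists w, cons1 (hoch_N x) = connes_B x + hoch_b w.
Proof.
exists (- s (s (hoch_N x))); rewrite hoch_bN b_bar d0_t_cons1 bar_b_s bar_b_s0 subrr add0r.
by rewrite opprK subrK.
Qed.

Lemma cons1_N_connes n (x : hoch A n.+1) : hoch_b x = 0 ->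
  exists w, cons1 (hoch_N x) = connes_B x + hoch_b w.
Proof.
move=> bx; exists (- s (s (hoch_N x))); rewrite hoch_bN b_bar d0_t_cons1 !bar_b_s bar_b_N bx.
by rewrite linear0 linear0 subr0 subrr add0r opprK subrK.
Qed.

Lemma LieE n (x : hoch A n) :
  Lie x = cap (cons1 (hoch_N x)) - (Ysum x - hoch_t (Ysum x)).
Proof. by rewrite cap_cons1 t_N Ysum_1t opprB addrC subrK. Qed.

Lemma cap0 n : cap (0 : hoch A n.+1) = 0.
Proof. by rewrite /cap atslot0 close0 scaler0. Qed.

Lemma Lie_boundary0 (x : hoch A 0) : (exists w, connes_B x = hoch_b w) ->
  exists w, Lie x = hoch_b w.
Proof.
move=> [w Bx]; have [w' E] := cons1_N_connes0 x.
exists (- cap (w + w') - cons1 (Ysum x)).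
rewrite LieE E Bx -hoch_bD hoch_bBr hoch_bN b_cap opprK; congr (_ - _).
by rewrite b_bar bar_b_s0 d0_t_cons1.
Qed.

(** Combine L_D = e_D sN - (1 - t)Y with b(sYx) = (1 - t)Yx + sN e_D x, replacing sN by B up to
    boundaries. The replacement for [cap x] is a hypothesis because it is justified differently when
    [cap x] has degree 0. *)
Lemma Lie_boundary_core n (x : hoch A n.+1) : hoch_b x = 0 ->
    (exists w, cons1 (hoch_N (cap x)) = connes_B (cap x) + hoch_b w) ->
    (exists w, connes_B x = hoch_b w) ->
  exists w, Lie x = connes_B (cap x) + hoch_b w.
Proof.
move=> bx [w1 E1] [w Bx]; have [w2 E2] := cons1_N_connes bx.
exists (w1 - cap (w + w2) - cons1 (Ysum x)).
have Y0 : Ysum (hoch_b x) = 0.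
  by rewrite bx /Ysum big1 // => k _; rewrite /Yterm linear0 Dsum0.
have E3 : hoch_b (cons1 (Ysum x)) =
    Ysum x - hoch_t (Ysum x) + (connes_B (cap x) + hoch_b w1).
  rewrite b_bar bar_b_s d0_t_cons1 bar_b_Ysum Y0 sub0r -E1 addrAC; congr (_ + _).
  by rewrite -[- hoch_N _]scaleN1r (linearZZ (@cons1 _ A n)) scaleN1r opprK.
rewrite LieE E2 Bx -hoch_bD [hoch_b (_ - _ - _)]hoch_bBr hoch_bBr b_cap opprK E3.
move: (_ - hoch_t _) (connes_B _) (hoch_b w1) (cap (hoch_b _)) => y p q c.
by rewrite [RHS]addrA [p + (q + c)]addrA [y + _]addrC opprD addrACA subrr add0r.
Qed.

(* Rinehart's formula: modulo boundaries, [L_D = e_D B + B e_D] on cycles. *)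
Lemma Lie_boundary n (x : hoch A n.+2) : hoch_b x = 0 ->
  (exists w, connes_B x = hoch_b w) ->
  hoch_b (cap x) = 0 /\ exists w, Lie x = connes_B (cap x) + hoch_b w.
Proof.
move=> bx Bx; have bc : hoch_b (cap x) = 0 by rewrite b_cap bx cap0 oppr0.
by split=> //; apply: Lie_boundary_core => //; apply: cons1_N_connes.
Qed.

Lemma Lie_boundary1 (x : hoch A 1) : hoch_b x = 0 ->
  (exists w, connes_B x = hoch_b w) ->
  exists w, Lie x = connes_B (cap x) + hoch_b w.
Proof.
by move=> bx Bx; apply: Lie_boundary_core => //; apply: cons1_N_connes0.
Qed.
End CartanHomotopy.

(** * Weight spaces and exactness of the cyclic complex in positive weight *)

Section Weights.
Variables (K : fieldType) (A : algType K) (D : {linear A -> A}).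
Hypothesis DM : forall a b, D (a * b) = D a * b + a * D b.
Hypothesis charK : forall n, n.+1%:R != 0 :> K.

Definition ofwt (r : nat) (a : A) : Prop := D a = r%:R *: a.

Hypothesis ofwt_span : forall a, exists N (c : nat -> A),
  (forall r, ofwt r (c r)) /\ a = \sum_(r < N) c r.

Implicit Types (n i : nat) (P Q : nat -> Prop) (f : nat -> A) (r : nat -> nat).

Lemma ofwt1 : ofwt 0 1.
Proof.
rewrite /ofwt scale0r; apply: (addrI (D 1)); rewrite addr0.
by have := DM 1 1; rewrite !mulr1 mul1r => <-.
Qed.

Lemma ofwtM (r s : nat) a b : ofwt r a -> ofwt s b -> ofwt (r + s) (a * b).
Proof.
rewrite /ofwt => ha hb; rewrite DM ha hb natrD scalerDl -scalerAl -scalerAr.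
by [].
Qed.

Lemma ofwt0 (r : nat) : ofwt r 0. Proof. by rewrite /ofwt linear0 scaler0. Qed.

Lemma ofwtD (r : nat) a : ofwt r a -> ofwt r (D a).
Proof. by rewrite /ofwt => ha; rewrite {1}ha linearZZ. Qed.

Definition ofwts r f : Prop := forall i, ofwt (r i) (f i).
Definition wsum n r : nat := (\sum_(i < n.+1) r i)%N.

(* [Q] is a condition on the total weight of a tensor. *)
Inductive hspan n Q : hoch A n -> Prop :=
| hspan0 : hspan Q 0
| hspan_cons c f r x : ofwts r f -> Q (wsum n r) -> hspan Q x ->
    hspan Q (c *: pt n f + x).

Lemma hspan_pt n Q f r : ofwts r f -> Q (wsum n r) -> hspan Q (pt n f).
Proof.
move=> hf Qr; rewrite -[pt n f]scale1r -[1 *: _]addr0.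
exact: hspan_cons hf Qr (hspan0 _ _).
Qed.

Lemma hspanD n Q (x y : hoch A n) : hspan Q x -> hspan Q y -> hspan Q (x + y).
Proof.
move=> hx hy; elim: x / hx => [|c f r x hf Qr _ IH]; first by rewrite add0r.
by rewrite -addrA; apply: hspan_cons hf Qr IH.
Qed.

Lemma hspanZ n Q a (x : hoch A n) : hspan Q x -> hspan Q (a *: x).
Proof.
elim=> [|c f r y hf Qr _ IH]; first by rewrite scaler0; exact: hspan0.
by rewrite scalerDr scalerA; apply: hspan_cons hf Qr IH.
Qed.

Lemma hspanN n Q (x : hoch A n) : hspan Q x -> hspan Q (- x).
Proof. by rewrite -scaleN1r; exact: hspanZ. Qed.

Lemma hspanB n Q (x y : hoch A n) : hspan Q x -> hspan Q y -> hspan Q (x - y).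
Proof. by move=> hx hy; apply: hspanD => //; exact: hspanN. Qed.

Lemma hspan_sum n Q (I : Type) (s : seq I) (F : I -> hoch A n) :
  (forall k, hspan Q (F k)) -> hspan Q (\sum_(k <- s) F k).
Proof. by move=> IF; elim/big_ind: _ => //; [exact: hspan0 | exact: hspanD]. Qed.

Lemma hspan_mono n Q P (x : hoch A n) : (forall w, Q w -> P w) -> hspan Q x -> hspan P x.
Proof.
move=> QP; elim=> [|c f r y hf Qr _ IH]; first exact: hspan0.
by apply: hspan_cons hf _ IH; exact: QP.
Qed.

Lemma hspan_map n m Q P (F : hoch A n -> hoch A m) (x : hoch A n) : linear F ->
    (forall f r, ofwts r f -> Q (wsum n r) -> hspan P (F (pt n f))) ->
  hspan Q x -> hspan P (F x).
Proof.
move=> Fl FQ; elim=> [|c f r y hf Qr _ IH].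
  have := Fl (-1) 0 0; rewrite !scaleN1r !addNr => ->; exact: hspan0.
by rewrite Fl; apply: hspanD => //; apply/hspanZ/(FQ _ _ hf Qr).
Qed.

Lemma ofwts_upd r f i w a : ofwts r f -> ofwt w a ->
  ofwts (fun j => if j == i then w else r j) (upd f i a).
Proof. by move=> hf ha j; rewrite /upd; case: eqP. Qed.

Lemma hspan_all n (x : hoch A n) : hspan (fun=> True) x.
Proof.
elim/hoch_ind: x => [|c x y hx hy|f]; first exact: hspan0.
  by apply: hspanD => //; exact: hspanZ.
(* Induction on the number [k] of leading slots that are not yet homogeneous. *)
suff H k g : (k <= n.+1)%N -> (forall i, (k <= i)%N -> exists w, ofwt w (g i)) ->
    hspan (fun=> True) (pt n g).
  (* [ofwts] speaks of all indices, so the values beyond [n] are first set to 0, which has every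
     weight. *)
  have -> : pt n f = pt n (fun i => if (i <= n)%N then f i else 0).
    by apply: eq_pt => i ->.
  apply: (H n.+1) => // i ni; exists 0%N; rewrite leqNgt ni; exact: ofwt0.
elim: k g => [|k IHk] g kn hg.
  have [r hr] := choice (fun i => hg i (leq0n i)).
  by apply: (@hspan_pt _ _ _ r).
have [N [c [hc gE]]] := ofwt_span (g k).
rewrite -(pt_upd_id n g k) gE pt_upd_sum //; apply: hspan_sum => w.
apply: IHk; first exact: ltnW.
move=> i; rewrite leq_eqVlt => /orP[/eqP<-|ki]; rewrite /upd.
  by rewrite eqxx; exists w.
by rewrite gtn_eqF //; exact: hg.
Qed.

Lemma hspan_split n P Q (x : hoch A n) : hspan (fun w => P w \/ Q w) x ->
  exists y z, [/\ x = y + z, hspan P y & hspan Q z].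
Proof.
elim=> [|c f r u hf [Pr|Qr] _ [y [z [-> hy hz]]]].
- by exists 0, 0; split; [rewrite addr0 | exact: hspan0 | exact: hspan0].
- exists (c *: pt n f + y), z; split=> //; first by rewrite addrA.
  exact: hspan_cons hf Pr hy.
- exists y, (c *: pt n f + z); split=> //; first by rewrite addrCA.
  exact: hspan_cons hf Qr hz.
Qed.

Lemma hspan_finite n Q (x : hoch A n) : hspan Q x -> exists s : seq nat,
  (forall w, w \in s -> Q w) /\ hspan (fun w => w \in s) x.
Proof.
elim=> [|c f r u hf Qr _ [s [Qs hu]]]; first by exists [::]; split=> //; exact: hspan0.
exists (wsum n r :: s); split=> [w|].
  by rewrite inE => /orP[/eqP->//|/Qs].
apply: hspan_cons hf (mem_head _ _) _; apply: hspan_mono hu => w ws.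
by rewrite inE ws orbT.
Qed.

Lemma hspan_bound n Q (x : hoch A n) : hspan Q x -> exists N, hspan (fun w => (w < N)%N) x.
Proof.
case/hspan_finite=> s [_ hs]; exists (\max_(w <- s) w).+1.
apply: hspan_mono hs => w ws; rewrite ltnS.
by rewrite (big_rem w) //= leq_maxl.
Qed.

Lemma LieD n (u v : hoch A n) : Lie D (u + v) = Lie D u + Lie D v.
Proof. exact: DsumD. Qed.
Lemma LieZ n c (u : hoch A n) : Lie D (c *: u) = c *: Lie D u.
Proof. exact: DsumZ. Qed.
Lemma Lie0 n : Lie D (0 : hoch A n) = 0. Proof. exact: Dsum0. Qed.

Lemma Lie_pt n f r : ofwts r f -> Lie D (pt n f) = (wsum n r)%:R *: pt n f.
Proof.
move=> hf; rewrite /Lie /Dsum /wsum natr_sum scaler_suml; apply: eq_bigr => j _.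
by rewrite atslot_pt hf pt_updZ ?pt_upd_id // -ltnS.
Qed.

Lemma Lie_hspan n p (x : hoch A n) : hspan (eq p) x -> Lie D x = p%:R *: x.
Proof.
elim=> [|c f r y hf -> _ IH]; first by rewrite Lie0 scaler0.
by rewrite LieD LieZ (Lie_pt _ hf) IH scalerDr !scalerA mulrC.
Qed.

Definition Lprod n (s : seq nat) (x : hoch A n) : hoch A n :=
  foldr (fun w y => Lie D y - w%:R *: y) x s.

Lemma LprodP n s c (x y : hoch A n) : Lprod s (c *: x + y) = c *: Lprod s x + Lprod s y.
Proof.
elim: s => //= w s ->; rewrite LieD LieZ !scalerDr opprD addrACA scalerN !scalerA.
by rewrite [w%:R * c]mulrC.
Qed.

Lemma Lprod_eigen n s p (x : hoch A n) : Lie D x = p%:R *: x ->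
  Lprod s x = (\prod_(w <- s) (p%:R - w%:R)) *: x.
Proof.
move=> Lx; elim: s => [|w s IHs] /=; first by rewrite big_nil scale1r.
by rewrite IHs big_cons LieZ Lx !scalerA -scalerBl [in RHS]mulrBl mulrC.
Qed.

(** The product of the operators L_D - w over the finitely many weights w occurring in the second
    expression kills [x], but acts on weight p by the product of the p - w, which is nonzero in
    characteristic zero. *)
Lemma hspan_disjoint n p Q (x : hoch A n) : ~ Q p ->
  hspan (eq p) x -> hspan Q x -> x = 0.
Proof.
move=> Qp xp /hspan_finite[s [Qs hs]].
have s0 : Lprod s x = 0.
  elim: hs => [|c f r y hf rs _ IH].
    by have := LprodP s (-1) 0 (0 : hoch A n); rewrite !scaleN1r !addNr.
  rewrite LprodP IH addr0 (Lprod_eigen _ (Lie_pt _ hf)) (big_rem _ rs) /=.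
  by rewrite subrr mul0r scale0r scaler0.
move: s0; rewrite (Lprod_eigen _ (Lie_hspan xp)) => /eqP; rewrite scaler_eq0.
case/orP=> [|/eqP//]; rewrite prodf_seq_eq0 => /hasP[w /Qs Qw /=]; rewrite subr_eq0 => /eqP pw.
case: Qp; suff -> : p = w by [].
have inj u v : u%:R = (u + v.+1)%:R :> K -> False.
  by rewrite natrD => /eqP; rewrite -subr_eq0 opprD addrA subrr sub0r oppr_eq0 (negPf (charK v)).
case: (ltngtP p w) => // lt.
  by have := @inj p (w - p.+1)%N; rewrite -addSnnS subnKC // => /(_ pw).
by have := @inj w (p - w.+1)%N; rewrite -addSnnS subnKC // => /(_ (esym pw)).
Qed.

Definition mrgwt i r : nat -> nat :=
  fun j => (if (j < i)%N then r j else if j == i then r j + r j.+1 else r j.+1)%N.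

Lemma wsum_mrg n i r : (i <= n)%N ->
  wsum n (mrgwt i r) =
  wsum n.+1 r.
Proof.
move=> iN; rewrite /wsum -(big_mkord xpredT (mrgwt i r)) -(big_mkord xpredT r).
rewrite (@big_cat_nat _ _ _ i 0 n.+1) ?leqW //= (@big_cat_nat _ _ _ i 0 n.+2) ?leqW //=.
congr (_ + _)%N.
  by rewrite big_nat [RHS]big_nat; apply: eq_bigr => j /andP[_]; rewrite /mrgwt => ->.
rewrite big_ltn // [RHS]big_ltn; last by lia.
rewrite {1}/mrgwt ltnn eqxx -addnA; congr (_ + _)%N; rewrite [RHS]big_ltn; last by lia.
congr (_ + _)%N; rewrite [RHS]big_add1 /= big_nat [RHS]big_nat; apply: eq_bigr => j /andP[ij _].
rewrite /mrgwt; have -> : (j < i)%N = false by lia.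
by have -> : (j == i) = false by lia.
Qed.

Lemma ofwts_mrg i r f : ofwts r f ->
  ofwts (mrgwt i r)
    (mrg i f).
Proof.
move=> hf j; rewrite /mrg /mrgwt; case: ltnP => // _; case: eqP => // _.
exact: ofwtM.
Qed.

Lemma face_hspan n Q (i : 'I_n.+1) (x : hoch A n.+1) : hspan Q x -> hspan Q (face i x).
Proof.
apply: hspan_map => [|f r hf Qr]; first exact: linearP.
rewrite face_pt; apply: hspan_pt (ofwts_mrg i hf) _.
by rewrite wsum_mrg // -ltnS.
Qed.

Definition rotwt (n : nat) r : nat -> nat := fun j => if j is j'.+1 then r j' else r n.
Lemma wsum_rot n r : wsum n (rotwt n r) = wsum n r.
Proof. by rewrite /wsum big_ord_recl [RHS]big_ord_recr /= addnC. Qed.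
Lemma ofwts_rot n r f : ofwts r f -> ofwts (rotwt n r) (rotf n f).
Proof. by move=> hf -[|j]; exact: hf. Qed.

Lemma hrot_hspan n Q (x : hoch A n) : hspan Q x -> hspan Q (hrot x).
Proof.
apply: hspan_map => [|f r hf Qr]; first exact: linearP.
by rewrite hrot_pt; apply: hspan_pt (ofwts_rot n hf) _; rewrite wsum_rot.
Qed.

Lemma cons1_hspan n Q (x : hoch A n) : hspan Q x -> hspan Q (cons1 x).
Proof.
apply: hspan_map => [|f r hf Qr]; first exact: linearP.
rewrite cons1_pt; apply: (@hspan_pt _ _ _ (fun j => if j is j'.+1 then r j' else 0%N)).
  by case=> [|j] //; exact: ofwt1.
by rewrite /wsum big_ord_recl.
Qed.

Lemma close_hspan n Q (x : hoch A n.+1) : hspan Q x -> hspan Q (close x).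
Proof. by move=> hx; apply/face_hspan/hrot_hspan. Qed.

Lemma b_hspan n Q (x : hoch A n.+1) : hspan Q x -> hspan Q (hoch_b x).
Proof.
move=> hx; rewrite hoch_bE; apply: hspanD; last exact/hspanZ/close_hspan.
by apply: hspan_sum => i; apply/hspanZ/face_hspan.
Qed.

Lemma t_hspan n Q (x : hoch A n) : hspan Q x -> hspan Q (hoch_t x).
Proof. by move=> hx; apply/hspanZ/hrot_hspan. Qed.

Lemma B_hspan n Q (x : hoch A n) : hspan Q x -> hspan Q (connes_B x).
Proof.
move=> hx; have hy : hspan Q (cons1 (hoch_N x)).
  apply: cons1_hspan; apply: hspan_sum => -[k /= _].
  by elim: k => //= k IHk; exact: t_hspan.
by rewrite connes_BE; apply: hspanB => //; exact: t_hspan.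
Qed.

Lemma cap_hspan n Q (x : hoch A n.+1) : hspan Q x -> hspan Q (cap D x).
Proof.
move=> hx; apply/hspanZ/close_hspan.
have lD : linear (@atslot K A n.+1 D n.+1) by exact: linearP.
apply: (hspan_map lD) hx => f r hf Qr.
rewrite atslot_pt; apply: (@hspan_pt _ _ _ r) => // j.
by rewrite /upd; case: eqP => [->|_]; [exact: ofwtD | exact: hf].
Qed.

(** Only the part of [y] of weight p contributes: the boundary of the rest has weight p and weights
    other than p, so it vanishes. *)
Lemma hspan_boundary n p (x : hoch A n) (y : hoch A n.+1) : hspan (eq p) x ->
  x = hoch_b y -> exists2 y', hspan (eq p) y' & x = hoch_b y'.
Proof.
move=> xp xy; have [|y1 [y2 [yE y1p y2p]]] := @hspan_split _ (eq p) (fun w => p <> w) y.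
  by apply: hspan_mono (hspan_all y) => w _; exact: EM.
exists y1 => //; apply/eqP; rewrite -subr_eq0; apply/eqP.
have E : x - hoch_b y1 = hoch_b y2 by rewrite xy yE hoch_bD addrC addKr.
apply: (@hspan_disjoint _ p (fun w => p <> w)) => //.
  by apply: hspanB => //; exact: b_hspan.
by rewrite E; exact: b_hspan.
Qed.

Definition is_bcycle n : hoch A n -> Prop :=
  match n with 0%N => fun=> True | _.+1 => fun u => hoch_b u = 0 end.

Lemma B_exact0 p (x : hoch A 0) : (0 < p)%N -> hspan (eq p) x ->
  (exists w, connes_B x = hoch_b w) -> exists2 v, hspan (eq p) v & x = hoch_b v.
Proof.
case: p => // p _ xp /(Lie_boundary0 DM)[w]; rewrite (Lie_hspan xp) => E.
apply: (@hspan_boundary _ _ _ (p.+1%:R^-1 *: w)) => //.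
by rewrite hoch_bZ -E scalerA mulVf ?scale1r.
Qed.

(** The Lie derivative is multiplication by p, so Rinehart's formula can be divided by p, with [u] a
    multiple of [cap D x]. The term [v] is then chosen of weight p as well. *)
Lemma B_exactS k p (x : hoch A k.+1) : (0 < p)%N -> hspan (eq p) x -> hoch_b x = 0 ->
    (exists w, connes_B x = hoch_b w) ->
  exists u v, [/\ hspan (eq p) u, hspan (eq p) v, is_bcycle u & x = connes_B u + hoch_b v].
Proof.
case: p => // p _ xp bx Bx.
have {Bx} [bc [w E]] : is_bcycle (cap D x) /\
    exists w, Lie D x = connes_B (cap D x) + hoch_b w.
  case: k x {xp} bx Bx => [|k] x bx Bx; first by split=> //; exact: Lie_boundary1.
  exact: Lie_boundary.
rewrite (Lie_hspan xp) in E; pose c := p.+1%:R^-1 : K.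
have xE : x - connes_B (c *: cap D x) = hoch_b (c *: w).
  have xE : x = c *: (connes_B (cap D x) + hoch_b w) by rewrite -E scalerK.
  by rewrite connes_BZ hoch_bZ {1}xE -scalerBr addrAC subrr add0r.
have cp : hspan (eq p.+1) (c *: cap D x) by apply/hspanZ/cap_hspan.
have bp : hspan (eq p.+1) (x - connes_B (c *: cap D x)).
  by apply: hspanB => //; exact: B_hspan.
have [v vp vE] := hspan_boundary bp xE.
exists (c *: cap D x), v; split=> //; last by rewrite -vE addrC subrK.
by case: k x bc {xp bx E xE cp bp v vp vE w} => //= k x bc; rewrite hoch_bZ bc scaler0.
Qed.

Definition single j (v : hoch A j) : hoch_prod A :=
  fun q => match @eqP _ j q with
           | ReflectT e => eq_rect j (fun i => hoch A i) v q e
           | ReflectF _ => 0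
           end.

Lemma single_eq j (v : hoch A j) : single v j = v.
Proof. by rewrite /single; case: eqP => // e; rewrite (eq_irrelevance e erefl). Qed.

Lemma single_neq j (v : hoch A j) q : j != q -> single v q = 0.
Proof. by rewrite /single; case: eqP. Qed.

Lemma single_bcycle j (v : hoch A j) q : is_bcycle v -> hoch_b (single v q.+1) = 0.
Proof.
move=> bv; have [e|e] := eqVneq j q.+1; last by rewrite single_neq // hoch_b0.
by subst j; rewrite single_eq.
Qed.

Lemma single_hspan j Q (v : hoch A j) q : hspan Q v -> hspan Q (single v q).
Proof. by move=> hv; rewrite /single; case: eqP => [e|_]; [case: q / e | exact: hspan0]. Qed.

Lemma hoch_prodDE (y z : hoch_prod A) q : (y + z) q = y q + z q. Proof. by []. Qed.
Lemma hoch_prodNE (y : hoch_prod A) q : (- y) q = - y q. Proof. by []. Qed.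
Lemma total_d0E (y : hoch_prod A) : total_d y 0%N = hoch_b (y 1%N).
Proof. by rewrite /total_d addr0. Qed.
Lemma total_dSE (y : hoch_prod A) q : total_d y q.+1 = hoch_b (y q.+2) + connes_B (y q).
Proof. by []. Qed.

Lemma total_d_first (z : hoch_prod A) k : (forall q, (q < k.+1)%N -> z q = 0) ->
  total_d z k = hoch_b (z k.+1).
Proof.
case: k => [|k] zk; first exact: total_d0E.
by rewrite total_dSE (zk k) ?connes_B0 ?addr0 // ltnW.
Qed.

Lemma total_d_per n (y : hoch_prod A) : per_chain n.+1 y -> per_chain n (total_d y).
Proof.
move=> py [|q] nq; first by rewrite total_d0E py ?hoch_b0 //= (inj_eq negb_inj).
rewrite total_dSE !py ?hoch_b0 ?connes_B0 ?addr0 //=.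
- by move: nq; rewrite /= eq_sym; case: (odd q); case: (odd n).
- by move: nq; rewrite /= eq_sym; case: (odd q); case: (odd n).
Qed.

Lemma total_d_below n (w : hoch_prod A) q : (q < n)%N ->
  total_d (below n.+1 w) q = total_d w q.
Proof.
case: q => [|q] qn; first by rewrite !total_d0E /below ltnS qn.
by rewrite !total_dSE /below !ltnS qn ltnW // ltnW.
Qed.

Lemma below_total_dd n (y : hoch_prod A) : below n (total_d (below n.+1 (total_d y))) = 0.
Proof.
apply: hoch_prodP => q; rewrite {1}/below; case: ltnP => // qn.
by rewrite total_d_below // total_dd.
Qed.

Variables (d : nat).
Hypothesis b_exact : forall q (z : hoch A q.+1),
  (d <= q)%N -> hoch_b z = 0 -> exists y, z = hoch_b y.

Definition wprod p (z : hoch_prod A) : Prop := forall q, hspan (eq p) (z q).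

Lemma wprod_total_d p (z : hoch_prod A) : wprod p z -> wprod p (total_d z).
Proof.
move=> hz [|q]; first by rewrite total_d0E; exact: b_hspan.
by rewrite total_dSE; apply: hspanD; [exact: b_hspan | exact: B_hspan].
Qed.

Lemma wprod_below p n (z : hoch_prod A) : wprod p z -> wprod p (below n z).
Proof. by move=> hz q; rewrite /below; case: ifP => // _; exact: hspan0. Qed.

(** Induction on the number [m] of degrees from [k] to [n]. The lowest component satisfies b z_k =
    0, and B z_k is a boundary, so z_k = B u + b v with b u = 0; subtracting the differential of u +
    v clears degree k without disturbing lower degrees. *)
Lemma cyc_exact_from n p m k (z : hoch_prod A) : (d <= n)%N -> (0 < p)%N ->
    (k + m = n.+1)%N -> (forall q, (q < k)%N -> z q = 0) ->
    cyc_chain n z -> wprod p z -> below n (total_d z) = 0 ->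
  exists y, [/\ cyc_chain n.+1 y, wprod p y & z = below n.+1 (total_d y)].
Proof.
move=> dn p0; elim: m k z => [|m IHm] k z; rewrite ?addn0 ?addnS => kn zk [pz cz] wz dz.
  exists 0; split=> [||]; first by split.
    by move=> q; exact: hspan0.
  apply: hoch_prodP => q; rewrite linear0 /below.
  have -> : z q = 0 by case: (ltnP q k) => [/zk//|]; rewrite kn; exact: cz.
  by case: ifP.
case: kn => kn; have kn' : (k <= n)%N by rewrite -kn leq_addr.
have km : (k.+1 + m = n.+1)%N by rewrite addSn kn.
have [kpar|kpar] := eqVneq (odd k) (odd n); last first.
  apply: (IHm k.+1) => // q; rewrite ltnS leq_eqVlt => /orP[/eqP->|/zk//].
  exact: pz.
have dz0 q : (q < n)%N -> total_d z q = 0.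
  by move=> qn; have := congr1 (fun y : hoch_prod A => y q) dz; rewrite /below qn.
suff [y [[py cy] wy dy0 dyk]] : exists y, [/\ cyc_chain n.+1 y, wprod p y,
    (forall q, (q < k)%N -> total_d y q = 0) & total_d y k = z k].
  have [||||y' [[py' cy'] wy' E]] := IHm k.+1 (z - below n.+1 (total_d y)) km.
  - move=> q qk; rewrite hoch_prodDE hoch_prodNE /below ltnS (leq_trans _ kn') //.
    move: qk; rewrite ltnS leq_eqVlt => /orP[/eqP->|qk]; first by rewrite dyk subrr.
    by rewrite zk // dy0 // subr0.
  - split=> q qn; rewrite hoch_prodDE hoch_prodNE /below.
      by rewrite pz // (total_d_per py) // if_same subr0.
    by rewrite cz // ltnS leqNgt qn subr0.
  - move=> q; rewrite hoch_prodDE hoch_prodNE; apply: hspanB => //.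
    by apply: wprod_below; apply: wprod_total_d.
  - by rewrite !linearB /= below_total_dd dz subrr.
  exists (y + y'); split.
  - by split=> q qn; rewrite hoch_prodDE; [rewrite py ?py' ?addr0 | rewrite cy ?cy' ?addr0].
  - by move=> q; rewrite hoch_prodDE; exact: hspanD.
  - by rewrite (linearD (@total_d _ A)) (linearD (@below _ A n.+1)) /= -E addrC subrK.
(* Below the top, parity gives k+2 <= n and the cycle condition yields B z_k = -b z_(k+2). At k = n
   the truncated complex imposes nothing, but B z_n is a Hochschild cycle of degree n+1 > d. *)
have Bzk : exists w, connes_B (z k) = hoch_b w.
  move: kn'; rewrite leq_eqVlt => /orP[/eqP E|kn'].
    apply: b_exact; first by rewrite E.
    case: k {kn km} zk kpar E => [|k] zk kpar E; first exact: hoch_bB0.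
    rewrite hoch_bB; suff -> : hoch_b (z k.+1) = 0 by rewrite connes_B0 oppr0.
    by rewrite -total_d_first // dz0 // -E.
  have k1n : (k.+1 < n)%N.
    by rewrite ltn_neqAle kn' andbT; apply/eqP=> E; move: kpar; rewrite -E /=; case: (odd k).
  exists (- z k.+2); rewrite hoch_bN; apply/eqP; rewrite -addr_eq0 addrC -total_dSE.
  by rewrite dz0.
case: k kn kn' zk kpar km Bzk => [|k] kn kn' zk kpar km Bzk.
  have [v vp vE] := B_exact0 p0 (wz 0%N) Bzk.
  exists (single v); split=> [|q|//|]; last by rewrite total_d0E single_eq.
    split=> q qn; rewrite single_neq //.
      by apply: contraNneq qn => <-; rewrite /= -kpar.
    by rewrite neq_ltn (leq_ltn_trans _ qn).
  exact: single_hspan.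
have bz : hoch_b (z k.+1) = 0 by rewrite -total_d_first // dz0.
have [u [v [up vp bu E]]] := B_exactS p0 (wz k.+1) bz Bzk.
exists (single u + single v); split.
- split=> q qn; rewrite hoch_prodDE !single_neq ?addr0 //.
  + by apply: contraNneq qn => <-; rewrite /= -kpar /= negbK.
  + by apply: contraNneq qn => <-; rewrite /= -kpar /= negbK.
  + by apply/eqP; lia.
  + by apply/eqP; lia.
- by move=> q; rewrite hoch_prodDE; apply: hspanD; exact: single_hspan.
- move=> q qk; have vq : single v q.+1 = 0 by apply: single_neq; apply/eqP; lia.
  have -> : total_d (single u + single v) q = hoch_b (single u q.+1).
    case: q qk vq => [|q] qk vq; first by rewrite total_d0E hoch_prodDE vq addr0.
    have uq : single u q = 0 by apply: single_neq; apply/eqP; lia.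
    have vq' : single v q = 0 by apply: single_neq; apply/eqP; lia.
    by rewrite total_dSE !hoch_prodDE vq uq vq' !addr0 connes_B0 addr0.
  exact: single_bcycle.
- have uk : single u k.+2 = 0 by apply: single_neq; apply/eqP; lia.
  have vk : single v k = 0 by apply: single_neq; apply/eqP; lia.
  by rewrite total_dSE !hoch_prodDE !single_eq uk vk add0r addr0 addrC.
Qed.

Lemma cyc_exact n p (z : hoch_prod A) : (d <= n)%N -> (0 < p)%N ->
    cyc_chain n z -> wprod p z -> below n (total_d z) = 0 ->
  exists y, [/\ cyc_chain n.+1 y, wprod p y & z = below n.+1 (total_d y)].
Proof. by move=> dn p0 cz wz dz; apply: (@cyc_exact_from n p n.+1 0%N). Qed.
End Weights.

(** * Filtered deformations *)

Lemma exists_fun (X Y : Type) (P : X -> Y -> Prop) :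
  (forall x, exists y, P x y) -> exists g : X -> Y, forall x, P x (g x).
Proof. by move=> /choice[g gP]; exists g. Qed.

Section FilteredDeformation.
Variables (K : fieldType) (A1 A : algType K) (D : {linear A1 -> A1}).
Hypothesis DM : forall a b, D (a * b) = D a * b + a * D b.
Hypothesis charK : forall n, n.+1%:R != 0 :> K.
Hypothesis ofwt_span : forall a, exists N (c : nat -> A1),
  (forall r, ofwt D r (c r)) /\ a = \sum_(r < N) c r.
Variables (theta : {linear A1 -> A}) (thetai : {linear A -> A1}).
Hypothesis thetaK : cancel theta thetai.
Hypothesis thetaiK : cancel thetai theta.
Hypothesis theta1 : theta 1 = 1.
(* Multiplication in [A] deforms that of [A1] by terms of lower weight. *)
Hypothesis thetaM : forall a b r s, ofwt D r a -> ofwt D s b -> exists c : nat -> A1,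
  (forall t, ofwt D t (c t)) /\
  theta a * theta b = theta (a * b) + theta (\sum_(t < r + s) c t).

Implicit Types (n : nat) (Q : nat -> Prop).
Local Notation tth := (@tmap K A1 A (fun=> theta) _).
Local Notation tthi := (@tmap K A A1 (fun=> thetai) _).

Lemma tthK n (x : hoch A1 n) : tthi (tth x) = x.
Proof.
rewrite (@tmap_comp _ _ _ _ _ _ (fun=> idfun)) ?tmap_id // => i a _; exact: thetaK.
Qed.
Lemma tthiK n (x : hoch A n) : tth (tthi x) = x.
Proof.
rewrite (@tmap_comp _ _ _ _ _ _ (fun=> idfun)) ?tmap_id // => i a _; exact: thetaiK.
Qed.
Lemma tthD n (x y : hoch A1 n) : tth (x + y) = tth x + tth y.
Proof. exact: (linearD (@tmap K A1 A (fun=> theta) n)). Qed.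
Lemma tthZ n c (x : hoch A1 n) : tth (c *: x) = c *: tth x.
Proof. exact: (linearZZ (@tmap K A1 A (fun=> theta) n)). Qed.
Lemma tth0 n : tth (0 : hoch A1 n) = 0. Proof. exact: linear0. Qed.
Lemma tthB n (x y : hoch A1 n) : tth (x - y) = tth x - tth y.
Proof. by rewrite tthD -scaleN1r tthZ scaleN1r. Qed.
Lemma tth_sum n (I : Type) (s : seq I) (F : I -> hoch A1 n) :
  tth (\sum_(i <- s) F i) = \sum_(i <- s) tth (F i).
Proof. exact: (linear_sum (@tmap K A1 A (fun=> theta) n)). Qed.

Lemma tth_hrot n (x : hoch A1 n) : hrot (tth x) = tth (hrot x).
Proof.
move: x; hext => f; rewrite hrot_pt !tmap_pt hrot_pt; apply: eq_pt => -[|j] _ //.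
Qed.
Lemma tth_cons1 n (x : hoch A1 n) : cons1 (tth x) = tth (cons1 x).
Proof.
by move: x; hext => f; rewrite cons1_pt !tmap_pt cons1_pt; apply: eq_pt => -[|j] _ //=.
Qed.
Lemma tth_t n (x : hoch A1 n) : hoch_t (tth x) = tth (hoch_t x).
Proof. by rewrite /hoch_t -!/(hrot _) tthZ tth_hrot. Qed.
Lemma tth_N n (x : hoch A1 n) : hoch_N (tth x) = tth (hoch_N x).
Proof.
rewrite /hoch_N tth_sum; apply: eq_bigr => -[i /= _] _.
by elim: i => //= i ->; rewrite tth_t.
Qed.
(** No entries are multiplied in B and theta fixes 1, so B is transported without error, in contrast
    to b. *)
Lemma tth_B n (x : hoch A1 n) : connes_B (tth x) = tth (connes_B x).
Proof. by rewrite !connes_BE tth_N tth_cons1 tth_t tthB. Qed.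

Definition below_wt Q : nat -> Prop := fun w => exists2 w', Q w' & (w < w')%N.

Lemma wsum_upd n i w (r : nat -> nat) : (i <= n)%N ->
  (wsum n (fun j => if j == i then w else r j) + r i = wsum n r + w)%N.
Proof.
rewrite -ltnS => io; rewrite /wsum (bigD1 (Ordinal io)) //= eqxx [in RHS](bigD1 (Ordinal io)) //=.
rewrite (eq_bigr (fun j : 'I_n.+1 => r j)); first by lia.
by move=> j /negPf ji; rewrite -(inj_eq val_inj) /= in ji; rewrite ji.
Qed.

(** Only the merged slot is affected by the deformation, and there [thetaM] leaves an error of
    smaller weight. *)
Lemma face_tth n Q (i : 'I_n.+1) (x : hoch A1 n.+1) : hspan D Q x ->
  exists2 z, hspan D (below_wt Q) z & face i (tth x) = tth (face i x + z).
Proof.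
elim=> [|c f r y hf Qr _ [z hz E]].
  by exists 0; [exact: hspan0 | rewrite !linear0 addr0 !linear0].
have [g [hg gE]] := thetaM (hf i) (hf i.+1).
pose u := pt n (upd (mrg i f) i (\sum_(t < r i + r i.+1) g t)).
exists (c *: u + z).
  apply: hspanD => //; apply: hspanZ; rewrite /u pt_upd_sum -1?ltnS //.
  apply: hspan_sum => t; apply: hspan_pt (ofwts_upd i (ofwts_mrg DM i hf) (hg t)) _.
  have iN : (i <= n)%N by rewrite -ltnS.
  exists (wsum n.+1 r) => //; rewrite -(@wsum_mrg n i) //.
  have := wsum_upd t (mrgwt i r) iN; have := ltn_ord t.
  have -> : mrgwt i r i = (r i + r i.+1)%N by rewrite /mrgwt ltnn eqxx.
  by lia.
have P : face i (tth (pt n.+1 f)) = tth (face i (pt n.+1 f)) + tth u.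
  rewrite !face_pt !tmap_pt face_pt.
  have iN : (i <= n)%N by rewrite -ltnS.
  transitivity (pt n (upd (fun j => theta (mrg i f j)) i (theta (f i) * theta (f i.+1)))).
    apply: eq_pt => j _; rewrite /upd /mrg.
    by have [ji|ji|->] := ltngtP j i.
  rewrite gE pt_updD //; congr (_ + _); apply: eq_pt => j _; rewrite /upd /mrg //.
    by case: eqP => // ->; rewrite ltnn.
  by case: eqP.
rewrite [tth (c *: pt n.+1 f + y)]tthD tthZ (linearP (@face _ A n i)) /= P E.
rewrite (linearP (@face _ A1 n i)) /= !tthD !tthZ.
by rewrite scalerDr addrACA.
Qed.

Lemma b_tth n Q (x : hoch A1 n.+1) : hspan D Q x ->
  exists2 z, hspan D (below_wt Q) z & hoch_b (tth x) = tth (hoch_b x + z).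
Proof.
move=> hx; have Hf (i : 'I_n.+1) := face_tth i hx.
have [z zP] : exists z : 'I_n.+1 -> hoch A1 n, forall i, hspan D (below_wt Q) (z i) /\
    face i (tth x) = tth (face i x + z i).
  apply: (exists_fun (P := fun i z => hspan D (below_wt Q) z /\
    face i (tth x) = tth (face i x + z))) => i.
  by have [z] := Hf i; exists z.
have [w hw wE] := face_tth ord0 (hrot_hspan hx).
exists (\sum_(i < n.+1) (-1) ^+ i *: z i + (-1) ^+ n.+1 *: w).
  apply: hspanD; last exact: hspanZ.
  by apply: hspan_sum => i; apply: hspanZ; exact: (zP i).1.
rewrite !hoch_bE [Z in _ = tth Z]addrACA -scalerDr -big_split tthD [Z in _ = _ + Z]tthZ tth_sum.
rewrite /close tth_hrot wE.
congr (_ + _); apply: eq_bigr => i _.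
by rewrite (zP i).2 /= -scalerDr [RHS]tthZ.
Qed.

(** With the strict bound, [fil 0] is zero and [fil 1] is the weight 0 part, where the two
    inductions below start. *)
Definition fil n p (y : hoch A n) : Prop :=
  exists2 x, hspan D (fun w => (w < p)%N) x & y = tth x.

Lemma fil0 n p : fil p (0 : hoch A n).
Proof. by exists 0; [exact: hspan0 | rewrite tth0]. Qed.
Lemma filD n p (x y : hoch A n) : fil p x -> fil p y -> fil p (x + y).
Proof. by move=> [u hu ->] [v hv ->]; exists (u + v); [exact: hspanD | rewrite tthD]. Qed.
Lemma filB n p (x y : hoch A n) : fil p x -> fil p y -> fil p (x - y).
Proof. by move=> [u hu ->] [v hv ->]; exists (u - v); [exact: hspanB | rewrite tthB]. Qed.
Lemma fil_tth n p (x : hoch A1 n) : hspan D (fun w => (w < p)%N) x -> fil p (tth x).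
Proof. by exists x. Qed.
Lemma fil_mono n p q (x : hoch A n) : (p <= q)%N -> fil p x -> fil q x.
Proof.
by move=> pq [u hu ->]; exists u => //; apply: hspan_mono hu => w wp; exact: leq_trans pq.
Qed.

Lemma fil_all n (x : hoch A n) : exists p, fil p x.
Proof.
have [p hp] := hspan_bound (hspan_all ofwt_span (tthi x)).
by exists p, (tthi x); rewrite ?tthiK.
Qed.

Lemma fil_b n p (x : hoch A n.+1) : fil p x -> fil p (hoch_b x).
Proof.
move=> [u hu ->]; have [z hz ->] := b_tth hu; apply: fil_tth; apply: hspanD.
  exact: (b_hspan DM hu).
by apply: hspan_mono hz => w [w' w'p ww']; exact: ltn_trans w'p.
Qed.

Lemma fil_B n p (x : hoch A n) : fil p x -> fil p (connes_B x).
Proof. by move=> [u hu ->]; rewrite tth_B; apply: fil_tth; exact: (B_hspan DM hu). Qed.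

Lemma fil_b_tth n p (x : hoch A1 n.+1) : hspan D (eq p) x ->
  fil p (hoch_b (tth x) - tth (hoch_b x)).
Proof.
move=> hx; have [z hz ->] := b_tth hx; rewrite tthD addrC addKr.
by apply: fil_tth; apply: hspan_mono hz => w [w' <-].
Qed.

Lemma fil_lead n p (y : hoch A n) : fil p.+1 y ->
  exists2 x, hspan D (eq p) x & fil p (y - tth x).
Proof.
move=> [u hu ->].
have [|x [z [uE hx hz]]] := @hspan_split _ _ D _ (eq p) (fun w => (w < p)%N) u.
  by apply: hspan_mono hu => w; rewrite ltnS leq_eqVlt => /orP[/eqP->|]; [left | right].
by exists x => //; rewrite uE tthD addrC addKr; exact: fil_tth.
Qed.

Lemma fil_eq0 n p (x : hoch A1 n) : hspan D (eq p) x -> fil p (tth x) -> x = 0.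
Proof.
move=> hx [u hu E]; apply: (hspan_disjoint charK _ hx (Q := fun w => (w < p)%N)).
  by rewrite ltnn.
by rewrite -[x]tthK E tthK.
Qed.

Lemma fil_0 n (x : hoch A n) : fil 0 x -> x = 0.
Proof.
by move=> [u hu ->]; elim: hu => [|c g r v _]; rewrite ?tth0 ?ltn0.
Qed.

Variables (d : nat).
Hypothesis b_exact : forall q (z : hoch A1 q.+1),
  (d <= q)%N -> hoch_b z = 0 -> exists y, z = hoch_b y.

(** Induction on the filtration: the leading part of a cycle is a cycle for A1, hence the boundary
    of some [y] of the same weight, and subtracting the boundary of the lift of [y] lowers the
    filtration. *)
Theorem b_exact_deformed q (z : hoch A q.+1) :
  (d <= q)%N -> hoch_b z = 0 -> exists y, z = hoch_b y.
Proof.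
move=> dq; have [p] := fil_all z; elim: p z => [|p IHp] z zp bz.
  by exists 0; rewrite hoch_b0; exact: fil_0.
have [x hx zx] := fil_lead zp.
have bx : hoch_b x = 0.
  apply: (fil_eq0 (b_hspan DM hx)).
  have -> : tth (hoch_b x) = hoch_b z - hoch_b (z - tth x) - (hoch_b (tth x) - tth (hoch_b x)).
    by rewrite [hoch_b (z - _)]hoch_bBr opprB addrCA subrr addr0 opprB addrC subrK.
  by rewrite bz; apply: filB (filB (fil0 _ _) (fil_b zx)) (fil_b_tth hx).
have [y0 /(hspan_boundary DM charK ofwt_span hx)[y hy xE]] := b_exact dq bx.
have [||w wE] := IHp (z - hoch_b (tth y)).
- have -> : z - hoch_b (tth y) = (z - tth x) - (hoch_b (tth y) - tth (hoch_b y)).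
    by rewrite -xE opprB addrA subrK.
  exact: filB zx (fil_b_tth hy).
- by rewrite hoch_bBr bz hoch_bb subrr.
by exists (tth y + w); rewrite hoch_bD -wE addrC subrK.
Qed.

Variables (A0 : algType K) (f : {lrmorphism A0 -> A}).
Hypothesis f_weight0 : forall c, exists2 a, ofwt D 0 a & f c = theta a.
Hypothesis weight0_f : forall a, ofwt D 0 a -> exists c, theta a = f c.

Definition from n (y : hoch A n) : Prop := exists c, y = hoch_map f n c.

Lemma from0 n : from (0 : hoch A n). Proof. by exists 0; rewrite linear0. Qed.
Lemma fromD n (x y : hoch A n) : from x -> from y -> from (x + y).
Proof. by move=> [u ->] [v ->]; exists (u + v); rewrite linearD. Qed.

(** Weights are natural numbers, so total weight 0 forces every factor to have weight 0. *)
Lemma fil1_from n (y : hoch A n) : fil 1 y -> from y.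
Proof.
move=> [x hx ->]; elim: hx => [|c g r u hg r0 _ IH]; first by rewrite tth0; exact: from0.
rewrite tthD tthZ; apply: fromD => //.
have hg0 i : (i <= n)%N -> ofwt D 0 (g i).
  rewrite -ltnS => io; suff <- : r i = 0%N by exact: hg.
  apply/eqP; rewrite -leqn0; move: r0; rewrite ltnS leqn0 /wsum sum_nat_eq0.
  by move=> /forallP/(_ (Ordinal io))/eqP ->.
have [e eP] : exists e : nat -> A0, forall i, (i <= n)%N -> theta (g i) = f (e i).
  apply: (exists_fun (P := fun i a => (i <= n)%N -> theta (g i) = f a)) => i.
  by case: (leqP i n) => [/hg0/weight0_f[a aE]|_]; [exists a | exists 0].
exists (c *: pt n e); rewrite linearZZ; congr (_ *: _).
by rewrite hoch_map_pt tmap_pt; apply: eq_pt => i /eP.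
Qed.

Lemma from_fil1 n (y : hoch A n) : from y -> fil 1 y.
Proof.
move=> [c ->]; elim/hoch_ind: c => [|a u v [x hx hxE] [y' hy hyE]|g].
- by rewrite linear0; exact: fil0.
- rewrite linearP hxE hyE -tthZ -tthD; apply: fil_tth.
  by apply: hspanD => //; exact: hspanZ.
have [e eP] : exists e : nat -> A1, forall i, ofwt D 0 (e i) /\ f (g i) = theta (e i).
  apply: (exists_fun (P := fun i a => ofwt D 0 a /\ f (g i) = theta a)) => i.
  by have [a ? ?] := f_weight0 (g i); exists a.
rewrite hoch_map_pt; have -> : pt n (fun i => f (g i)) = tth (pt n e).
  by rewrite tmap_pt; apply: eq_pt => i _; exact: (eP i).2.
apply: fil_tth; apply: (@hspan_pt _ _ _ _ _ _ (fun=> 0%N)); first by move=> i; exact: (eP i).1.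
by rewrite /wsum big1.
Qed.

(** For cycles relative to the subcomplex, by induction on the filtration: the defect [total_d z]
    has weight 0, so the part of weight p+1 is an honest cyclic cycle for A1, and [cyc_exact]
    removes it. *)
Lemma cyc_exact_fil n p (z : hoch_prod A) : (d <= n)%N -> cyc_chain n z ->
    (forall q, fil p.+1 (z q)) -> (forall q, (q < n)%N -> from (total_d z q)) ->
  exists2 y, cyc_chain n.+1 y & forall q, (q <= n)%N -> from (z q - total_d y q).
Proof.
move=> dn; elim: p z => [|p IHp] z [pz cz] zp dz.
  exists 0; first by split.
  by move=> q _; rewrite linear0 subr0; exact: fil1_from.
(* The leading part is chosen to be 0 wherever [z] is, so that it inherits the parity and truncation
   conditions. *)
have [x xP] : exists x : hoch_prod A1, forall q,
    [/\ hspan D (eq p.+1) (x q), fil p.+1 (z q - tth (x q)) & z q = 0 -> x q = 0].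
  have H q : exists u : hoch A1 q,
      [/\ hspan D (eq p.+1) u, fil p.+1 (z q - tth u) & z q = 0 -> u = 0].
    have [z0|z0] := EM (z q = 0).
      by exists 0; split=> //; [exact: hspan0 | rewrite z0 tth0 subr0; exact: fil0].
    by have [u hu zu] := fil_lead (zp q); exists u.
  exists (fun q => projT1 (cid (H q))) => q; exact: projT2 (cid (H q)).
have xw : wprod D p.+1 x by move=> q; have [] := xP q.
have cx : cyc_chain n x.
  by split=> q qn; have [_ _ x0] := xP q; apply: x0; [exact: pz | exact: cz].
have dzx q : fil p.+1 (total_d z q - tth (total_d x q)).
  have b1 m : fil p.+1 (hoch_b (z m.+1) - tth (hoch_b (x m.+1))).
    have [h1 h2 _] := xP m.+1.
    rewrite -[_ - _](subrKA (hoch_b (tth (x m.+1)))) -hoch_bBr.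
    by apply: filD; [exact: fil_b | exact: fil_b_tth].
  case: q => [|q]; first by rewrite !total_d0E.
  rewrite !total_dSE tthD opprD addrACA; apply: filD => //.
  rewrite -tth_B -connes_BBr; apply: fil_B; by have [] := xP q.
have dx : below n (total_d x) = 0.
  apply: hoch_prodP => q; rewrite /below; case: ltnP => // qn.
  apply: (fil_eq0 (wprod_total_d DM xw q)).
  rewrite -[tth _](subKr (total_d z q)); apply: filB => //.
  by apply: fil_mono (from_fil1 (dz q qn)).
have [y [[py cy] yw xE]] := cyc_exact DM charK ofwt_span b_exact dn (ltn0Sn p) cx xw dx.
pose ty : hoch_prod A := fun q => tth (y q).
have pty : per_chain n.+1 ty by move=> q qn; rewrite /ty py // tth0.
have dty q : fil p.+1 (total_d ty q - tth (total_d y q)).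
  case: q => [|q]; first by rewrite !total_d0E; apply: fil_b_tth; exact: yw.
  rewrite !total_dSE tthD opprD addrACA -tth_B [Z in _ + Z]subrr addr0.
  by apply: fil_b_tth; exact: yw.
pose z' := z - below n.+1 (total_d ty).
have z'E q : (q <= n)%N -> z' q = z q - total_d ty q.
  by move=> qn; rewrite /z' hoch_prodDE hoch_prodNE /below ltnS qn.
have z'0 q : (n < q)%N -> z' q = 0.
  by move=> qn; rewrite /z' hoch_prodDE hoch_prodNE /below ltnS leqNgt qn cz // subr0.
have [||q|y' [py' cy'] y'P] := IHp z'.
- split=> // q qn; rewrite /z' hoch_prodDE hoch_prodNE /below pz // (total_d_per pty) //.
  by rewrite if_same subr0.
- move=> q; case: (leqP q n) => qn; last by rewrite z'0 //; exact: fil0.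
  rewrite z'E //; have [_ h _] := xP q.
  have xq : x q = total_d y q by rewrite xE /below ltnS qn.
  rewrite -[_ - _](subrKA (tth (x q))); apply: filD => //.
  by rewrite xq -opprB -[X in fil _ X]sub0r; apply: filB => //; exact: fil0.
- move=> qn; rewrite /z' (linearB (@total_d _ A)) /= hoch_prodDE hoch_prodNE.
  by rewrite total_d_below // total_dd subr0; exact: dz.
exists (ty + y').
  split=> q qn; rewrite hoch_prodDE; first by rewrite pty // py' // addr0.
  by rewrite /ty cy // tth0 cy' // addr0.
move=> q qn; have := y'P q qn; rewrite z'E // (linearD (@total_d _ A)) /= hoch_prodDE.
by rewrite -[_ - _ - _]addrA -opprD.
Qed.

Theorem cyc_exact_deformed n (z : hoch_prod A) : (d <= n)%N -> cyc_chain n z ->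
    (forall q, (q < n)%N -> from (total_d z q)) ->
  exists2 y, cyc_chain n.+1 y & forall q, (q <= n)%N -> from (z q - total_d y q).
Proof.
(* A cyclic chain has finitely many nonzero components, so a single filtration bound serves them
   all. *)
move=> dn cz dz; have [P PP] : exists P, forall q, (q <= n)%N -> fil P (z q).
  elim: n {dn cz dz} => [|m [P PP]].
    by have [P hP] := fil_all (z 0%N); exists P => -[].
  have [P' hP'] := fil_all (z m.+1); exists (P + P')%N => q.
  rewrite leq_eqVlt => /orP[/eqP->|qm]; first by apply: fil_mono hP'; exact: leq_addl.
  by apply: fil_mono (PP q qm); exact: leq_addr.
apply: (@cyc_exact_fil n P) => // q; case: (leqP q n) => [/PP|qn].
  by apply: fil_mono.
by rewrite cz.2 //; exact: fil0.
Qed.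
End FilteredDeformation.

(** * Periodic and cyclic homology *)

Section SubcomplexCorrection.
Variables (K : fieldType) (A : algType K) (iota : forall q, hoch A q -> Prop) (m : nat).
Variables (n N : nat) (z : hoch_prod A).
Hypothesis iota0 : forall q, iota (0 : hoch A q).
Hypothesis iotaD : forall q (x y : hoch A q), iota x -> iota y -> iota (x + y).
Hypothesis iotaN : forall q (x : hoch A q), iota x -> iota (- x).
Hypothesis iota_B : forall q (x : hoch A q), iota x -> iota (connes_B x).
Hypothesis iota_exact : forall q (z : hoch A q.+1),
  (m <= q)%N -> iota (hoch_b z) -> exists v, iota (z - hoch_b v).

(** Requiring the correction to vanish when nothing needs correcting is what later makes [w] zero in
    low degrees and in degrees of the wrong parity. *)
Lemma correction_step : exists g : forall q, hoch A q -> hoch A q.+2,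
  forall q (x : hoch A q), let u := z q.+1 - connes_B x in
    (iota u -> g q x = 0) /\ ((m <= q)%N -> iota (hoch_b u) -> iota (u - hoch_b (g q x))).
Proof.
have H q (x : hoch A q) : exists v, let u := z q.+1 - connes_B x in
    (iota u -> v = 0) /\ ((m <= q)%N -> iota (hoch_b u) -> iota (u - hoch_b v)).
  set u := z q.+1 - connes_B x.
  have [iu|iu] := EM (iota u); first by exists 0; split=> //; rewrite hoch_b0 subr0.
  have [[mq ib]|nb] := EM ((m <= q)%N /\ iota (hoch_b u)).
    by have [v hv] := iota_exact mq ib; exists v.
  by exists 0; split=> [//|mq ib]; case: nb.
by exists (fun q x => projT1 (cid (H q x))) => q x; exact: projT2 (cid (H q x)).
Qed.

(* [w (q + 2)] is chosen from [w q]; the resulting [w] is an infinite sequence, which is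
   why products, and not sums, of chains are needed. *)
Lemma correct_upward : (m <= N)%N -> per_chain n z ->
    (forall q, (q <= N)%N -> iota (z q)) -> (forall q, iota (total_d z q)) ->
  exists w, [/\ per_chain n.+1 w, forall q, (q <= N.+1)%N -> w q = 0 &
    forall q, iota (z q - total_d w q)].
Proof.
move=> mN pz zN dz; have [g gP] := correction_step.
pose w : hoch_prod A := fix w q := match q with
  | q1.+1 => match q1 return hoch A q1.+1 with q2.+1 => g q2 (w q2) | 0 => 0 end
  | 0 => 0 end.
have wS q : w q.+2 = g q (w q) by [].
have w0 q : (q <= N.+1)%N -> w q = 0.
  elim/ltn_ind: q => -[|[|q]] IH // qN; rewrite wS; apply: (gP q (w q)).1.
  have -> : w q = 0 by apply: IH; lia.
  by rewrite connes_B0 subr0; apply: zN; lia.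
have pw : per_chain n.+1 w.
  elim/ltn_ind => -[|[|q]] IH // oq; rewrite wS; apply: (gP q (w q)).1.
  have -> : w q = 0 by apply: IH => //; move: oq; rewrite /= negbK.
  by rewrite connes_B0 subr0 pz //; move: oq => /=; case: (odd q); case: (odd n).
have wP q : iota (z q.+1 - connes_B (w q) - hoch_b (w q.+2)).
  elim/ltn_ind: q => q IH; have [qN|Nq] := ltnP q N.
    by rewrite !w0 ?connes_B0 ?hoch_b0 ?subr0; [exact: zN | lia..].
  rewrite wS; apply: (gP q (w q)).2; first exact: leq_trans Nq.
  rewrite hoch_bBr; case: q IH Nq => [|q] IH Nq.
    by rewrite [w 0%N]/(0 : hoch A 0) connes_B0 hoch_b0 subr0 -total_d0E.
  rewrite hoch_bB opprK; have := dz q.+1; rewrite total_dSE => dzq.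
  (* The boundary to control is b z_(q+2) + B b w_(q+1). Replacing B b w_(q+1) by B z_q minus B of
     the previous defect leaves [total_d z], which is in the subcomplex, and a term handled by
     induction, where BB = 0 removes the part of the defect coming from B. *)
  have E : connes_B (hoch_b (w q.+1)) = connes_B (z q) -
      connes_B (z q - hoch_b (w q.+1)) by rewrite connes_BBr subKr.
  rewrite E addrA; apply: iotaD => //; apply: iotaN; case: q IH Nq {dzq E} => [|q] IH Nq.
    by rewrite [w 1%N]/(0 : hoch A 1) hoch_b0 subr0; apply: iota_B; exact: zN.
  have IHq := iota_B (IH q (leqnSn _)).
  by rewrite addrAC [X in iota X]connes_BBr connes_BB subr0 in IHq.
exists w; split=> // -[|q]; rewrite ?total_d0E ?total_dSE.
  by rewrite [w 1%N]/(0 : hoch A 1) hoch_b0 subr0; exact: zN.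
by rewrite opprD addrA addrAC; exact: wP.
Qed.
End SubcomplexCorrection.

(** * Isomorphisms of vector spaces and of subquotients *)

Section LinearIso.
Variable K : fieldType.

Lemma linear_inverse (U V : lmodType K) (f : {linear U -> V}) :
  bijective f -> exists2 g : {linear V -> U}, cancel f g & cancel g f.
Proof.
move=> [g fK gK].
have gL : linear g by move=> c x y; apply: (can_inj fK); rewrite linearP !gK.
pose gl := GRing.isLinear.Build K V U *:%R g gL.
pose G : {linear V -> U} := HB.pack g gl.
by exists G.
Qed.

Lemma lmod_iso_sym (U V : lmodType K) : lmod_iso U V -> lmod_iso V U.
Proof. by move=> [f /linear_inverse[g fK gK]]; exists g; exists f. Qed.

Lemma lmod_iso_trans (U V T : lmodType K) : lmod_iso U V -> lmod_iso V T -> lmod_iso U T.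
Proof.
by move=> [f fb] [g gb]; exists (g \o f : {linear U -> T}); exact: bij_comp.
Qed.

Lemma surj_inj_bij (U V : lmodType K) (f : {linear U -> V}) :
  (forall x, f x = 0 -> x = 0) -> (forall y, exists x, f x = y) -> bijective f.
Proof.
move=> f0 fs; have [g gK] := exists_fun fs; exists g => // x.
by apply/eqP; rewrite -subr_eq0; apply/eqP/f0; rewrite linearB gK subrr.
Qed.

Variables (V V' : lmodType K) (Z B : submodClosed V) (Z' B' : submodClosed V').
Variables (f : {linear V -> V'}).
Hypothesis fZ : forall x, x \in Z -> f x \in Z'.
Hypothesis fB : forall x, x \in B -> f x \in B'.

Lemma subquot_map_bij : (forall x, x \in Z -> f x \in B' -> x \in B) ->
    (forall y, y \in Z' -> exists2 x, x \in Z & y - f x \in B') ->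
  bijective (subquot_map fZ fB).
Proof.
move=> finj fsurj; apply: surj_inj_bij => [x|y].
  elim/quotW: x => z; rewrite -/(quot_pi _ z).
  have -> : subquot_map fZ fB (quot_pi _ z) = quot_pi _ (subspace_map fZ z).
    exact: quot_liftE.
  move=> E; rewrite -(linear0 (@quot_pi _ _ (restrict_to B))); apply/quot_eqP.
  rewrite subr0 unfold_in; apply: finj; first exact: valP.
  move: E; rewrite -(linear0 (@quot_pi _ _ (restrict_to B'))) => /quot_eqP.
  by rewrite subr0.
elim/quotW: y => z; have [x xZ xE] := fsurj _ (valP z).
exists (quot_pi _ (Subspace xZ)); rewrite /subquot_map.
apply: etrans (quot_liftE _ _) _ => /=; apply/esym/quot_eqP; exact: xE.
Qed.
End LinearIso.

Lemma per_chain_odd (K : fieldType) (A : algType K) n n' (z : hoch_prod A) :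
  odd n = odd n' -> per_chain n z -> per_chain n' z.
Proof. by move=> nn' pz q; rewrite -nn'; exact: pz. Qed.

Lemma below_eq (K : fieldType) (A : algType K) m q (x y : hoch_prod A) :
  below m x = below m y -> (q < m)%N -> x q = y q.
Proof. by move=> E qm; have := congr1 (fun u : hoch_prod A => u q) E; rewrite /below qm. Qed.

(** * HP and HC agree above the degrees where HH lives *)

Section Stabilization.
Variables (K : fieldType) (A : algType K) (d : nat).
Hypothesis b_exact : forall q (z : hoch A q.+1),
  (d <= q)%N -> hoch_b z = 0 -> exists y, z = hoch_b y.

(** Upward correction with respect to the zero subcomplex. *)
Lemma truncated_boundary n N (z : hoch_prod A) : (d <= N)%N -> per_chain n z ->
    (forall q, (q <= N)%N -> z q = 0) -> total_d z = 0 ->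
  exists w, [/\ per_chain n.+1 w, forall q, (q <= N.+1)%N -> w q = 0 & z = total_d w].
Proof.
move=> dN pz zN dz.
have [|||||||||w [pw wN wE]] := @correct_upward _ A (fun q x => x = 0) d n N z.
- by [].
- by move=> q x y -> ->; rewrite addr0.
- by move=> q x ->; rewrite oppr0.
- by move=> q x ->; rewrite connes_B0.
- by move=> q u dq /(b_exact dq)[v ->]; exists v; rewrite subrr.
- exact: dN.
- exact: pz.
- exact: zN.
- by move=> q; rewrite dz.
by exists w; split=> //; apply: hoch_prodP => q; apply/eqP; rewrite -subr_eq0 wE.
Qed.

Lemma below_cycle n x : x \in @HP_cycle _ A n -> below n.+1 x \in @HC_cycle _ A n.
Proof.
move=> /asboolP[px dx]; apply/asboolP; split.
  split=> q; rewrite /below; first by move=> /px ->; rewrite if_same.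
  by move=> nq; rewrite ltnS leqNgt nq.
by apply: hoch_prodP => q; rewrite /below; case: ltnP => // qn; rewrite total_d_below // dx.
Qed.

Lemma below_per n m (y : hoch_prod A) : per_chain n y -> per_chain n (below m y).
Proof. by move=> py q /py yq; rewrite /below yq if_same. Qed.

Lemma below_boundary n x : x \in @HP_boundary _ A n -> below n.+1 x \in @HC_boundary _ A n.
Proof.
move=> /asboolP[y py ->]; apply/asboolP; exists (below n.+2 y).
  split=> [|q nq]; first exact: below_per.
  by rewrite /below ltnS leqNgt nq.
by apply: hoch_prodP => q; rewrite /below; case: ltnP => // qn; rewrite total_d_below.
Qed.

(** The map is truncation. Injectivity: once the truncated boundary is subtracted, the cycle
    vanishes up to degree n and is a boundary. Surjectivity: the full differential of a cyclic cycle
    vanishes up to degree n, so it equals [total_d w] with [w] zero up to degree n+1, and z - w is a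
    periodic cycle with truncation [z]. *)
Lemma HP_iso_HC n : (d < n)%N -> lmod_iso (HP n A) (HC n A).
Proof.
move=> dn; exists (subquot_map (@below_cycle n) (@below_boundary n)).
apply: subquot_map_bij => [z /asboolP[pz dz] /asboolP[y [py cy] zE]|z /asboolP[[pz cz] dz]].
  have [||||w [pw _ wE]] := @truncated_boundary n n (z - total_d y).
  - exact: ltnW.
  - rewrite -scaleN1r addrC; apply: per_chainP => //; exact: total_d_per.
  - by move=> q qn; rewrite hoch_prodDE hoch_prodNE (below_eq zE) ?ltnS // subrr.
  - by rewrite (linearB (@total_d _ A)) /= dz total_dd subr0.
  apply/asboolP; exists (y + w); last by rewrite (linearD (@total_d _ A)) /= -wE addrC subrK.
  by rewrite -[y]scale1r; apply: per_chainP.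
have pdz : per_chain n.+1 (total_d z).
  by apply: total_d_per; refine (per_chain_odd _ pz); rewrite /= negbK.
have [||||w [pw w0 wE]] := @truncated_boundary n.+1 n (total_d z).
- exact: ltnW.
- exact: pdz.
- move=> q; rewrite leq_eqVlt => /orP[/eqP->|qn]; first by apply: pdz; rewrite /=; case: odd.
  by apply: (@below_eq _ _ n q _ 0) => //; rewrite dz linear0.
- exact: total_dd.
exists (z - w).
  apply/asboolP; split; last by rewrite (linearB (@total_d _ A)) /= wE subrr.
  rewrite -scaleN1r addrC; apply: per_chainP => //.
  by refine (per_chain_odd _ pw); rewrite /= negbK.
suff -> : z - below n.+1 (z - w) = 0 by exact: rpred0.
apply: hoch_prodP => q; rewrite hoch_prodDE hoch_prodNE /below.
case: ltnP => qn; last by rewrite cz // subr0.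
by rewrite hoch_prodDE hoch_prodNE w0 1?ltnW // subr0 subrr.
Qed.
End Stabilization.

(** * The inclusion of the weight 0 subalgebra on periodic cyclic homology *)

Section Comparison.
Variables (K : fieldType) (A A0 : algType K) (f : {lrmorphism A0 -> A}) (d : nat).
Variable ret : {linear A -> A0}.
Hypothesis retK : cancel f ret.
Hypothesis b_exact : forall q (z : hoch A q.+1),
  (d <= q)%N -> hoch_b z = 0 -> exists y, z = hoch_b y.
Hypothesis b_exact0 : forall q (z : hoch A0 q.+1),
  (d <= q)%N -> hoch_b z = 0 -> exists y, z = hoch_b y.
Hypothesis cyc_exact_from : forall n (z : hoch_prod A), (d <= n)%N -> cyc_chain n z ->
    (forall q, (q < n)%N -> from f (total_d z q)) ->
  exists2 y, cyc_chain n.+1 y & forall q, (q <= n)%N -> from f (z q - total_d y q).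

Lemma hoch_map_inj n (c : hoch A0 n) : hoch_map f n c = 0 -> c = 0.
Proof.
have H : tmap (fun=> ret) (hoch_map f n c) = c.
  move: c; hext => g; rewrite hoch_map_pt tmap_pt; apply: eq_pt => i _; exact: retK.
by move=> E; rewrite -H E; exact: linear0.
Qed.

Lemma prod_map_inj (c : hoch_prod A0) : prod_map f c = 0 -> c = 0.
Proof.
move=> E; apply: hoch_prodP => q; apply: hoch_map_inj.
exact: (congr1 (fun u : hoch_prod A => u q) E).
Qed.

Lemma prod_map_per_inv n (c : hoch_prod A0) : per_chain n (prod_map f c) -> per_chain n c.
Proof. by move=> pc q /pc E; exact: hoch_map_inj. Qed.

Lemma fromN n (x : hoch A n) : from f x -> from f (- x).
Proof. by move=> [c ->]; exists (- c); rewrite linearN. Qed.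

Lemma from_B n (x : hoch A n) : from f x -> from f (connes_B x).
Proof. by move=> [c ->]; exists (connes_B c); rewrite hoch_map_B. Qed.

(** Exactness of the quotient complex by the long exact sequence argument. It uses exactness for A0
    one degree lower, hence the strict bound here and the [d.+1] below. *)
Lemma from_exact q (z : hoch A q.+1) :
  (d < q)%N -> from f (hoch_b z) -> exists v, from f (z - hoch_b v).
Proof.
case: q z => // q z; rewrite ltnS => dq [c cE].
have bc : hoch_b c = 0 by apply: hoch_map_inj; rewrite hoch_map_b -cE hoch_bb.
have [c' c'E] := b_exact0 dq bc.
have [|v vE] := @b_exact q.+1 (z - hoch_map f _ c') (leqW dq).
  by rewrite hoch_bBr cE c'E hoch_map_b subrr.
by exists v; rewrite -vE subKr; exists c'.
Qed.

(** Acyclicity of the periodic complex modulo that of A0: the filtration argument handles the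
    degrees up to N, and upward correction handles those above. *)
Lemma relative_boundary n (z : hoch_prod A) : per_chain n z ->
    (forall q, from f (total_d z q)) ->
  exists y c, [/\ per_chain n.+1 y, per_chain n c & z = total_d y + prod_map f c].
Proof.
(* Periodic chains depend on [n] only through its parity; N has the same parity and lies beyond the
   bounds of both arguments, so no condition on [n] is needed. *)
move=> pz dz; pose N := (n + d.+1.*2)%N.
have oN : odd n = odd N by rewrite /N oddD odd_double addbF.
have [||q qN|y [py cy] yP] := @cyc_exact_from N (below N.+1 z).
- by rewrite /N; lia.
- split=> q; first by rewrite -oN => /pz zq; rewrite /below zq if_same.
  by move=> Nq; rewrite /below ltnS leqNgt Nq.
- by rewrite total_d_below.
have py' : per_chain n.+1 y by refine (per_chain_odd _ py); rewrite /= oN.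
pose z1 := z - total_d y.
have z1E q : z1 q = z q - total_d y q by rewrite /z1 hoch_prodDE hoch_prodNE.
have pz1 : per_chain n z1.
  by rewrite /z1 -scaleN1r addrC; apply: per_chainP => //; exact: total_d_per.
have [|||||||||w [pw _ wP]] := @correct_upward _ A (@from _ _ _ f) d.+1 n N z1.
- by move=> q; exact: from0.
- by move=> q x x'; exact: fromD.
- by move=> q x; exact: fromN.
- by move=> q x; exact: from_B.
- by move=> q u; exact: from_exact.
- by rewrite /N; lia.
- exact: pz1.
- by move=> q qN; rewrite z1E; have := yP q qN; rewrite /below ltnS qN.
- by move=> q; rewrite /z1 (linearB (@total_d _ A)) /= total_dd subr0.
pose c : hoch_prod A0 := fun q => projT1 (cid (wP q)).
have cE : z1 - total_d w = prod_map f c.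
  by apply: hoch_prodP => q; rewrite hoch_prodDE hoch_prodNE; exact: projT2 (cid (wP q)).
exists (y + w), c; split.
- by rewrite -[y]scale1r; apply: per_chainP.
- apply: prod_map_per_inv; rewrite -cE -scaleN1r addrC; apply: per_chainP => //.
  exact: total_d_per.
- have S (a b e : hoch_prod A) : a = b + e + (a - b - e).
    by rewrite -[a - b - e]addrA -opprD [RHS]addrC subrK.
  by rewrite -cE (linearD (@total_d _ A)) /=; exact: S.
Qed.

Lemma HP_map_bij n : bijective (HP_map f n).
Proof.
apply: subquot_map_bij => [c /asboolP[pc dc] /asboolP[z pz zE]|z /asboolP[pz dz]].
  have [|y [c' [py pc' zE']]] := relative_boundary pz.
    by move=> q; rewrite -zE; exists (c q).
  apply/asboolP; exists c' => //; apply/eqP; rewrite -subr_eq0; apply/eqP.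
  apply: prod_map_inj; rewrite linearB /= prod_map_d zE zE'.
  by rewrite (linearD (@total_d _ A)) /= total_dd add0r subrr.
have [|y [c [py pc zE]]] := relative_boundary pz.
  by move=> q; rewrite dz; exact: from0.
exists c.
  apply/asboolP; split=> //; apply: prod_map_inj; rewrite prod_map_d.
  have : total_d z = total_d (prod_map f c).
    by rewrite zE (linearD (@total_d _ A)) /= total_dd add0r.
  by rewrite dz.
by apply/asboolP; exists y => //; rewrite zE addrK.
Qed.

Theorem HP_HC_comparison :
  (forall n, (d < n)%N ->
     lmod_iso (HP n A) (HC n A) /\ lmod_iso (HC n A) (HC n A0)) /\
  (forall n, bijective (HP_map f n)).
Proof.
split=> n; last exact: HP_map_bij.
move=> dn; have i1 := HP_iso_HC b_exact dn; split=> //.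
(* HC for A and for A0 are compared by passing through HP on both sides. *)
apply: lmod_iso_trans (lmod_iso_sym i1) _.
apply: lmod_iso_trans (HP_iso_HC b_exact0 dn).
apply: lmod_iso_sym; exists (HP_map f n); exact: HP_map_bij.
Qed.
End Comparison.

(** * Polynomial crossed products and their PBW deformations *)

Section PolynomialOperators.
Variables (K : fieldType) (d : nat).
Local Notation S := {mpoly K[d]}.

Lemma mpoly_lin_ind (P : S -> Prop) :
  (forall c p q, P p -> P q -> P (c *: p + q)) -> (forall m, P 'X_[m]) -> forall p, P p.
Proof.
move=> PL PX p; have P0 : P 0.
  by have := PL (-1) _ _ (PX 0%MM) (PX 0%MM); rewrite scaleN1r addNr.
by rewrite (mpolyE p); elim/big_rec: _ => // m q _ Pq; exact: PL.
Qed.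

Lemma mpoly_gen_ind (P : S -> Prop) :
  (forall c p q, P p -> P q -> P (c *: p + q)) -> (forall p q, P p -> P q -> P (p * q)) ->
  P 1 -> (forall j, P 'X_j) -> forall p, P p.
Proof.
move=> PL PM P1 PX; apply: mpoly_lin_ind => // m; rewrite mpolyXE_id.
elim/big_rec: _ => // j q _ Pq; apply: (PM) => //.
by elim: (m j) => [|k IH]; rewrite ?expr0 // exprS; exact: PM.
Qed.

Section Lift.
Variables (U : lmodType K) (F : 'X_{1..d} -> U).

Definition mpoly_lift_fun (p : S) : U := free_lift F (mpoly_val p).
Lemma mpoly_lift_linear : linear mpoly_lift_fun.
Proof. by move=> c p q; rewrite /mpoly_lift_fun -linearP. Qed.
HB.instance Definition _ := GRing.isLinear.Build K S U *:%R mpoly_lift_fun mpoly_lift_linear.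
Definition mpoly_lift : {linear S -> U} := mpoly_lift_fun.

Lemma mpoly_liftE m : mpoly_lift 'X_[m] = F m.
Proof. by rewrite /mpoly_lift /= /mpoly_lift_fun unlock /mpolyX_def free_liftE. Qed.
End Lift.

(** The Euler derivation, the sum of the x_j d/dx_j, given by its eigenvalues on monomials. *)
Definition euler : {linear S -> S} := mpoly_lift (fun m => (mdeg m)%:R *: 'X_[m]).
Definition homog_part r : {linear S -> S} :=
  mpoly_lift (fun m => if mdeg m == r then 'X_[m] else 0).
Definition divX (j : 'I_d) : {linear S -> S} :=
  mpoly_lift (fun m => if m j == 0%N then 0 else 'X_[m - U_(j)]).

Lemma eulerX m : euler 'X_[m] = (mdeg m)%:R *: 'X_[m]. Proof. exact: mpoly_liftE. Qed.

Lemma eulerM p q : euler (p * q) = euler p * q + p * euler q.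
Proof.
elim/mpoly_lin_ind: p => [c p p' Ep Ep'|m].
  by rewrite mulrDl -scalerAl !linearP /= Ep Ep' !mulrDl -!scalerAl scalerDr addrACA.
elim/mpoly_lin_ind: q => [c q q' Eq Eq'|m'].
  by rewrite mulrDr -scalerAr !linearP /= Eq Eq' !mulrDr -!scalerAr scalerDr addrACA.
by rewrite -mpolyXD !eulerX mdegD natrD scalerDl mpolyXD -scalerAl -scalerAr.
Qed.

Lemma homog_partX r m : homog_part r 'X_[m] = if mdeg m == r then 'X_[m] else 0.
Proof. exact: mpoly_liftE. Qed.

Lemma euler_homog_part r p : euler (homog_part r p) = r%:R *: homog_part r p.
Proof.
elim/mpoly_lin_ind: p => [c p p' Ep Ep'|m].
  by rewrite linearP /= [LHS]linearP /= Ep Ep' scalerDr !scalerA mulrC.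
by rewrite homog_partX; case: eqP => [<-|_]; rewrite ?eulerX ?linear0 ?scaler0.
Qed.

Lemma homog_part_sum p : exists N, forall N', (N <= N')%N ->
  p = \sum_(r < N') homog_part r p.
Proof.
elim/mpoly_lin_ind: p => [c p p' [N pE] [N' pE']|m].
  exists (maxn N N') => N2; rewrite geq_max => /andP[/pE {1}-> /pE' {1}->].
  by rewrite scaler_sumr -big_split; apply: eq_bigr => r _; rewrite linearP.
exists (mdeg m).+1 => N' mN; rewrite (bigD1 (Ordinal mN)) //= homog_partX eqxx big1 ?addr0 //.
by move=> r /negPf rm; rewrite homog_partX eq_sym -(inj_eq val_inj) /= in rm *; rewrite rm.
Qed.

Lemma divXM j p : divX j ('X_j * p) = p.
Proof.
elim/mpoly_lin_ind: p => [c p q Ep Eq|m].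
  by rewrite mulrDr -scalerAr linearP /= Ep Eq.
by rewrite -mpolyXD mpoly_liftE mnmDE mnm1E eqxx addmC addmK.
Qed.

Lemma divXC i j p : i != j -> divX i ('X_j * p) = 'X_j * divX i p.
Proof.
move=> ij; elim/mpoly_lin_ind: p => [c p q Ep Eq|m].
  by rewrite mulrDr -scalerAr !linearP /= Ep Eq mulrDr scalerAr.
rewrite -mpolyXD !mpoly_liftE mnmDE mnm1E [j == i]eq_sym (negPf ij) add0n.
case: eqP => [|mi]; first by rewrite mulr0.
rewrite -mpolyXD; suff -> : (U_(j) + m - U_(i) = U_(j) + (m - U_(i)))%MM by [].
apply/mnmP => k; rewrite !(mnmBE, mnmDE, mnm1E).
by have [ik|] := eqVneq i k; [move: mi; rewrite ik; lia | rewrite !subn0].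
Qed.

Lemma divX_nil j p : exists N, iter N (divX j) p = 0.
Proof.
have iL N c p1 q1 : iter N (divX j) (c *: p1 + q1) =
    c *: iter N (divX j) p1 + iter N (divX j) q1.
  by elim: N => //= N ->; rewrite linearP.
have iD N N' p1 : iter N (divX j) p1 = 0 -> iter (N' + N) (divX j) p1 = 0.
  by rewrite iterD => ->; elim: N' => //= N' ->; rewrite linear0.
elim/mpoly_lin_ind: p => [c p q [N pN] [N' qN]|m].
  by exists (N + N')%N; rewrite iL [iter _ _ q]iD // addnC [iter _ _ p]iD // scaler0 addr0.
exists (m j).+1; move: {2}(m j) (erefl (m j)) => k; elim: k m => [|k IHk] m mj.
  by rewrite mj /= mpoly_liftE mj.
rewrite mj iterSr mpoly_liftE mj /=; have := IHk (m - U_(j))%MM.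
by rewrite mnmBE mnm1E eqxx mj subn1 /= => ->.
Qed.

Hypothesis charK : forall n, n.+1%:R != 0 :> K.

Lemma euler_coeff m p : (euler p)@_m = (mdeg m)%:R * p@_m.
Proof.
elim/mpoly_lin_ind: p => [c p q Ep Eq|m'].
  by rewrite linearP /= !mcoeffD !mcoeffZ Ep Eq mulrDr mulrCA.
by rewrite eulerX mcoeffZ mcoeffX; case: eqP => [->|]; rewrite ?mulr0.
Qed.

Lemma homog_coeff r p m : euler p = r%:R *: p -> p@_m != 0 -> mdeg m = r.
Proof.
move=> pE p0; have := congr1 (mcoeff m) pE; rewrite euler_coeff mcoeffZ.
move/(mulIf p0)/eqP; rewrite -subr_eq0; have natK n : n%:R = 0 :> K -> n = 0%N.
  by case: n => // n /eqP; rewrite (negPf (charK n)).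
case: (leqP r (mdeg m)) => [rm|/ltnW rm].
  by rewrite -natrB // => /eqP/natK/eqP; rewrite subn_eq0 => mr; apply/eqP; rewrite eqn_leq mr.
rewrite -opprB -natrB // oppr_eq0 => /eqP/natK/eqP; rewrite subn_eq0 => mr.
by apply/eqP; rewrite eqn_leq mr rm.
Qed.

Lemma homog0_const p : euler p = 0%:R *: p -> p = (p@_0)%:MP.
Proof.
move=> pE; apply/mpolyP => m; rewrite mcoeffC eq_sym; have [p0|p0] := eqVneq p@_m 0.
  by rewrite p0; case: eqP => [E|]; rewrite ?mulr0 // E p0 mul0r.
have /eqP := homog_coeff pE p0; rewrite mdeg_eq0 => /eqP ->; by rewrite eqxx mulr1.
Qed.
End PolynomialOperators.

(** * Crossed product of a polynomial algebra by a linear group action *)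

Section LinearCrossedProduct.
Variables (K : fieldType) (d : nat) (G : finGroupType) (M : G -> 'M[K]_d).
Hypotheses (M1 : M 1%g = 1%:M) (MM : forall g h, M (g * h)%g = M g *m M h).
Local Notation S := {mpoly K[d]}.

Definition linform g (j : 'I_d) : S := \sum_i M g i j *: 'X_i.
Definition lin_act g : {lrmorphism S -> S} := comp_mpoly [tuple linform g j | j < d].

#[local] Arguments lin_act : simpl never.

Lemma lin_actX g j : lin_act g 'X_j = linform g j.
Proof. by rewrite /lin_act /= comp_mpolyXU -tnth_nth tnth_mktuple. Qed.

Lemma lin_act_lin g c p q : lin_act g (c *: p + q) = c *: lin_act g p + lin_act g q.
Proof. exact: linearP. Qed.
Lemma lin_act_mul g p q : lin_act g (p * q) = lin_act g p * lin_act g q.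
Proof. exact: rmorphM. Qed.
Lemma lin_act_one g : lin_act g 1 = 1. Proof. exact: rmorph1. Qed.
Lemma lin_act_add g p q : lin_act g (p + q) = lin_act g p + lin_act g q.
Proof. exact: raddfD. Qed.
Lemma lin_act_sum g (c : 'I_d -> K) (F : 'I_d -> S) :
  lin_act g (\sum_i c i *: F i) = \sum_i c i *: lin_act g (F i).
Proof. by rewrite linear_sum; apply: eq_bigr => i _; exact: linearZZ. Qed.

Lemma lin_act1 p : lin_act 1%g p = p.
Proof.
elim/mpoly_gen_ind: p => [c p q Ep Eq|p q Ep Eq||j].
- by rewrite lin_act_lin Ep Eq.
- by rewrite lin_act_mul Ep Eq.
- exact: lin_act_one.
rewrite lin_actX /linform M1 (bigD1 j) //= big1 => [|i /negPf ij].
  by rewrite mxE eqxx scale1r addr0.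
by rewrite mxE ij scale0r.
Qed.

Lemma lin_actM g h p : lin_act (g * h)%g p = lin_act g (lin_act h p).
Proof.
elim/mpoly_gen_ind: p => [c p q Ep Eq|p q Ep Eq||j].
- by rewrite !lin_act_lin Ep Eq.
- by rewrite !lin_act_mul Ep Eq.
- by rewrite !lin_act_one.
rewrite !lin_actX /linform lin_act_sum MM.
under [RHS]eq_bigr => i _ do rewrite lin_actX /linform scaler_sumr.
rewrite exchange_big; apply: eq_bigr => k _ /=; rewrite mxE scaler_suml.
by apply: eq_bigr => i _; rewrite scalerA mulrC.
Qed.

Definition lin_action : algebra_action G S := AlgebraAction lin_act1 lin_actM.
Local Notation A1 := (crossed lin_action).
Local Notation elt := (crossed_elt lin_action).
Implicit Types (a b : A1) (g h : G) (p q : S) (r n : nat).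

Lemma lin_actV g p : lin_act g (lin_act g^-1%g p) = p.
Proof. by rewrite -lin_actM mulgV lin_act1. Qed.
Lemma lin_actVK g p : lin_act g^-1%g (lin_act g p) = p.
Proof. by rewrite -lin_actM mulVg lin_act1. Qed.

Lemma euler_lin_act g p : euler K d (lin_act g p) = lin_act g (euler K d p).
Proof.
elim/mpoly_gen_ind: p => [c p q Ep Eq|p q Ep Eq||j].
- by rewrite lin_act_lin linearP /= Ep Eq -lin_act_lin -linearP.
- by rewrite lin_act_mul !eulerM Ep Eq lin_act_add !lin_act_mul.
- by rewrite lin_act_one -mpolyX0 eulerX mdeg0 scale0r -[RHS]/(lin_act g (0 : S)) raddf0.
rewrite eulerX mdeg1 scale1r lin_actX /linform linear_sum; apply: eq_bigr => i _.
by rewrite linearZZ /= eulerX mdeg1 scale1r.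
Qed.

Section Slotwise.
Variable phi : {linear S -> S}.
Definition slotwise_fun (a : A1) : A1 := [ffun g => phi (a g)].
Lemma slotwise_linear : linear slotwise_fun.
Proof. by move=> c a b; apply/ffunP=> g; rewrite !ffunE linearP. Qed.
HB.instance Definition _ :=
  GRing.isLinear.Build K A1 A1 *:%R slotwise_fun slotwise_linear.
Definition slotwise : {linear A1 -> A1} := slotwise_fun.
Lemma slotwiseE a g : slotwise a g = phi (a g). Proof. by rewrite /slotwise /= ffunE. Qed.
End Slotwise.

Definition crossed_euler : {linear A1 -> A1} := slotwise (euler K d).

Lemma crossed_eulerM a b :
  crossed_euler (a * b) = crossed_euler a * b + a * crossed_euler b.
Proof.
apply/ffunP=> g; rewrite slotwiseE !ffunE linear_sum -big_split; apply: eq_bigr => h _.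
by rewrite eulerM !slotwiseE /= euler_lin_act.
Qed.

Lemma ofwt_crossed r a : ofwt crossed_euler r a <-> forall g, euler K d (a g) = r%:R *: a g.
Proof.
split=> [E g|E]; last by apply/ffunP=> g; rewrite slotwiseE E ffunE.
by rewrite -slotwiseE -/crossed_euler E ffunE.
Qed.

Lemma crossed_ofwt_span a : exists N (c : nat -> A1),
  (forall r, ofwt crossed_euler r (c r)) /\ a = \sum_(r < N) c r.
Proof.
have [N NP] : exists N : G -> nat, forall g N', (N g <= N')%N ->
    a g = \sum_(r < N') homog_part K d r (a g).
  apply: (exists_fun (P := fun g N => forall N', (N <= N')%N ->
    a g = \sum_(r < N') homog_part K d r (a g))) => g; exact: homog_part_sum.
exists (\max_g N g)%N, (fun r => slotwise (homog_part K d r) a); split.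
  by move=> r; apply/ofwt_crossed => g; rewrite slotwiseE euler_homog_part.
apply/ffunP=> g; rewrite sum_ffunE {1}(NP g (\max_g N g)%N) ?leq_bigmax //.
by apply: eq_bigr => r _; rewrite slotwiseE.
Qed.

Lemma elt_linear g : linear (elt^~ g).
Proof.
move=> c p q; apply/ffunP=> h; rewrite !ffunE; case: eqP => //.
by rewrite scaler0 addr0.
Qed.

Lemma elt_sum g (I : Type) (s : seq I) (F : I -> S) :
  elt (\sum_(i <- s) F i) g = \sum_(i <- s) elt (F i) g.
Proof.
apply/ffunP=> h; rewrite sum_ffunE ffunE; case: eqP => hg.
  by apply: eq_bigr => i _; rewrite ffunE hg eqxx.
by rewrite big1 // => i _; rewrite ffunE; case: eqP.
Qed.

Lemma eltE a : a = \sum_g elt (a g) g.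
Proof.
apply/ffunP=> h; rewrite sum_ffunE (bigD1 h) //= big1 => [|g /negPf gh].
  by rewrite ffunE eqxx addr0.
by rewrite ffunE eq_sym gh.
Qed.

Definition crossedU g : A1 := elt 1 g.
(** Variables and divisions are indexed by [nat], as in the vanishing theorem, with value 0 from
    index d on. *)
Definition varS (i : nat) : S := oapp (fun j : 'I_d => 'X_j) 0 (insub i).
Definition divS (i : nat) : {linear S -> S} :=
  oapp (fun j : 'I_d => divX K j) (\0%R : {linear S -> S}) (insub i).
Definition crossedX (i : nat) : A1 := elt (varS i) 1%g.
Definition crossed_div (i : nat) : {linear A1 -> A1} := slotwise (divS i).

Lemma varSE (j : 'I_d) : varS j = 'X_j. Proof. by rewrite /varS valK. Qed.
Lemma divSE (j : 'I_d) : divS j = divX K j. Proof. by rewrite /divS valK. Qed.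

Lemma crossedXM i a g : (crossedX i * a) g = varS i * a g.
Proof.
rewrite ffunE (bigD1 1%g) //= big1 => [|h /negPf h1].
  by rewrite ffunE eqxx invg1 mul1g addr0 lin_act1.
by rewrite ffunE h1 mul0r.
Qed.

Lemma ltn_ord_ex i : (i < d)%N -> exists j : 'I_d, i = j.
Proof. by move=> id; exists (Ordinal id). Qed.

(** The polynomial coefficients stand to the left of the group elements, so division by a variable
    acts coefficientwise; nilpotency on all coefficients at once uses that the group is finite. *)
Lemma crossed_vanish n (z : hoch A1 n.+1) : #|G|%:R != 0 :> K ->
  (d <= n)%N -> hoch_b z = 0 -> exists y, z = hoch_b y.
Proof.
move=> cardG; apply: (@hoch_vanish _ _ d crossedX crossed_div _ _ _ _ G crossedU) => //.
- by move=> i j _ _; rewrite !crossed_eltM /= !lin_act1 mulrC.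
- move=> _ a /ltn_ord_ex[i ->]; apply/ffunP=> g.
  by rewrite slotwiseE crossedXM varSE divSE divXM.
- move=> _ _ a /ltn_ord_ex[i ->] /ltn_ord_ex[j ->] ij.
  apply/ffunP=> g; rewrite slotwiseE !crossedXM slotwiseE varSE divSE divXC //.
- move=> _ a /ltn_ord_ex[i ->].
  have [N NP] : exists N : G -> nat, forall g, iter (N g) (divX K i) (a g) = 0.
    exact: (exists_fun (P := fun g N => iter N (divX K i) (a g) = 0)
      (fun g => divX_nil _ _)).
  exists (\max_g N g)%N; apply/ffunP=> g; rewrite [RHS]ffunE.
  have -> k : iter k (crossed_div i) a g = iter k (divX K i) (a g).
    by elim: k => //= k <-; rewrite slotwiseE divSE.
  have /subnK <- : (N g <= \max_g N g)%N by exact: leq_bigmax.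
  by rewrite iterD NP; elim: (_ - _)%N => //= k ->; rewrite linear0.
- by apply/ffunP=> g; rewrite !ffunE; case: eqP.
- by move=> g h; rewrite /crossedU crossed_eltM rmorph1 mulr1.
- move=> g _ /ltn_ord_ex[j ->]; exists (fun i => oapp (fun i => M g i j) 0 (insub i)).
  rewrite !crossed_eltM mul1r rmorph1 mulr1 mulg1 mulgV varSE.
  rewrite /= -/(lin_act g _) lin_actX elt_sum; apply: eq_bigr => i _.
  rewrite valK /= /crossedX varSE; have := elt_linear 1%g (M g i j) 'X_i 0.
  by rewrite addr0 => ->; apply/ffunP=> h; rewrite !ffunE if_same addr0.
- move=> P PL PM PU PX a.
  have P0 : P 0 by have := PL (-1) _ _ (PU 1%g) (PU 1%g); rewrite scaleN1r addNr.
  rewrite [a]eltE; elim/big_rec: _ => // g b _ Pb; rewrite -[elt _ _]scale1r.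
  apply: (PL) => //; have -> : elt (a g) g = elt (a g) 1%g * crossedU g.
    by rewrite crossed_eltM /= lin_act1 mulr1 mul1g.
  apply: (PM) => //; move: (a g); apply: mpoly_gen_ind => [c p q Pp Pq|p q Pp Pq||j].
  + by rewrite elt_linear; exact: PL.
  + by have := PM _ _ Pp Pq; rewrite crossed_eltM /= lin_act1 mul1g.
  + exact: PU.
  + by have := PX j (ltn_ord j); rewrite /crossedX varSE.
Qed.
End LinearCrossedProduct.

(** * A PBW basis makes an algebra a filtered deformation of the crossed product *)

Section PBWDeformation.
Variables (K : fieldType) (d : nat) (G : finGroupType) (M : G -> 'M[K]_d).
Hypotheses (M1 : M 1%g = 1%:M) (MM : forall g h, M (g * h)%g = M g *m M h).
Hypothesis charK : forall n, n.+1%:R != 0 :> K.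
Local Notation S := {mpoly K[d]}.
Local Notation act := (lin_act M).
Local Notation A1 := (crossed (lin_action M1 MM)).
Local Notation elt := (crossed_elt (lin_action M1 MM)).
Local Notation wt := (ofwt (crossed_euler M1 MM)).
Local Notation hom r p := (euler K d p = r%:R *: p).
#[local] Arguments lin_act : simpl never.

Variables (A : algType K) (Sx : {lrmorphism S -> A}) (U : G -> A).
Hypotheses (U1 : U 1%g = 1) (UM : forall g h, U (g * h)%g = U g * U h).

(** Elements of A1 have their polynomials on the left, whereas the PBW basis has them on the right;
    p g = g (g^-1 p) in A1 accounts for the inverse action. *)
Definition pbw_fun (a : A1) : A := \sum_g U g * Sx (act g^-1%g (a g)).
Lemma pbw_linear : linear pbw_fun.
Proof.
move=> c a b; rewrite /pbw_fun scaler_sumr -big_split; apply: eq_bigr => g _ /=.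
by rewrite !ffunE lin_act_lin linearP /= mulrDr scalerAr.
Qed.
HB.instance Definition _ := GRing.isLinear.Build K A1 A *:%R pbw_fun pbw_linear.
Definition pbw : {linear A1 -> A} := pbw_fun.

Lemma pbwE a : pbw a = \sum_g U g * Sx (act g^-1%g (a g)). Proof. by []. Qed.
#[local] Arguments pbw : simpl never.

Hypothesis pbw_bij : bijective pbw.
Hypothesis commX : forall g j, exists c : G -> K,
  Sx 'X_j * U g - U g * Sx (act g^-1%g 'X_j) = \sum_h c h *: U h.

Implicit Types (a b : A1) (y : A) (g h : G) (p q : S) (r s t n : nat).

Lemma hom_act r g p : hom r p -> hom r (act g p).
Proof.
by move=> E; rewrite (euler_lin_act M g p) E; exact: linearZZ.
Qed.

Lemma homM r s p q : hom r p -> hom s q -> hom (r + s) (p * q).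
Proof. by move=> E F; rewrite eulerM E F natrD scalerDl -scalerAl -scalerAr. Qed.

Lemma pbw_elt p g : pbw (elt p g) = U g * Sx (act g^-1%g p).
Proof.
rewrite pbwE (bigD1 g) //= big1 => [|h /negPf hg]; first by rewrite ffunE eqxx addr0.
by rewrite ffunE hg raddf0 rmorph0 mulr0.
Qed.

Lemma wt_elt r p g : hom r p -> wt r (elt p g).
Proof.
by move=> E; apply/ofwt_crossed => h; rewrite ffunE; case: eqP => // _; rewrite linear0 scaler0.
Qed.

(* [low n]: the span of the [U g * Sx p] with [p] of degree less than [n]. *)
Definition low n y : Prop := exists c : nat -> A1,
  (forall t, wt t (c t)) /\ y = pbw (\sum_(t < n) c t).

Lemma low0 n : low n 0.
Proof.
exists (fun=> 0); split=> [t|]; first exact: ofwt0.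
by rewrite big1 // linear0.
Qed.

Lemma low_lin n k y y' : low n y -> low n y' -> low n (k *: y + y').
Proof.
move=> [c [cw ->]] [c' [cw' ->]]; exists (fun t => k *: c t + c' t); split=> [t|].
  by rewrite /ofwt linearP /= cw cw' scalerDr !scalerA mulrC.
by rewrite -linearP scaler_sumr -big_split.
Qed.

Lemma lowD n y y' : low n y -> low n y' -> low n (y + y').
Proof. by move=> ly ly'; rewrite -[y]scale1r; exact: low_lin. Qed.

Lemma lowZ n k y : low n y -> low n (k *: y).
Proof. by move=> ly; rewrite -[_ *: _]addr0; apply: low_lin => //; exact: low0. Qed.

Lemma low_sum n (I : Type) (l : seq I) (P : pred I) (F : I -> A) :
  (forall i, low n (F i)) -> low n (\sum_(i <- l | P i) F i).
Proof. by move=> H; elim/big_ind: _ => // [|y y']; [exact: low0 | exact: lowD]. Qed.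

Lemma low_wt n t a : wt t a -> (t < n)%N -> low n (pbw a).
Proof.
move=> wa tn; exists (fun s => if s == t then a else 0); split=> [s|].
  by case: eqP => [->|_] //; exact: ofwt0.
rewrite (bigD1 (Ordinal tn)) //= eqxx big1 ?addr0 // => s /negPf st.
by rewrite -(inj_eq val_inj) /= in st; rewrite st.
Qed.

Lemma low_US n t p g : hom t p -> (t < n)%N -> low n (U g * Sx p).
Proof.
move=> hp tn; have -> : U g * Sx p = pbw (elt (act g p) g).
  by rewrite pbw_elt (lin_actVK M1 MM).
by apply: low_wt tn; apply: wt_elt; exact: hom_act.
Qed.

Lemma low_ind n y (P : A -> Prop) : low n y -> P 0 -> (forall x x', P x -> P x' -> P (x + x')) ->
  (forall t p g, hom t p -> (t < n)%N -> P (U g * Sx p)) -> P y.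
Proof.
move=> [c [cw ->]] P0 PD PX; rewrite linear_sum; elim/big_ind: _ => // t _.
rewrite pbwE; elim/big_ind: _ => // g _; apply: (PX t) => //; apply: hom_act.
by have /ofwt_crossed := cw t.
Qed.

Lemma low_Umul n y g : low n y -> low n (U g * y).
Proof.
move=> ly; apply: (low_ind (P := fun y => low n (U g * y)) ly) => [|x x' lx lx'|t p h hp tn];
    first by rewrite mulr0; exact: low0.
  by rewrite mulrDr; exact: lowD.
by rewrite mulrA -UM; exact: low_US hp tn.
Qed.

Lemma low_mulS n s y q : hom s q -> low n y -> low (n + s) (y * Sx q).
Proof.
move=> hq ly; apply: (low_ind (P := fun y => low (n + s) (y * Sx q)) ly) =>
  [|x x' lx lx'|t p h hp tn];
    first by rewrite mul0r; exact: low0.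
  by rewrite mulrDl; exact: lowD.
rewrite -mulrA -rmorphM; apply: low_US (homM hp hq) _.
by rewrite ltn_add2r.
Qed.

Lemma hom_X m : hom (mdeg m) 'X_[m]. Proof. exact: eulerX. Qed.

Lemma low_Xmul n y j : low n y -> low n.+1 (Sx 'X_j * y).
Proof.
move=> ly; apply: (low_ind (P := fun y => low n.+1 (Sx 'X_j * y)) ly) => [|x x' lx lx'|t p g hp tn];
    first by rewrite mulr0; exact: low0.
  by rewrite mulrDr; exact: lowD.
have [c cE] := commX g j.
have -> : Sx 'X_j * (U g * Sx p) =
    U g * Sx (act g^-1%g 'X_j * p) + \sum_h c h *: (U h * Sx p).
  under eq_bigr => h _ do rewrite scalerAl.
  by rewrite -mulr_suml -cE mulrBl -!mulrA -rmorphM addrC subrK.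
apply: lowD; first apply: low_US (homM (hom_act _ (hom_X _)) hp) _; first by rewrite mdeg1.
by apply: low_sum => h; apply: lowZ; apply: low_US hp _; exact: ltnW.
Qed.

(** Peel off one variable: the error is X_j times the error of the remaining monomial, plus the
    group algebra error of X_j times a polynomial of degree r-1, and both have degree below r. *)
Lemma low_comm_monomial r m g : mdeg m = r ->
  low r (Sx 'X_[m] * U g - U g * Sx (act g^-1%g 'X_[m])).
Proof.
elim: r m => [|r IHr] m mr.
  move/eqP: mr; rewrite mdeg_eq0 => /eqP ->.
  by rewrite mpolyX0 lin_act_one rmorph1 mulr1 mul1r subrr; exact: low0.
have [j mj] : exists j, m j != 0%N.
  apply/existsP; rewrite -negb_forall; apply/negP => /forallP m0.
  suff : mdeg m = 0%N by rewrite mr.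
  by rewrite mdegE big1 // => i _; apply/eqP.
have mE : m = (U_(j) + (m - U_(j)))%MM.
  by rewrite addmC submK // lep1mP.
have m'r : mdeg (m - U_(j))%MM = r by have := mr; rewrite {1}mE mdegD mdeg1 => -[].
have [c cE] := commX g j.
rewrite mE mpolyXD; set m' := (m - _)%MM in m'r *.
have -> : Sx ('X_j * 'X_[m']) * U g - U g * Sx (act g^-1%g ('X_j * 'X_[m'])) =
    Sx 'X_j * (Sx 'X_[m'] * U g - U g * Sx (act g^-1%g 'X_[m'])) +
    \sum_h c h *: (U h * Sx (act g^-1%g 'X_[m'])).
  under eq_bigr => h _ do rewrite scalerAl.
  by rewrite -mulr_suml -cE mulrBr mulrBl lin_act_mul !rmorphM !mulrA subrKA.
apply: lowD; first by apply: low_Xmul; exact: IHr.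
apply: low_sum => h; apply: lowZ; apply: low_US (hom_act _ (hom_X _)) _.
by rewrite m'r.
Qed.

Lemma low_comm r p g : hom r p -> low r (Sx p * U g - U g * Sx (act g^-1%g p)).
Proof.
move=> hp; have : forall m, p@_m != 0 -> mdeg m = r by move=> m; exact: homog_coeff.
rewrite {2 3}(mpolyE p); elim: (msupp p) => [|m l IHl] pr.
  by rewrite !big_nil raddf0 !rmorph0 mul0r mulr0 subrr; exact: low0.
rewrite !big_cons lin_act_lin !linearP /= mulrDl mulrDr opprD addrACA.
apply: lowD; last exact: IHl.
rewrite -scalerAl -scalerAr -scalerBr.
have [->|p0] := eqVneq p@_m 0; first by rewrite scale0r; exact: low0.
by apply: lowZ; apply: low_comm_monomial; exact: pr.
Qed.

(** After normal ordering, the two products differ only by the error of moving a polynomial past a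
    group element, which [low_comm] bounds. *)
Lemma pbwM a b r s : wt r a -> wt s b -> exists c : nat -> A1,
  (forall t, wt t (c t)) /\ pbw a * pbw b = pbw (a * b) + pbw (\sum_(t < r + s) c t).
Proof.
move=> /ofwt_crossed wa /ofwt_crossed wb.
suff [c [cw cE]] : low (r + s) (pbw a * pbw b - pbw (a * b)).
  by exists c; split=> //; rewrite -cE addrC subrK.
have -> : pbw (a * b) = \sum_g \sum_h pbw (elt (a g * act g (b h)) (g * h)%g).
  rewrite {1}[a]eltE {1}[b]eltE big_distrl linear_sum; apply: eq_bigr => g _ /=.
  by rewrite big_distrr linear_sum; apply: eq_bigr => h _; rewrite /= crossed_eltM.
rewrite !pbwE mulr_suml -sumrB; apply: low_sum => g.
rewrite mulr_sumr -sumrB; apply: low_sum => h.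
have E p : act (g * h)^-1%g p = act h^-1%g (act g^-1%g p).
  by rewrite invMg; exact: lin_actM.
rewrite pbw_elt lin_act_mul [Sx (_ * _)]rmorphM UM (E (a g)) (E (act g (b h))).
rewrite [act g^-1%g (act g _)](lin_actVK M1 MM).
set p := act g^-1%g (a g); set q := act h^-1%g (b h).
have -> : U g * Sx p * (U h * Sx q) - U g * U h * (Sx (act h^-1%g p) * Sx q) =
    U g * ((Sx p * U h - U h * Sx (act h^-1%g p)) * Sx q).
  by rewrite mulrBl mulrBr !mulrA.
apply: low_Umul; apply: low_mulS; first exact: hom_act.
by apply: low_comm; exact: hom_act.
Qed.
Lemma card_group_neq0 : #|G|%:R != 0 :> K.
Proof. by move: (cardG_gt0 [set: G]); rewrite cardsT; case: #|G|. Qed.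

(** The averaging argument with no variables: a group algebra has no higher Hochschild homology in
    characteristic zero. *)
Lemma group_algebra_vanish n (z : hoch (group_algebra K G) n.+1) : hoch_b z = 0 ->
  exists u, z = hoch_b u.
Proof.
apply: (@hoch_vanish _ _ 0%N (fun=> 0) (fun=> idfun) _ _ _ _ G (@group_elt K G)) => //.
- exact: group_elt1.
- exact: group_eltM.
- move=> P PL PM PU _ c; have P0 : P 0.
    by have := PL (-1) _ _ (PU 1%g) (PU 1%g); rewrite scaleN1r addNr.
  have -> : c = \sum_g c g *: group_elt K g.
    apply/ffunP=> h; rewrite sum_ffunE (bigD1 h) //= big1 => [|g /negPf gh].
      by rewrite !ffunE eqxx addr0 -[_ *: _]/(c h * 1) mulr1.
    by rewrite !ffunE eq_sym gh scaler0.
  by elim/big_rec: _ => // g b _; exact: PL.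
exact: card_group_neq0.
Qed.

Local Notation f := (group_algebra_lift U1 UM).

Lemma lift_pbw (c : group_algebra K G) : f c = pbw [ffun g => (c g)%:MP].
Proof.
rewrite pbwE; apply: eq_bigr => g _; rewrite ffunE -[_%:MP]mulr1 mul_mpolyC.
have -> : act g^-1%g (c g *: 1) = c g *: 1.
  by rewrite -[RHS](congr1 (fun p => c g *: p) (lin_act_one M g^-1%g)); exact: linearZZ.
by rewrite linearZZ rmorph1 -scalerAr mulr1.
Qed.

Lemma wt_const (c : group_algebra K G) : wt 0 ([ffun g => (c g)%:MP] : A1).
Proof.
apply/ofwt_crossed => g; rewrite ffunE -[_%:MP]mulr1 mul_mpolyC linearZZ /=.
by rewrite -mpolyX0 eulerX mdeg0 !scale0r scaler0.
Qed.

Theorem pbw_comparison :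
  (forall n, (d < n)%N -> lmod_iso (HP n A) (HC n A) /\
     lmod_iso (HC n A) (HC n (group_algebra K G))) /\
  (forall n, bijective (HP_map f n)).
Proof.
have [pbwi pbwK pbwiK] := linear_inverse pbw_bij.
have DM := crossed_eulerM (M1 := M1) (MM := MM).
have span := crossed_ofwt_span (M1 := M1) (MM := MM).
have exact1 n (z : hoch A1 n.+1) : (d <= n)%N -> hoch_b z = 0 -> exists u, z = hoch_b u.
  exact: crossed_vanish card_group_neq0.
have pbw1 : pbw 1 = 1.
  have -> : (1 : A1) = elt 1 1%g by apply/ffunP=> g; rewrite !ffunE; case: eqP.
  by rewrite pbw_elt U1 mul1r lin_act_one rmorph1.
have fw c : exists2 a, wt 0 a & f c = pbw a.
  by exists [ffun g => (c g)%:MP]; [exact: wt_const | exact: lift_pbw].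
have wf a : wt 0 a -> exists c, pbw a = f c.
  move=> /ofwt_crossed wa; exists ([ffun g => (a g)@_0] : group_algebra K G).
  rewrite lift_pbw; congr (pbw _); apply/ffunP=> g; rewrite !ffunE.
  by apply: homog0_const => //; exact: wa.
(* Constant terms in PBW coordinates give a linear retraction of the inclusion, which makes the
   induced maps on tensors injective. *)
pose r0 (y : A) : group_algebra K G := [ffun g => (pbwi y g)@_0].
have r0L : linear r0.
  by move=> k y y'; apply/ffunP=> g; rewrite !ffunE linearP /= !ffunE mcoeffD mcoeffZ.
pose rl := GRing.isLinear.Build K A (group_algebra K G) *:%R r0 r0L.
pose ret : {linear A -> group_algebra K G} := HB.pack r0 rl.
apply: (@HP_HC_comparison _ _ _ f d ret).
- by move=> c; apply/ffunP=> g; rewrite ffunE lift_pbw pbwK ffunE mcoeffC eqxx mulr1.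
- exact: (b_exact_deformed DM charK span pbwK pbwiK pbwM exact1).
- by move=> q z _; exact: group_algebra_vanish.
- exact: (cyc_exact_deformed DM charK span pbwK pbwiK pbw1 pbwM exact1 fw wf).
Qed.
End PBWDeformation.

Import Order.TTheory Num.Theory.

(** * Extended graded Hecke algebras *)

Section RootDatumAction.
Variables (R : realType) (D : root_datum R) (W : weyl_group D) (Gam : diagram_group W).
Local Notation K := R[i].
Local Notation V := (dual_space D).
Local Notation d := (\dim {:D}).
Local Notation G := (extended_weyl Gam).
Local Notation e j := ((vbasis {:D})`_j).
Implicit Types (x y z : V) (v : D) (g : Gam) (w : W) (u : G).

(** The dual basis belonging to the coordinates in which [sym_of] is written, so that [xdual j]
    corresponds to the variable of index j. *)
Definition xdual (j : 'I_d) : V := linfun (coord (vbasis {:D}) j : D -> R^o).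

Lemma xdualE (i j : 'I_d) : xdual j (e i) = (i == j)%:R.
Proof. by rewrite lfunE /= coord_free //; exact: basis_free (vbasisP _). Qed.

Lemma dual_expand y : y = \sum_(j < d) y (e j) *: xdual j.
Proof.
apply/lfunP => v; rewrite sum_lfunE [in LHS](coord_vbasis (memvf v)) linear_sum.
by apply: eq_bigr => j _; rewrite linearZ scale_lfunE lfunE; exact: mulrC.
Qed.

(** The reflection is an isometry and negates the coroot; comparing the inner product of [v] with
    the coroot before and after reflecting expresses the root through its coroot. *)
Lemma root_ip_coroot (a : V) v : a \in rd_roots D ->
  a v * rd_ip (rd_coroot a) (rd_coroot a) = 2 * rd_ip v (rd_coroot a).
Proof.
move=> ha; set c := rd_coroot a.
have ipZ k v1 v2 : rd_ip (k *: v1) v2 = k * rd_ip v1 v2 :> R.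
  have ip0 : rd_ip 0 v2 = 0 :> R.
    by have := rd_ipDl (-1) v1 v1 v2; rewrite scaleN1r addNr mulN1r addNr.
  by rewrite -[k *: v1]addr0 rd_ipDl ip0 addr0.
have := rd_orthogonal v c ha; rewrite -/c rd_pairing //.
have -> : c - 2 *: c = (-1) *: c by rewrite -{1}[c]scale1r -scalerBl; congr (_ *: _); ring.
rewrite rd_ipC ipZ rd_ipC -[v - _]addrC -scaleNr rd_ipDl mulN1r => E.
have -> : a v * rd_ip c c = (- (- a v * rd_ip c c + rd_ip v c)) + rd_ip v c by ring.
by rewrite E; ring.
Qed.

(** Diagram automorphisms are prescribed on coroots; since a root is determined by its coroot and
    the inner product, orthogonality carries the prescription over to roots. *)
Lemma simple_root_diag g i v :
  simple_root (diag_perm g i) (diag_lin g v) = simple_root i v.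
Proof.
have ri j : simple_root j \in rd_roots D by apply: rd_simple_root; exact: mem_tnth.
have := root_ip_coroot (diag_lin g v) (ri (diag_perm g i)).
rewrite -/(simple_coroot (diag_perm g i)) -diag_coroot !diag_orthogonal.
rewrite -(root_ip_coroot v (ri i)); apply: mulIf; apply/eqP => c0.
have := rd_ip_gt0 (v := simple_coroot i); rewrite c0 ltxx => H.
suff : simple_coroot i != 0 by move/H.
apply/eqP => s0; have := rd_pairing (ri i); rewrite -/(simple_coroot i) s0 linear0.
by move/eqP; rewrite eq_sym pnatr_eq0.
Qed.

Definition diag_dual g x : V := (x \o diag_lin g^-1%g)%VF.

Lemma diag_dualE g x v : diag_dual g x v = x (diag_lin g^-1%g v).
Proof. exact: comp_lfunE. Qed.

Lemma diag_linK g v : diag_lin g (diag_lin g^-1%g v) = v.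
Proof. by rewrite -comp_lfunE -diag_linM mulgV diag_lin1 id_lfunE. Qed.

Lemma diag_dualM g h x : diag_dual (g * h)%g x = diag_dual g (diag_dual h x).
Proof. by apply/lfunP => v; rewrite !diag_dualE invMg diag_linM comp_lfunE. Qed.

Lemma diag_dual1 x : diag_dual 1%g x = x.
Proof. by apply/lfunP => v; rewrite diag_dualE invg1 diag_lin1 id_lfunE. Qed.

Lemma diag_dualK g x : diag_dual g^-1%g (diag_dual g x) = x.
Proof. by rewrite -diag_dualM mulVg diag_dual1. Qed.

Lemma diag_dualKV g x : diag_dual g (diag_dual g^-1%g x) = x.
Proof. by rewrite -diag_dualM mulgV diag_dual1. Qed.

Lemma diag_dual_linear g c x y : diag_dual g (c *: x + y) = c *: diag_dual g x + diag_dual g y.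
Proof. by apply/lfunP => v; rewrite !(diag_dualE, add_lfunE, scale_lfunE). Qed.

Lemma weyl_act_diag g w x :
  weyl_act (diag_w Gam w g) x = diag_dual g^-1%g (weyl_act w (diag_dual g x)).
Proof.
pose P := [set w : W | `[< forall x, weyl_act (diag_w Gam w g) x =
  diag_dual g^-1%g (weyl_act w (diag_dual g x)) >]].
suff: [set: W] \subset P by move/subsetP/(_ w (in_setT w)); rewrite inE => /asboolP.
have gP : group_set P.
  apply/group_setP; split=> [|w1 w2].
    rewrite inE; apply/asboolP => y.
    by rewrite gact1 ?inE // !weyl_act1 !id_lfunE diag_dualK.
  rewrite !inE => /asboolP P1 /asboolP P2; apply/asboolP => y.
  rewrite gactM ?inE // !weyl_actM !comp_lfunE P1 P2.
  by rewrite diag_dualKV.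
rewrite -weyl_generated (gen_subG _ (Group gP)); apply/subsetP=> _ /imsetP[j _ ->].
rewrite inE; apply/asboolP => y; rewrite -(permKV (diag_perm g) j) diag_w_s !weyl_act_s.
move: ((diag_perm g)^-1%g j) => i; apply/lfunP => v.
rewrite diag_dualE invgK !(add_lfunE, opp_lfunE, scale_lfunE) !diag_dualE -!diag_coroot.
have K1 v1 : diag_lin g^-1%g (diag_lin g v1) = v1 by rewrite -{2}[g]invgK diag_linK.
by rewrite !K1 simple_root_diag.
Qed.

(** The action of the extended Weyl group on the dual space. It is multiplicative because [diag_w]
    is conjugation by the inverse, as [weyl_act_diag] verifies on generators. *)
Definition rho u x : V := diag_dual (\val u).1 (weyl_act (\val u).2 x).

Lemma rho1 x : rho 1%g x = x.
Proof. by rewrite /rho /= weyl_act1 id_lfunE diag_dual1. Qed.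

Lemma rhoM u u' x : rho (u * u')%g x = rho u (rho u' x).
Proof.
rewrite /rho /= weyl_actM comp_lfunE weyl_act_diag diag_dualM; congr diag_dual.
by rewrite diag_dualKV.
Qed.

Lemma rho_linear u c x y : rho u (c *: x + y) = c *: rho u x + rho u y.
Proof. by rewrite /rho linearP diag_dual_linear. Qed.

Lemma rho_sum u (c : 'I_d -> R) (F : 'I_d -> V) :
  rho u (\sum_j c j *: F j) = \sum_j c j *: rho u (F j).
Proof.
have rho0 : rho u 0 = 0 by have := rho_linear u (-1) 0 0; rewrite scaler0 addr0 scaleN1r addNr.
elim: (index_enum _) => [|j l IHl]; first by rewrite !big_nil.
by rewrite !big_cons rho_linear IHl.
Qed.

Definition rho_mx u : 'M[K]_d := \matrix_(i, j) Complex (rho u (xdual j) (e i)) 0.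

Lemma rho_mx1 : rho_mx 1%g = 1%:M.
Proof. by apply/matrixP => i j; rewrite !mxE rho1 xdualE; case: eqP. Qed.

Lemma rho_mxM u u' : rho_mx (u * u')%g = rho_mx u *m rho_mx u'.
Proof.
apply/matrixP => i j; rewrite !mxE rhoM [rho u' _]dual_expand rho_sum sum_lfunE.
rewrite -[Complex _ _]/(real_complex R _) rmorph_sum; apply: eq_bigr => k _.
by rewrite !mxE scale_lfunE mulrC; exact: (rmorphM (real_complex R)).
Qed.

Definition sym_re y : symt D := sym_of (y, 0).

Lemma sym_reE y : sym_re y = \sum_(j < d) Complex (y (e j)) 0 *: 'X_j.
Proof. by apply: eq_bigr => j _; rewrite /cpairing /= zero_lfunE. Qed.

Lemma sym_re_xdual j : sym_re (xdual j) = 'X_j.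
Proof.
rewrite sym_reE (bigD1 j) //= big1 => [|i /negPf ij]; rewrite xdualE ?eqxx ?ij.
  by rewrite scale1r addr0.
exact: scale0r.
Qed.

Lemma linform_rho u j : linform rho_mx u j = sym_re (rho u (xdual j)).
Proof. by rewrite sym_reE; apply: eq_bigr => i _; rewrite mxE. Qed.
End RootDatumAction.

(** * The extended graded Hecke algebra as a PBW deformation *)

Section HeckePBW.
Variables (R : realType) (D : root_datum R) (W : weyl_group D) (k : parameters W).
Variables (Gam : diagram_group W) (H : hecke_algebra k) (psi : hecke_diagram_action Gam H).
Local Notation K := R[i].
Local Notation V := (dual_space D).
Local Notation d := (\dim {:D}).
Local Notation G := (extended_weyl Gam).
Local Notation A := (extended_hecke psi).
Local Notation inc := (extended_inclusion psi).
Local Notation act := (lin_act (@rho_mx R D W Gam)).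
Implicit Types (x y : V) (g : Gam) (w : W) (u : G) (z : A) (h : H).

Definition hecke_in h : A := crossed_elt psi h 1%g.

Lemma hecke_in_lin c h h' : hecke_in (c *: h + h') = c *: hecke_in h + hecke_in h'.
Proof.
by apply/ffunP=> g; rewrite !ffunE; case: eqP => // _; rewrite scaler0 addr0.
Qed.

Lemma hecke_in0 : hecke_in 0 = 0.
Proof. by apply/ffunP=> g; rewrite !ffunE if_same. Qed.

Lemma hecke_inM h h' : hecke_in (h * h') = hecke_in h * hecke_in h'.
Proof. by rewrite /hecke_in crossed_eltM algebra_act1 mulg1. Qed.

Lemma hecke_in1 : hecke_in 1 = 1.
Proof. by apply/ffunP=> g; rewrite !ffunE; case: eqP. Qed.

Definition Sx_fun (p : {mpoly K[d]}) : A := hecke_in (hecke_S H p).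
Lemma Sx_linear : linear Sx_fun.
Proof. by move=> c p q; rewrite /Sx_fun linearP hecke_in_lin. Qed.
Lemma Sx_monoid : monoid_morphism Sx_fun.
Proof.
by split=> [|p q]; rewrite /Sx_fun; [rewrite rmorph1 hecke_in1 | rewrite rmorphM hecke_inM].
Qed.
HB.instance Definition _ := GRing.isLinear.Build K {mpoly K[d]} A *:%R Sx_fun Sx_linear.
HB.instance Definition _ :=
  GRing.isMonoidMorphism.Build {mpoly K[d]} A Sx_fun Sx_monoid.
Definition Sx : {lrmorphism {mpoly K[d]} -> A} := Sx_fun.
Lemma SxE p : Sx p = hecke_in (hecke_S H p). Proof. by []. Qed.
#[local] Arguments Sx : simpl never.
#[local] Arguments lin_act : simpl never.

Definition diag_elt g : A := crossed_elt psi 1 g.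
Definition weyl_elt w : A := hecke_in (hecke_W H (group_elt K w)).

Lemma extended_eltE u : extended_elt psi u = diag_elt (\val u).1 * weyl_elt (\val u).2.
Proof. by []. Qed.

Lemma sd_subproof (p : Gam * W) : p \in setX [set: Gam] [set: W].
Proof. by rewrite !inE. Qed.
Definition sd (p : Gam * W) : G := SdPair (diag_w Gam) (sd_subproof p).

Lemma valsdK u : sd (\val u) = u. Proof. exact: val_inj. Qed.

Definition img z : Prop := exists c, z = inc c.

Lemma img_elt u : img (extended_elt psi u).
Proof. by exists (group_elt K u); rewrite group_algebra_liftE. Qed.

Lemma imgD z z' : img z -> img z' -> img (z + z').
Proof. by move=> [c ->] [c' ->]; exists (c + c'); rewrite raddfD. Qed.
Lemma imgM z z' : img z -> img z' -> img (z * z').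
Proof. by move=> [c ->] [c' ->]; exists (c * c'); rewrite rmorphM. Qed.
Lemma img0 : img 0. Proof. by exists 0; rewrite raddf0. Qed.

Lemma img_diag g : img (diag_elt g).
Proof.
have := img_elt (sd (g, 1%g)); rewrite extended_eltE /= /weyl_elt group_elt1 rmorph1.
by rewrite hecke_in1 mulr1.
Qed.

Lemma img_weyl w : img (weyl_elt w).
Proof.
have := img_elt (sd (1%g, w)); rewrite extended_eltE /=.
have -> : diag_elt 1%g = 1 by exact: hecke_in1.
by rewrite mul1r.
Qed.

(** The cross relations modulo the group algebra. In this form they are stable under products, so
    they need checking only on diagram automorphisms and simple reflections. *)
Definition intertwines z (r : V -> V) : Prop :=
  forall y, img (Sx (sym_re y) * z - z * Sx (sym_re (r y))).

Lemma intertwinesM z z' r r' : img z -> img z' -> intertwines z r -> intertwines z' r' ->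
  intertwines (z * z') (fun y => r' (r y)).
Proof.
move=> iz iz' zr zr' y.
have -> : Sx (sym_re y) * (z * z') - z * z' * Sx (sym_re (r' (r y))) =
   (Sx (sym_re y) * z - z * Sx (sym_re (r y))) * z' +
   z * (Sx (sym_re (r y)) * z' - z' * Sx (sym_re (r' (r y)))).
  by rewrite mulrBl mulrBr !mulrA subrKA.
by apply: imgD; apply: imgM.
Qed.

Lemma intertwines_diag g : intertwines (diag_elt g) (diag_dual g^-1%g).
Proof.
move=> y; rewrite !SxE /hecke_in /diag_elt !crossed_eltM rmorph1 mulr1 mul1g mul1r mulg1.
rewrite hecke_act_S; have -> : cdiag g (diag_dual g^-1%g y, 0) = (y, 0).
  congr (_, _); first exact: diag_dualKV.
  by apply/lfunP => v; rewrite /= comp_lfunE !zero_lfunE.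
by rewrite subrr; exact: img0.
Qed.

Lemma reflectionK i y : reflection i (reflection i y) = y.
Proof.
have ri : simple_root i \in rd_roots D by apply: rd_simple_root; exact: mem_tnth.
rewrite /reflection !(add_lfunE, opp_lfunE, scale_lfunE) (rd_pairing ri).
set c := y _; have -> : c - c *: (2 : R^o) = - c :> R by rewrite -[_ *: _]/(c * 2); ring.
by rewrite scaleNr opprK subrK.
Qed.

(** The defect is the scalar on the right of the cross relation, a multiple of the unit of the group
    algebra. *)
Lemma intertwines_s i : intertwines (weyl_elt (weyl_s W i)) (weyl_act (weyl_s W i)^-1%g).
Proof.
move=> y.
have -> : weyl_act (weyl_s W i)^-1%g y = reflection i y.
  rewrite -{1}[y](reflectionK i) -[Z in weyl_act _ Z = _](weyl_act_s W).
  by rewrite -comp_lfunE -weyl_actM mulVg weyl_act1 id_lfunE.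
rewrite !SxE -!hecke_inM -[_ - _]addrC -scaleN1r -hecke_in_lin scaleN1r addrC.
have := hecke_cross H i (y, 0); have -> : creflection i (y, 0) = (reflection i y, 0).
  congr (_, _); apply/lfunP => v.
  by rewrite /= /reflection !(add_lfunE, opp_lfunE, scale_lfunE, zero_lfunE) scale0r subr0.
rewrite -!/(sym_re _) => ->.
exists ((k i * cpairing (y, 0 : V) (simple_coroot i)) *: 1).
rewrite linearZZ /= rmorph1; have := hecke_in_lin (k i * cpairing (y, 0 : V) (simple_coroot i)) 1 0.
by rewrite addr0 => ->; rewrite hecke_in1 hecke_in0 addr0.
Qed.

Lemma intertwines_weyl w : intertwines (weyl_elt w) (weyl_act w^-1%g).
Proof.
pose P := [set w : W | `[< intertwines (weyl_elt w) (weyl_act w^-1%g) >]].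
suff: [set: W] \subset P by move/subsetP/(_ w (in_setT w)); rewrite inE => /asboolP.
have gP : group_set P.
  apply/group_setP; split=> [|w1 w2].
    rewrite inE; apply/asboolP => y; rewrite /weyl_elt group_elt1 rmorph1 hecke_in1.
    by rewrite invg1 weyl_act1 id_lfunE mulr1 mul1r subrr; exact: img0.
  rewrite !inE => /asboolP P1 /asboolP P2; apply/asboolP => y.
  have -> : weyl_elt (w1 * w2)%g = weyl_elt w1 * weyl_elt w2.
    by rewrite /weyl_elt group_eltM rmorphM hecke_inM.
  rewrite invMg weyl_actM comp_lfunE.
  exact: (intertwinesM (img_weyl _) (img_weyl _) P1 P2).
rewrite -weyl_generated (gen_subG _ (Group gP)); apply/subsetP=> _ /imsetP[j _ ->].
by rewrite inE; apply/asboolP; exact: intertwines_s.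
Qed.

Lemma extended_comm u (j : 'I_d) : exists c : G -> K,
  Sx 'X_j * extended_elt psi u - extended_elt psi u * Sx (act u^-1%g 'X_j) =
  \sum_t c t *: extended_elt psi t.
Proof.
rewrite lin_actX linform_rho -(sym_re_xdual j) extended_eltE.
have -> : rho u^-1%g (xdual j) =
    weyl_act (\val u).2^-1%g (diag_dual (\val u).1^-1%g (xdual j)).
  have {2}-> : xdual j = rho u (rho u^-1%g (xdual j)) by rewrite -rhoM mulgV rho1.
  by rewrite {2}/rho diag_dualK -comp_lfunE -weyl_actM mulVg weyl_act1 id_lfunE.
have [c ->] := intertwinesM (img_diag _) (img_weyl _) (intertwines_diag (\val u).1)
  (intertwines_weyl (\val u).2) (xdual j).
by exists c.
Qed.

Local Notation tens p := (\sum_w hecke_W H (group_elt K w) * hecke_S H (p w)).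
Local Notation pbwA := (pbw (rho_mx1 Gam) (@rho_mxM R D W Gam) Sx (extended_elt psi)).

(** In the component of [g], only the group elements with diagram part [g] contribute; moving [g]
    past the Hecke algebra applies [psi g] to an expression in the PBW basis. *)
Lemma extended_sum_component (b : G -> {mpoly K[d]}) g :
  (\sum_u extended_elt psi u * Sx (b u)) g = psi g (tens [ffun w => b (sd (g, w))]).
Proof.
pose F g' w' := extended_elt psi (sd (g', w')) * Sx (b (sd (g', w'))).
rewrite (reindex sd); last by exists (fun u => \val u) => ? _ //; exact: valsdK.
have FE g' w' : F g' w' g = if g' == g
    then psi g (hecke_W H (group_elt K w') * hecke_S H (b (sd (g, w')))) else 0.
  rewrite /F extended_eltE SxE -mulrA -hecke_inM crossed_eltM mul1r mulg1 ffunE eq_sym.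
  rewrite -[(\val (sd (g', w'))).1]/g' -[(\val (sd (g', w'))).2]/w'.
  by case: eqP => // ->.
transitivity ((\sum_g' \sum_w' F g' w') g).
  by rewrite pair_bigA; congr ((_ : A) g); apply: eq_bigr => -[g' w'] _.
rewrite sum_ffunE (bigD1 g) //= [Z in _ + Z]big1 => [|g' /negPf g'g].
  rewrite addr0 sum_ffunE [RHS]linear_sum; apply: eq_bigr => w _.
  by rewrite FE eqxx ffunE.
by rewrite sum_ffunE big1 // => w _; rewrite FE g'g.
Qed.

(** The inverse works one component at a time: undo [psi g], read off PBW coordinates in the graded
    Hecke algebra, and move the polynomials back to the left of the group elements. *)
Lemma extended_pbw : bijective pbwA.
Proof.
have [T TK KT] := hecke_tensor H.
pose inv (z : A) : crossed (lin_action (rho_mx1 Gam) (@rho_mxM R D W Gam)) :=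
  [ffun u => act u (T (psi (\val u).1^-1%g (z (\val u).1)) (\val u).2)].
exists inv => [a|z].
  apply/ffunP=> u; rewrite ffunE pbwE extended_sum_component -algebra_actM mulVg algebra_act1 TK.
  rewrite ffunE -surjective_pairing valsdK.
  exact: (lin_actV (rho_mx1 Gam) (@rho_mxM R D W Gam)).
apply/ffunP=> g; rewrite pbwE extended_sum_component.
have -> : [ffun w => act (sd (g, w))^-1%g (inv z (sd (g, w)))] = T (psi g^-1%g (z g)).
  apply/ffunP=> w; rewrite !ffunE /=.
  exact: (lin_actVK (rho_mx1 Gam) (@rho_mxM R D W Gam)).
by rewrite KT -algebra_actM mulgV algebra_act1.
Qed.
End HeckePBW.

Theorem theorem3p3 (R : realType) (D : root_datum R) (W : weyl_group D)
    (k : parameters W) (Gam : diagram_group W)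
    (k_inv : forall (g : Gam) i, k (diag_perm g i) = k i)
    (H : hecke_algebra k) (psi : hecke_diagram_action Gam H) :
  (forall n : nat, (\dim {:D} < n)%N ->
     lmod_iso (HP n (extended_hecke psi)) (HC n (extended_hecke psi)) /\
     lmod_iso (HC n (extended_hecke psi))
              (HC n (group_algebra R[i] (extended_weyl Gam)))) /\
  (forall n : nat, bijective (HP_map (extended_inclusion psi) n)).
Proof.
have charK n : n.+1%:R != 0 :> R[i] by rewrite pnatr_eq0.
exact: (pbw_comparison charK (extended_elt1 psi) (extended_eltM psi)
  (extended_pbw psi) (@extended_comm _ _ _ _ _ _ psi)).
Qed.
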